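(* Let $n\wedge p\wedge q\to\infty$. Suppose that $X$ and $Y$ are independent (null hypothesis $H_0$) and that $$\frac{E[U(X,X')^4]}{\sqrt n\,(E[U(X,X')^2])^2}\to0,\qquad\frac{E[U(X,X')U(X',X'')U(X'',X''')U(X''',X)]}{(E[U(X,X')^2])^2}\to0,$$ and that the same two conditions hold with $(U,X)$ replaced by $(V,Y)$. Then $$\sqrt{\binom n2}\;\frac{uCov_n^2(\mathbf X,\mathbf Y)}{\mathcal S}\overset{d}{\to}N(0,1),\qquad\text{where }\mathcal S^2=E[U(X,X')^2]\,E[V(Y,Y')^2].$$
   Context: Setting. For each $p,q$, $(X,Y)$ is a pair of random vectors $X=(x_1,\dots,x_p)^T\in\mathbb R^p$, $Y=(y_1,\dots,y_q)^T\in\mathbb R^q$ (whose law may depend on $p,q$). $(X_1,Y_1),\dots,(X_n,Y_n)$ are i.i.d. copies of $(X,Y)$, with $X_s=(x_{s1},\dots,x_{sp})^T$, $Y_s=(y_{s1},\dots,y_{sq})^T$; $\mathbf X=(X_1,\dots,X_n)^T$, $\mathbf Y=(Y_1,\dots,Y_n)^T$. $(X',Y'),(X'',Y''),(X''',Y''')$ are further independent copies of $(X,Y)$. $\mathcal U$-centering. For an $n\times n$ matrix $\mathbf A=(a_{st})$ with zero diagonal, $\widetilde{\mathbf A}=(\tilde a_{st})$ has $\tilde a_{ss}=0$ and, for $s\neq t$, $\tilde a_{st}=a_{st}-\frac1{n-2}\sum_{v}a_{sv}-\frac1{n-2}\sum_{u}a_{ut}+\frac1{(n-1)(n-2)}\sum_{u,v}a_{uv}$;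 $(\widetilde{\mathbf A}\cdot\widetilde{\mathbf B})=\frac1{n(n-3)}\sum_{s\ne t}\tilde a_{st}\tilde b_{st}$. Let $k,l$ be symmetric bivariate kernels on $\mathbb R$. For $s\neq t$ put $k_{st}(i)=k(x_{si},x_{ti})-E[k(x_{si},x_{ti})|x_{si}]-E[k(x_{si},x_{ti})|x_{ti}]+E[k(x_{si},x_{ti})]$ and $l_{st}(j)=l(y_{sj},y_{tj})-E[l(y_{sj},y_{tj})|y_{sj}]-E[l(y_{sj},y_{tj})|y_{tj}]+E[l(y_{sj},y_{tj})]$. Let $\mathbf K(i)=(k_{st}(i))$, $\mathbf L(j)=(l_{st}(j))$ with zero diagonals and $uCov_n^2(\mathbf X,\mathbf Y)=\frac1{\sqrt{pq}}\sum_{i=1}^p\sum_{j=1}^q(\widetilde{\mathbf K}(i)\cdot\widetilde{\mathbf L}(j))$. $U(X_s,X_t)=\frac1{\sqrt p}\sum_{i=1}^pk_{st}(i)$, $V(Y_s,Y_t)=\frac1{\sqrt q}\sum_{j=1}^ql_{st}(j)$; this defines the functions $U(\cdot,\cdot)$, $V(\cdot,\cdot)$. *)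

(* Defs.v *)
From HB Require Import structures.
From mathcomp Require Import all_boot all_order all_algebra.
From mathcomp Require Import finmap.
From mathcomp Require Import all_classical all_reals all_analysis.

Set Implicit Arguments.
Unset Strict Implicit.
Unset Printing Implicit Defensive.

Import Order.TTheory GRing.Theory Num.Theory.
Import numFieldNormedType.Exports.

Local Open Scope classical_set_scope.
Local Open Scope ring_scope.

Section Independence.
Context (R : realType) (d : measure_display) (Omega : measurableType d).
Variable P : probability Omega R.

Definition independent_pair d1 d2 (T1 : measurableType d1)
    (T2 : measurableType d2) (X : Omega -> T1) (Y : Omega -> T2) : Prop :=
  forall (A : set T1) (B : set T2), measurable A -> measurable B ->
    P (X @^-1` A `&` Y @^-1` B) = (P (X @^-1` A) * P (Y @^-1` B))%E.

Definition mutually_independent d' (T : measurableType d')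
    (Z : nat -> Omega -> T) : Prop :=
  forall (J : {fset nat}) (B : nat -> set T), (forall s, measurable (B s)) ->
    P (\bigcap_(s in [set` J]) (Z s @^-1` B s)) =
    (\prod_(s <- J) P (Z s @^-1` B s))%E.

Definition identically_distributed d' (T : measurableType d')
    (Z : nat -> Omega -> T) : Prop :=
  forall s t (B : set T), measurable B -> P (Z s @^-1` B) = P (Z t @^-1` B).

Definition iid d' (T : measurableType d') (Z : nat -> Omega -> T) : Prop :=
  mutually_independent Z /\ identically_distributed Z.

(* [g] is a version of u |-> E[h | xi = u], i.e. E[h | xi] = g(xi) a.s. *)
Definition is_condE (h xi : Omega -> R) (g : R -> R) : Prop :=
  [/\ measurable_fun setT g,
      P.-integrable setT (fun w => (g (xi w))%:E) &
      forall A : set R, measurable A ->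
        (\int[P]_(w in xi @^-1` A) (g (xi w))%:E =
         \int[P]_(w in xi @^-1` A) (h w)%:E)%E].

(* A chosen version of u |-> E[h | xi = u]; for integrable h it is unique up to
   a null set of the law of xi (it is 0 by convention if no version exists). *)
Definition condE (h xi : Omega -> R) : R -> R :=
  xget (cst 0) [set g | is_condE h xi g].

End Independence.

(* Convergence of the distribution functions at every continuity point of the
   limit; each T i lives on its own probability space. *)
Definition cvg_in_distribution (R : realType) (I : Type) (F : set_system I)
    (d : I -> measure_display) (Omega : forall i, measurableType (d i))
    (P : forall i, probability (Omega i) R) (T : forall i, Omega i -> R)
    (nu : probability (measurableTypeR R) R) : Prop :=
  forall x : R, {for x, continuous (fun y : R => nu `]-oo, y]%classic)} ->
    P i [set w | T i w <= x] @[i --> F] --> nu `]-oo, x]%classic.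

Section UCentering.
Context (R : realType) (n : nat).

Definition ucenter (A : 'M[R]_n) : 'M[R]_n :=
  \matrix_(s, t) if s == t then 0 else
    A s t - (n%:R - 2)^-1 * (\sum_v A s v) - (n%:R - 2)^-1 * (\sum_u A u t)
    + ((n%:R - 1) * (n%:R - 2))^-1 * (\sum_u \sum_v A u v).

Definition uprod (A B : 'M[R]_n) : R :=
  (n%:R * (n%:R - 3))^-1 * \sum_s \sum_(t | s != t) A s t * B s t.

End UCentering.

Section CenteredKernels.
Context (R : realType) (d : measure_display) (Omega : measurableType d).
Context (P : probability Omega R) (m : nat).
Variables (k : R -> R -> R) (X : nat -> {RV P >-> m.-tuple R}).

(* [coord s i] is x_si, the i-th coordinate of X_s. *)
Definition coord (s : nat) (i : 'I_m) (w : Omega) : R := tnth (X s w) i.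

Definition kpair (i : 'I_m) (w : Omega) : R :=
  k (coord 0%N i w) (coord 1%N i w).

(* The function with k_st(i) = kcenter i x_si x_ti.  For an i.i.d. sequence X
   the law of (x_si, x_ti) is the same for all s <> t, so that the (conditional)
   expectations are computed from the pair s = 0, t = 1. *)
Definition kcenter (i : 'I_m) (u v : R) : R :=
  k u v - condE P (kpair i) (coord 0%N i) u - condE P (kpair i) (coord 1%N i) v
  + fine ('E_P[kpair i])%E.

Definition kmat (n : nat) (i : 'I_m) (w : Omega) : 'M[R]_n :=
  \matrix_(s, t) if s == t then 0 else kcenter i (coord s i w) (coord t i w).

Definition Ufun (x x' : m.-tuple R) : R :=
  (Num.sqrt m%:R)^-1 * \sum_(i < m) kcenter i (tnth x i) (tnth x' i).

(* In the moments below X, X', X'', X''' are the first four terms of the i.i.d.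
   sequence: only their joint law matters. *)
Definition EU2 : \bar R :=
  ('E_P[fun w => (Ufun (X 0%N w) (X 1%N w) ^+ 2)%R])%E.

Definition EU4 : \bar R :=
  ('E_P[fun w => (Ufun (X 0%N w) (X 1%N w) ^+ 4)%R])%E.

Definition EUcycle : \bar R :=
  ('E_P[fun w => (Ufun (X 0%N w) (X 1%N w) * Ufun (X 1%N w) (X 2%N w)
                  * Ufun (X 2%N w) (X 3%N w) * Ufun (X 3%N w) (X 0%N w))%R])%E.

(* Existence of the expectations that enter [kcenter]. *)
Definition kernel_integrable : Prop :=
  forall i : 'I_m, P.-integrable setT (fun w => (kpair i w)%:E).

End CenteredKernels.

Section Statistic.
Context (R : realType) (d : measure_display) (Omega : measurableType d).
Context (P : probability Omega R) (p q : nat).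
Variables (k l : R -> R -> R).
Variables (X : nat -> {RV P >-> p.-tuple R}) (Y : nat -> {RV P >-> q.-tuple R}).

(* The sample is (X_0, Y_0), ..., (X_(n-1), Y_(n-1)). *)
Definition uCov2 (n : nat) (w : Omega) : R :=
  (Num.sqrt (p%:R * q%:R))^-1 * \sum_(i < p) \sum_(j < q)
    uprod (ucenter (kmat k X n i w)) (ucenter (kmat l Y n j w)).

Definition Sscale : R := Num.sqrt (fine (EU2 k X) * fine (EU2 l Y)).

End Statistic.

(* Main.v *)
(* Put h_st = U(X_s, X_t) V(Y_s, Y_t) / S and W = sum_(s < t) h_st / sqrt 'C(n, 2).
   Since the U-centered matrices have zero row sums, the statistic differs from W
   only by a multiple of W and by products of row sums, whose second moments are
   O(1/n).  For W the normal limit follows from Stein's method: if f solves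
   f'(x) - x f(x) = g(x) and A_s is the part of W that involves the s-th
   observation, then E[A_s f(W - A_s)] = 0 by degeneracy of U and V, and W is half
   the sum of the A_s, so that a Taylor expansion turns E[W f(W)] into
   E[f'(W) Q] with Q = (1/2) sum_s A_s^2.  Here E[Q] = 1, and E[Q^2] - 1 only
   involves the 4-cycle moment and fourth moments divided by n.  Logistic
   functions approximate the indicators of half-lines by such smooth g. *)
Require Import Defs.
From HB Require Import structures.
From mathcomp Require Import all_boot all_order all_algebra.
From mathcomp Require Import finmap.
From mathcomp Require Import all_classical all_reals all_analysis.
From mathcomp Require Import measurable_realfun ring lra.

Set Implicit Arguments.
Unset Strict Implicit.
Unset Printing Implicit Defensive.

Import Order.TTheory GRing.Theory Num.Theory.
Import numFieldNormedType.Exports.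

Local Open Scope classical_set_scope.
Local Open Scope ring_scope.

(** The conditions on U and V act only through products. The two samples are independent, so E[h^4]
    = E[U^4] E[V^4] / S^4, and E[h^4] / n is the product of the two fourth-moment ratios: this is
    the origin of the sqrt n in each of them. The 4-cycle moment of h factorises likewise. The main
    estimates are explicit inequalities for fixed n, p, q, which is why an arbitrary filter is
    allowed. They contain a free parameter lam > 0, from |x| <= lam + x^2 / lam in place of
    Cauchy-Schwarz: lam is fixed small, then all terms with lam^-1 tend to 0. The delicate point is
    degeneracy. The kernels are centred with chosen versions of conditional expectations, so
    E[U(x, X')] = 0 is available only off a null set of x, and the Fubini arguments carry that set
    along. Symmetry of the centred kernel, in contrast, holds everywhere, because both conditional
    expectations are chosen from one and the same set of versions. The moments of h obey one
    combinatorial rule: a product of entries has mean 0 as soon as some index occurs in exactly one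
    factor. *)

Section Stein.
Context (R : realType).
Local Notation phi := (@normal_pdf R 0 1).

(** * The standard normal density and the growth of solutions of Stein's equation *)

Lemma normal_pdf01E (x : R) : phi x = normal_peak 1 * expR (- (x ^+ 2 / 2)).
Proof.
rewrite normal_pdfE ?oner_neq0// /normal_fun subr0 expr1n mulNr.
by rewrite -[1 *+ 2]/(1%:R *+ 2) mulr2n.
Qed.

Lemma normal_pdf01_gt0 (x : R) : 0 < phi x.
Proof. by rewrite normal_pdf01E mulr_gt0 ?expR_gt0// normal_peak_gt0// oner_neq0. Qed.

Lemma is_derive_normal_pdf01 (x : R) : is_derive x 1 phi (- x * phi x).
Proof.
have -> : phi = (fun x => normal_peak 1 * expR (- (x ^+ 2 / 2))).
  by apply/funext => y; rewrite normal_pdf01E.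
have H : is_derive x 1 (fun y : R => - (y ^+ 2 / 2)) (- x).
  by apply: is_derive_eq; rewrite !scaler0 add0r /GRing.scale/=; field.
have H2 := @is_derive1_comp R expR (fun y : R => - (y ^+ 2 / 2)) x _ _ _ H.
have H3 := H2 _ (is_derive_expR _).
apply: (is_derive_eq (is_deriveZ (normal_peak 1) H3)).
rewrite /GRing.scale/=; ring.
Qed.

Lemma normal_pdf01_cvgy : phi x @[x --> +oo%R] --> (0 : R).
Proof.
apply/cvgrPdist_le => e e0.
near=> x.
rewrite sub0r normrN gtr0_norm ?normal_pdf01_gt0// normal_pdf01E expRN.
have x2 : 2 * (normal_peak 1 / e) <= x.
  by near: x; apply: nbhs_pinfty_ge; rewrite num_real.
rewrite ler_pdivrMr ?expR_gt0//.
apply: (@le_trans _ _ (e * (1 + x ^+ 2 / 2))); last first.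
  by rewrite ler_pM2l// expR_ge1Dx// ?divr_ge0 ?sqr_ge0//.
rewrite -ler_pdivrMl// mulrC; nra.
Unshelve. all: by end_near. Qed.

Lemma le_of_ge0_derive (v dv : R -> R) (a x y : R) :
  (forall z : R, is_derive z 1 v (dv z)) -> (forall z, a <= z -> 0 <= dv z) ->
  a <= x -> x <= y -> v x <= v y.
Proof.
move=> Hd H0 ax xy.
have cv : {within `[x, y], continuous v}.
  apply: derivable_within_continuous => z _; exact: ex_derive.
have [c cxy ->] : exists2 c, c \in `[x, y] & v y = v x + dv c * (y - x).
  have [c cxy E] := MVT_segment xy (fun z _ => Hd z) cv.
  by exists c => //; rewrite -E; ring.
rewrite lerDl mulr_ge0 ?subr_ge0//; apply: H0.
by move: cxy; rewrite in_itv/= => /andP[+ _]; apply: le_trans.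
Qed.

(* Comparison with the supersolution [K / x0]: the function
   [(u - K / x0) * phi] is nondecreasing on [x0, +oo[ and vanishes at +oo. *)
Lemma stein_tail_le (u du : R -> R) (K x0 : R) :
  (forall x : R, is_derive x 1 u (du x)) ->
  (forall x, `|du x - x * u x| <= K) ->
  u x * phi x @[x --> +oo%R] --> (0 : R) -> 0 < x0 -> x0 * u x0 <= K.
Proof.
move=> Hu HK u0 x00.
have K0 : 0 <= K by apply: le_trans (HK 0); exact: normr_ge0.
pose v x := (u x - K / x0) * phi x.
pose dv x := (du x - x * u x + x * K / x0) * phi x.
have Hv (z : R) : is_derive z 1 v (dv z).
  have h1 : is_derive z 1 (fun x => u x - K / x0) (du z).
    by apply: (is_derive_eq (is_deriveB (Hu z) (is_derive_cst (K / x0) z 1))); rewrite subr0.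
  apply: (is_derive_eq (is_deriveM h1 (is_derive_normal_pdf01 z))).
  rewrite /dv /GRing.scale/=; ring.
have dv0 z : x0 <= z -> 0 <= dv z.
  move=> xz; apply: mulr_ge0; last exact/ltW/normal_pdf01_gt0.
  have := HK z; rewrite ler_norml => /andP[+ _].
  have : K <= z * K / x0 by rewrite ler_pdivlMr// mulrC ler_wpM2r.
  lra.
have v0 : v x @[x --> +oo%R] --> (0 : R).
  have -> : v = (fun x => u x * phi x - (K / x0) * phi x).
    by apply/funext => x; rewrite /v mulrBl.
  rewrite -[X in _ --> X](subr0 (0 : R)) -[X in _ --> _ - X](mulr0 (K / x0)).
  apply: cvgB => //; apply: cvgM; [exact: cvg_cst|exact: normal_pdf01_cvgy].
have : v x0 <= 0.
  apply: (cvgr_to_ge v0).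
  apply: filterS (nbhs_pinfty_ge (num_real x0)) => y xy.
  exact: (le_of_ge0_derive Hv dv0).
rewrite /v pmulr_lle0 ?normal_pdf01_gt0// subr_le0 ler_pdivlMr//.
by rewrite mulrC.
Qed.

(** The hypotheses survive [u -> - u] and the reflection [x -> - x], so the one-sided bound on the
    positive axis yields all cases. It serves twice below: for the Stein solution and for its
    derivative. *)
Lemma stein_tail (u du : R -> R) (K : R) :
  (forall x : R, is_derive x 1 u (du x)) ->
  (forall x, `|du x - x * u x| <= K) ->
  u x * phi x @[x --> +oo%R] --> (0 : R) ->
  u x * phi x @[x --> -oo%R] --> (0 : R) ->
  forall x, `|x * u x| <= K.
Proof.
have pos (v dv : R -> R) : (forall x : R, is_derive x 1 v (dv x)) ->
    (forall x, `|dv x - x * v x| <= K) ->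
    v x * phi x @[x --> +oo%R] --> (0 : R) ->
    forall x, 0 < x -> `|x * v x| <= K.
  move=> Hv HK v0 x x0; rewrite ler_norml; apply/andP; split; last first.
    exact: (stein_tail_le Hv).
  rewrite lerNl -mulrN; apply: (@stein_tail_le (fun y => - v y) (fun y => - dv y)) => //.
    by move=> y; rewrite mulrN -opprB normrN opprK addrC.
  have -> : (fun y => - v y * phi y) = (- (fun y => v y * phi y)) by apply/funext => y; rewrite mulNr.
  by have := cvgN v0; rewrite oppr0; apply.
move=> Hu HK uy uNy x; case: (ltgtP x 0) => [x0|x0|->].
- rewrite -normrN -mulNr -[in u x](opprK x).
  apply: (pos (fun y => u (- y)) (fun y => - du (- y))); rewrite ?oppr_gt0//.
  + move=> y.
    have h : is_derive y 1 (fun y : R => - y) (-1 : R) by apply: is_derive_eq.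
    have h2 : is_derive y 1 (fun y => u (- y)) (du (- y) * -1).
      exact: (@is_derive1_comp R u _ y _ _ (Hu (- y)) h).
    by apply: (is_derive_eq h2); rewrite mulrN1.
  + by move=> y; have := HK (- y); rewrite mulNr opprK -normrN opprD.
  + move/cvgNy_compNP : uNy; apply: cvg_trans; apply: near_eq_cvg.
    by near=> y; rewrite /= !normal_pdf01E sqrrN.
- exact: pos Hu HK uy _ x0.
- by rewrite mul0r normr0; apply: le_trans (HK 0); exact: normr_ge0.
Unshelve. all: by end_near. Qed.

End Stein.

(** * Integrability of real-valued functions *)

Section RealIntegration.
Context d (T : measurableType d) (R : realType) (mu : {measure set T -> \bar R}).
Local Notation intble f := (mu.-integrable setT (EFin \o f)).

Lemma intble_ext (f g : T -> R) : f =1 g -> intble f -> intble g.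
Proof. by move=> /funext ->. Qed.

Lemma intbleD (f g : T -> R) : intble f -> intble g -> intble (fun x => f x + g x).
Proof. by move=> hf hg; exact: (integrableD _ hf hg). Qed.

Lemma intbleB (f g : T -> R) : intble f -> intble g -> intble (fun x => f x - g x).
Proof. by move=> hf hg; exact: (integrableB _ hf hg). Qed.

Lemma intbleZ (c : R) (f : T -> R) : intble f -> intble (fun x => c * f x).
Proof. by move=> hf; exact: (integrableZl _ c hf). Qed.

Lemma intble0 : intble (fun=> 0).
Proof. exact: integrable0. Qed.

Lemma intble_sum (J : Type) (r : seq J) (A : pred J) (f : J -> T -> R) :
  (forall j, A j -> intble (f j)) -> intble (fun x => \sum_(j <- r | A j) f j x).
Proof.
move=> hf; elim: r => [|j r IH].
  by apply: intble_ext intble0 => x; rewrite big_nil.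
have [Aj|nAj] := boolP (A j).
  apply: intble_ext (intbleD (hf j Aj) IH) => x; by rewrite big_cons Aj.
by apply: intble_ext IH => x; rewrite big_cons (negbTE nAj).
Qed.

Lemma Rintegral_sum (J : Type) (r : seq J) (A : pred J) (f : J -> T -> R) :
  (forall j, A j -> intble (f j)) ->
  \int[mu]_x (\sum_(j <- r | A j) f j x) = \sum_(j <- r | A j) \int[mu]_x f j x.
Proof.
move=> hf; elim: r => [|j r IH].
  rewrite big_nil; under eq_Rintegral do rewrite big_nil.
  by rewrite /Rintegral integral0.
rewrite big_cons; case: ifPn => Aj.
  under eq_Rintegral do rewrite big_cons Aj.
  rewrite RintegralD ?IH//; [exact: hf|exact: intble_sum].
by under eq_Rintegral do rewrite big_cons (negbTE Aj).
Qed.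

Lemma intble_measurable (f : T -> R) : intble f -> measurable_fun setT f.
Proof. by move=> /measurable_int/measurable_EFinP. Qed.

Lemma intble_le (f g : T -> R) : measurable_fun setT f -> intble g ->
  (forall x, `|f x| <= g x) -> intble f.
Proof.
move=> mf ig fg; apply: le_integrable ig => //; first exact/measurable_EFinP.
by move=> x _ /=; rewrite lee_fin (le_trans (fg x))// ler_norm.
Qed.

Lemma intbleM_bounded (f g : T -> R) (K : R) : intble f -> measurable_fun setT g ->
  (forall x, `|g x| <= K) -> intble (fun x => f x * g x).
Proof.
move=> hf mg gK; apply: (@intble_le _ (fun x => K * `|f x|)).
- by apply: measurable_funM => //; exact: intble_measurable.
- by apply: intbleZ; exact: integrable_norm.
- by move=> x; rewrite normrM mulrC ler_wpM2r.
Qed.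

End RealIntegration.

Section ProbabilityIntegration.
Context (R : realType).

Lemma probability_fine d (T : measurableType d) (P : probability T R) :
  fine (P setT) = 1.
Proof. by rewrite probability_setT. Qed.

Lemma bounded_integrable d (T : measurableType d) (P : probability T R) (f : T -> R) (K : R) :
  measurable_fun setT f -> (forall x, `|f x| <= K) -> P.-integrable setT (EFin \o f).
Proof.
move=> mf fK; apply: measurable_bounded_integrable => //.
  by apply: (le_lt_trans (probability_le1 P measurableT)); rewrite ltry.
exists K; split; first exact: num_real.
by move=> M KM x _ /=; apply: le_trans (fK x) (ltW KM).
Qed.

End ProbabilityIntegration.

(** * The bounded solution of Stein's equation *)

Section SteinSolution.
Context (R : realType).
Local Notation phi := (@normal_pdf R 0 1).
Local Notation mu := (@lebesgue_measure R).

Lemma integrable_bounded_normal (g : R -> R) (K : R) (D : set (measurableTypeR R)) : measurable D ->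
  measurable_fun setT g -> (forall x, `|g x| <= K) ->
  mu.-integrable D (EFin \o (fun x => g x * phi x)).
Proof.
move=> mD mg gK; apply: (@integrableS _ _ _ _ setT) => //.
apply: (@le_integrable _ (measurableTypeR R) R mu setT measurableT _ (fun x : R => (K * phi x)%:E)) => //.
- apply/measurable_EFinP; apply: measurable_funM => //; exact: measurable_normal_pdf.
- move=> x _ /=; rewrite lee_fin !normrM ler_wpM2r//.
  by rewrite [leRHS]ger0_norm//; apply: le_trans (gK x).
- under [X in integrable _ _ X]eq_fun do rewrite EFinM.
  by apply: integrableZl => //; exact: integrable_normal_pdf.
Qed.

Lemma normal_primitive_le (g : R -> R) (K : R) (D : set (measurableTypeR R)) : measurable D ->
  measurable_fun setT g -> (forall x, `|g x| <= K) ->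
  `|\int[mu]_(x in D) (g x * phi x)| <= K * fine (normal_prob 0 1 D).
Proof.
move=> mD mg gK; have iD := integrable_bounded_normal mD mg gK.
apply: (le_trans (le_normr_Rintegral mD iD)).
have -> : fine (normal_prob 0 1 D) = \int[mu]_(x in D) phi x by [].
have iphi : mu.-integrable D (EFin \o phi).
  by apply: (@integrableS _ _ _ _ setT) => //; exact: integrable_normal_pdf.
rewrite -RintegralZl//; apply: le_Rintegral => //.
- exact: integrable_norm.
- under [X in integrable _ _ X]eq_fun do rewrite /= EFinM.
  exact: integrableZl.
- by move=> x _; rewrite normrM (ger0_norm (normal_pdf_ge0 _ _ _)) ler_wpM2r// normal_pdf_ge0.
Qed.

(** The identity, seen as a random variable under [normal_prob 0 1], has the normal law; the general
    limits of distribution functions at infinity then apply to the normal one. *)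
Let idTR : measurableTypeR R -> R := idfun.

#[local] HB.instance Definition _ :=
  @isMeasurableFun.Build _ _ _ _ idTR (@measurable_id _ _ setT).

Lemma normal_cdfNy : fine (normal_prob 0 1 `]-oo, x]%classic) @[x --> -oo%R] --> (0 : R).
Proof.
have := cvg_cdfNy0 (idTR : {RV (normal_prob 0 1 : probability (measurableTypeR R) R) >-> R}).
by move=> /fine_cvgP[].
Qed.

Lemma normal_ccdfy : fine (normal_prob 0 1 `]x, +oo[%classic) @[x --> +oo%R] --> (0 : R).
Proof.
have := cvg_ccdfy0 (idTR : {RV (normal_prob 0 1 : probability (measurableTypeR R) R) >-> R}).
by move=> /fine_cvgP[].
Qed.

(** The solution is the primitive of [g * phi] from -oo, divided by [phi]. Because [g] has normal
    mean 0, [f * phi] vanishes at both ends, so [stein_tail] bounds [x * f x] and with it [df].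
    Differentiating the equation shows that [df] solves Stein's equation with right-hand side
    [dg + f], and the same argument bounds [ddf]. *)
Lemma stein_solution (g dg : R -> R) (K : R) :
  (forall x : R, is_derive x 1 g (dg x)) ->
  (forall x, `|g x| <= K) -> (forall x, `|dg x| <= K) ->
  \int[mu]_x (g x * phi x) = 0 ->
  exists f df ddf : R -> R, exists C : R,
    [/\ forall x : R, is_derive x 1 f (df x), forall x : R, is_derive x 1 df (ddf x),
      forall x, [/\ `|f x| <= C, `|df x| <= C & `|ddf x| <= C] &
      forall x, df x - x * f x = g x].
Proof.
move=> Hg gK dgK g0.
have cg : continuous g.
  by move=> x; apply: differentiable_continuous; apply/derivable1_diffP; exact: ex_derive.
have mg : measurable_fun setT g by exact: continuous_measurable_fun.
pose F (x : R) := \int[mu]_(t in `]-oo, x]) (g t * phi t).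
have HF (x : R) : is_derive x 1 F (g x * phi x).
  have [||||dF <-] := @continuous_FTC1 R (fun t => g t * phi t) -oo%O x (x + 1).
  - by rewrite ltrDl.
  - exact: integrable_bounded_normal mg gK.
  - by rewrite ltNye.
  - apply: cvgM; [exact: cg|apply: continuous_normal_pdf; exact: oner_neq0].
  - by split; [exact: dF|rewrite derive1E].
have phi0 x : phi x != 0 by rewrite gt_eqF// normal_pdf01_gt0.
pose f x := F x / phi x.
have Hf (x : R) : is_derive x 1 f (g x + x * f x).
  have hV := is_deriveV (phi0 x) (is_derive_normal_pdf01 x).
  apply: (is_derive_eq (is_deriveM (HF x) hV)).
  by rewrite /f /GRing.scale/=; field; exact: phi0.
have fphi x : f x * phi x = F x by rewrite /f divfK.
have fNy : f x * phi x @[x --> -oo%R] --> (0 : R).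
  under eq_fun do rewrite fphi.
  apply/norm_cvg0P; apply: (@squeeze_cvgr _ _ _ _ (cst 0) (fun x => K * fine (normal_prob 0 1 `]-oo, x]%classic))).
  - by near=> x; rewrite /cst normr_ge0/=; apply: normal_primitive_le.
  - exact: cvg_cst.
  - rewrite -[X in _ --> X](mulr0 K); apply: cvgM; [exact: cvg_cst|exact: normal_cdfNy].
have fy : f x * phi x @[x --> +oo%R] --> (0 : R).
  under eq_fun do rewrite fphi.
  apply/norm_cvg0P; apply: (@squeeze_cvgr _ _ _ _ (cst 0) (fun x => K * fine (normal_prob 0 1 `]x, +oo[%classic))).
  - near=> x; rewrite /cst normr_ge0/=.
    (* The total integral is 0, so the primitive is also minus the integral over the right tail,
       which is small at +oo. *)
    have -> : F x = - \int[mu]_(t in `]x, +oo[) (g t * phi t).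
      apply/eqP; rewrite -addr_eq0 /F -Rintegral_setU//.
      + by rewrite -itv_bndbnd_setU// set_itvNyy g0.
      + by apply: integrable_bounded_normal mg gK; exact: measurableU.
      + rewrite disj_set2E; apply/eqP; rewrite -subset0 => y [] /=.
        by rewrite !in_itv/= andbT leNgt => /negP.
    rewrite normrN; exact: normal_primitive_le.
  - exact: cvg_cst.
  - rewrite -[X in _ --> X](mulr0 K); apply: cvgM; [exact: cvg_cst|exact: normal_ccdfy].
have xf : forall x, `|x * f x| <= K.
  by apply: (stein_tail Hf) => // x; rewrite addrK.
have K0 : 0 <= K by apply: le_trans (gK 0); exact: normr_ge0.
have dfb x : `|g x + x * f x| <= 2 * K.
  by apply: (le_trans (ler_normD _ _)); rewrite mulr_natl mulr2n lerD.
have cf : continuous f.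
  by move=> x; apply: differentiable_continuous; apply/derivable1_diffP; exact: ex_derive.
(* For |x| <= 1 the mean value theorem compares [f x] with [f 0]; for |x| > 1 the bound on [x * f x]
   is stronger than the one wanted. *)
pose C0 := `|f 0| + 2 * K.
have near0 x : `|x| <= 1 -> `|f x - f 0| <= 2 * K.
  move=> x1.
  have H a b : a <= b -> `|b - a| <= 1 -> `|f b - f a| <= 2 * K.
    move=> ab ab1.
    have [|c _ ->] := @MVT_segment R f _ a b ab (fun z _ => Hf z).
      exact: continuous_subspaceT.
    rewrite normrM -[leRHS]mulr1; apply: ler_pM => //; exact: dfb.
  have [x0|x0] := leP 0 x; first by apply: H => //; rewrite subr0.
  by rewrite distrC; apply: H; [exact: ltW|rewrite sub0r normrN].
have fC x : `|f x| <= C0.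
  have [x1|x1] := leP `|x| 1.
    rewrite /C0 addrC -lerBlDr; apply: le_trans (near0 x x1); exact: lerB_dist.
  have xfK := xf x; rewrite normrM in xfK.
  apply: (@le_trans _ _ K); last by rewrite /C0; have := normr_ge0 (f 0); lra.
  apply: le_trans xfK; rewrite ler_peMl//; exact: ltW.
pose df x := g x + x * f x.
pose ddf x := dg x + (f x + x * df x).
have Hdf (x : R) : is_derive x 1 df (ddf x).
  have h := is_deriveM (is_derive_id x 1) (Hf x).
  apply: (is_derive_eq (is_deriveD (Hg x) h)).
  by rewrite /ddf /df /GRing.scale/=; ring.
have phiNy : phi x @[x --> -oo%R] --> (0 : R).
  apply/cvgNy_compNP; apply: cvg_trans (@normal_pdf01_cvgy R); apply: near_eq_cvg.
  by near=> y; rewrite /= !normal_pdf01E sqrrN.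
have bnd0 (G : set_system R) : ProperFilter G -> phi x @[x --> G] --> (0 : R) ->
    df x * phi x @[x --> G] --> (0 : R).
  move=> PG G0; apply/norm_cvg0P.
  apply: (@squeeze_cvgr _ _ _ _ (cst 0) (fun x => (2 * K) * phi x)).
  - near=> x; rewrite /cst normr_ge0/= normrM.
    by rewrite (ger0_norm (normal_pdf_ge0 _ _ _)) ler_wpM2r ?normal_pdf_ge0//; exact: dfb.
  - exact: cvg_cst.
  - by rewrite -[X in _ --> X](mulr0 (2 * K)); apply: cvgM => //; exact: cvg_cst.
(* The right-hand side of the equation for [df] is [dg + f], bounded by [K + C0]. *)
have xdf : forall x, `|x * df x| <= K + C0.
  apply: (stein_tail Hdf).
  - move=> x; rewrite /ddf addrA addrK; apply: (le_trans (ler_normD _ _)); exact: lerD.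
  - exact: bnd0 (@normal_pdf01_cvgy R).
  - exact: bnd0 phiNy.
have C00 : 0 <= C0 by apply: le_trans (fC 0); exact: normr_ge0.
(* The constant is dictated by [ddf = dg + (f + x * df)], at most [K + C0 + (K + C0)]; it dominates
   the bounds for [f] and [df]. *)
exists f, df, ddf, (2 * (K + C0)); split => //.
- move=> x; split.
  + by apply: (le_trans (fC x)); lra.
  + by apply: (le_trans (dfb x)); lra.
  + apply: (le_trans (ler_normD _ _)).
    have := ler_normD (f x) (x * df x); have := fC x; have := xdf x; have := dgK x; lra.
- by move=> x; rewrite /df addrK.
Unshelve. all: by end_near. Qed.

End SteinSolution.

(** * Smooth approximation of indicators of half-lines *)

Section StepApproximation.
Context (R : realType).

(* A logistic function centred at [a], of slope [(eta * delta)^-1]. *)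
Lemma smooth_step (a delta eta : R) : 0 < delta -> 0 < eta ->
  exists s ds : R -> R, exists K : R,
    [/\ forall x : R, is_derive x 1 s (ds x),
        forall x, [/\ 0 <= s x, s x <= 1 & `|ds x| <= K],
        forall x, x <= a - delta -> 1 - eta <= s x &
        forall x, a + delta <= x -> s x <= eta].
Proof.
move=> d0 e0.
pose k := (eta * delta)^-1; have k0 : 0 < k by rewrite invr_gt0 mulr_gt0.
pose E x := expR (k * (x - a)).
have Eg0 x : 0 < E x by exact: expR_gt0.
have E1 x : 1 + E x != 0 by rewrite gt_eqF// addr_gt0.
pose s x := (1 + E x)^-1.
pose ds x := - (k * (E x / (1 + E x)) * s x).
have s0 x : 0 <= s x by rewrite invr_ge0 ltW// addr_gt0.
have s1 x : s x <= 1 by rewrite invf_le1 ?addr_gt0// lerDl ltW.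
have HE (x : R) : is_derive x 1 E (k * E x).
  have h : is_derive x 1 (fun y : R => k * (y - a)) k.
    by apply: is_derive_eq; rewrite /GRing.scale/=; ring.
  by apply: (is_derive_eq (@is_derive1_comp R expR _ x _ _ (is_derive_expR _) h)); rewrite mulrC.
(* At distance [delta] from the centre the exponent is 1/eta, and exp(1/eta) >= 1 + 1/eta >= 1/eta;
   hence the error there is at most [eta]. *)
have delta_tail : k * delta = eta^-1 by rewrite /k; field; rewrite !gt_eqF.
have exp_small : expR (- eta^-1) <= eta.
  rewrite expRN invf_ple ?posrE ?expR_gt0//.
  by apply: le_trans (expR_ge1Dx _); lra.
exists s, ds, k; split.
- move=> x.
  have h : is_derive x 1 (fun y => 1 + E y) (k * E x).
    by apply: (is_derive_eq (is_deriveD (is_derive_cst (1 : R) x 1) (HE x))); rewrite add0r.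
  have h2 := @is_deriveV R (fun y => 1 + E y) x _ 1 (E1 x) h.
  apply: (is_derive_eq h2).
  by rewrite /ds /s /GRing.scale/=; field.
- move=> x; split => //.
  have r0 : 0 <= E x / (1 + E x) by apply: divr_ge0; apply: ltW; rewrite ?addr_gt0.
  have r1 : E x / (1 + E x) <= 1 by rewrite ler_pdivrMr ?addr_gt0// mul1r lerDr.
  have kk := ltW k0; rewrite /ds normrN ger0_norm; last by do 2?[apply: mulr_ge0 => //].
  have rs : E x / (1 + E x) * s x <= 1 by apply: mulr_ile1.
  by rewrite -[leLHS]mulrA -[leRHS]mulr1 ler_pM2l.
- move=> x xa.
  have Ex : E x <= eta.
    apply: le_trans exp_small; rewrite ler_expR -delta_tail -mulrN ler_pM2l//; lra.
  rewrite /s -[leRHS]mul1r ler_pdivlMr ?addr_gt0//.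
  have := Eg0 x; nra.
- move=> x xa.
  apply: le_trans exp_small; rewrite expRN /s lef_pV2 ?posrE ?expR_gt0 ?addr_gt0//.
  rewrite -[leLHS]add0r lerD// ler_expR -delta_tail ler_pM2l//; lra.
Qed.

End StepApproximation.

(** * From centred smooth test functions to convergence in distribution *)

Section Sandwich.
Context (R : realType).
Local Notation phi := (@normal_pdf R 0 1).
Local Notation mu := (@lebesgue_measure R).

Lemma Rintegral_indic d (T : measurableType d) (P : probability T R) (A : set T) :
  measurable A -> \int[P]_x (\1_A x : R) = fine (P A).
Proof. by move=> mA; rewrite /Rintegral integral_indic// setIT. Qed.

(** The indicator of ]-oo, x] lies, up to a small error, between two logistic functions centred at
    [x - delta] and [x + delta]. Their expectations converge to normal means, and these are close to
    the normal distribution function at [x] by its continuity there. *)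
Lemma cvg_normal_of_smooth (I : Type) (F : set_system I) (FF : ProperFilter F)
  (d : I -> measure_display) (Omega : forall i, measurableType (d i))
  (P : forall i, probability (Omega i) R) (T : forall i, Omega i -> R) :
  (forall i, measurable_fun setT (T i)) ->
  (forall (g dg : R -> R) (K : R), (forall x : R, is_derive x 1 g (dg x)) ->
     (forall x, `|g x| <= K) -> (forall x, `|dg x| <= K) ->
     \int[mu]_x (g x * phi x) = 0 ->
     \int[P i]_w g (T i w) @[i --> F] --> (0 : R)) ->
  cvg_in_distribution F P T (normal_prob 0 1).
Proof.
move=> mT HT x cx.
pose Phi y := fine (normal_prob 0 1 (`]-oo, y]%classic : set (measurableTypeR R))).
have PhiE y : normal_prob 0 1 (`]-oo, y]%classic : set (measurableTypeR R)) = (Phi y)%:E.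
  by rewrite fineK// fin_num_measure.
pose p i := fine (P i [set w | T i w <= x]).
have mA i : measurable [set w | T i w <= x].
  rewrite -[X in measurable X]setTI; have := mT i measurableT `]-oo, x]%classic (measurable_itv _).
  by congr (measurable _); apply/seteqP; split => w /=; rewrite in_itv.
have pE i : P i [set w | T i w <= x] = (p i)%:E by rewrite fineK// fin_num_measure.
suff H : P i [set w | T i w <= x] @[i --> F] --> (Phi x)%:E by move: H; rewrite -PhiE; exact.
under eq_fun do rewrite pE.
apply: cvg_EFin; first by apply: nearW.
apply/cvgrPdist_le => e e0.
have step (a delta eta : R) : 0 < delta -> 0 < eta ->
  exists s : R -> R, exists m : R, [/\
    measurable_fun setT s,
    forall x, 0 <= s x <= 1,
    forall x, x <= a - delta -> 1 - eta <= s x,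
    forall x, a + delta <= x -> s x <= eta &
    [/\ Phi (a - delta) - eta <= m, m <= Phi (a + delta) + eta &
     \forall i \near F, `|\int[P i]_w s (T i w) - m| <= eta]].
  move=> d0 eta0; have [s [ds [K [Hs sb sl sr]]]] := smooth_step a d0 eta0.
  have cs : continuous s.
    by move=> y; apply: differentiable_continuous; apply/derivable1_diffP; exact: ex_derive.
  have ms : measurable_fun setT s by exact: continuous_measurable_fun.
  have s01 y : 0 <= s y <= 1 by have [-> -> _] := sb y.
  have sn y : `|s y| <= 1 by have [h1 h2 _] := sb y; rewrite ger0_norm.
  pose m := \int[mu]_y (s y * phi y).
  have iphi : mu.-integrable setT (EFin \o phi) by exact: integrable_normal_pdf.
  have isphi : mu.-integrable setT (EFin \o (fun y => s y * phi y)).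
    exact: integrable_bounded_normal ms sn.
  have phi1 : \int[mu]_y phi y = 1 by rewrite /Rintegral integral_normal_pdf.
  have irest b : mu.-integrable setT (EFin \o (phi \_ `]-oo, b])).
    rewrite -restrict_EFin; apply/integrable_restrict => //; rewrite setTI.
    by apply: (@integrableS _ _ _ _ setT).
  have iec : mu.-integrable setT (EFin \o (fun y => eta * phi y)).
    exact: intbleZ.
  have PhiR b : Phi b = \int[mu]_y (phi \_ `]-oo, b]) y by rewrite -Rintegral_mkcond.
  have etaR : eta = \int[mu]_y (eta * phi y) by rewrite RintegralZl// phi1 mulr1.
  have p0 y : 0 <= phi y by exact: normal_pdf_ge0.
  have mlow : Phi (a - delta) - eta <= m.
    rewrite PhiR etaR -RintegralB//; apply: le_Rintegral => //.
      exact: intbleB.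
    move=> y _; rewrite patchE; case: ifPn => [|_].
      rewrite inE/= in_itv/= => ya; have := ler_wpM2r (p0 y) (sl y ya); lra.
    have /andP[h1 _] := s01 y; have := mulr_ge0 h1 (p0 y); have := mulr_ge0 (ltW eta0) (p0 y).
    by rewrite /point/=; lra.
  have mup : m <= Phi (a + delta) + eta.
    rewrite PhiR etaR -RintegralD//; apply: le_Rintegral => //.
      exact: intbleD.
    move=> y _; rewrite patchE; case: ifPn => [_|].
      by have /andP[_ h1] := s01 y; have := ler_wpM2r (p0 y) h1; have := mulr_ge0 (ltW eta0) (p0 y); lra.
    rewrite notin_setE/= in_itv/= => /negP; rewrite -ltNge => /ltW ya.
    by rewrite /point/=; have := ler_wpM2r (p0 y) (sr y ya); lra.
  exists s, m; split => //; split => //.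
  have m1 : `|m| <= 1.
    have := normal_primitive_le (@measurableT _ (measurableTypeR R)) ms sn.
    by rewrite mul1r probability_setT.
  have g0 : \int[mu]_y ((s y - m) * phi y) = 0.
    under eq_Rintegral do rewrite mulrBl.
    have im : mu.-integrable setT (EFin \o (fun y => m * phi y)).
      exact: intbleZ.
    by rewrite RintegralB// RintegralZl// phi1 mulr1 subrr.
  have K0 : 0 <= K by have [_ _] := sb 0; apply: le_trans; exact: normr_ge0.
  have /cvgrPdist_le /(_ _ eta0) : \int[P i]_w (s (T i w) - m) @[i --> F] --> (0 : R).
    apply: (HT (fun y => s y - m) ds (2 + K)) => //.
    - move=> y; apply: (is_derive_eq (is_deriveB (Hs y) (is_derive_cst m y 1))).
      by rewrite subr0.
    - move=> y; apply: (le_trans (ler_normB _ _)); have := sn y; lra.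
    - move=> y; have [_ _] := sb y; lra.
  apply: filterS => i.
  have iS : (P i).-integrable setT (EFin \o (s \o T i)).
    apply: (@bounded_integrable _ _ _ _ _ 1); last by move=> w; exact: sn.
    exact: (measurableT_comp ms (mT i)).
  rewrite RintegralB//; last exact: finite_measure_integrable_cst.
  by rewrite Rintegral_cst// probability_fine mulr1 sub0r normrN.
have [delta d0 hd] : exists2 delta : R, 0 < delta &
    Phi (x + 2 * delta) <= Phi x + e / 4 /\ Phi x - e / 4 <= Phi (x - 2 * delta).
  have cx' : Phi y @[y --> x] --> Phi x.
    have h : normal_prob 0 1 (`]-oo, y]%classic : set (measurableTypeR R)) @[y --> x] --> (Phi x)%:E.
      by rewrite -PhiE; exact: cx.
    exact: (fine_cvg h).
  have e4 : 0 < e / 4 by rewrite divr_gt0.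
  move/cvgrPdist_le : cx' => /(_ _ e4) /nbhs_ballP[r /= r0 hr].
  exists (r / 4); first by rewrite divr_gt0.
  have h1 : `|Phi x - Phi (x + 2 * (r / 4))| <= e / 4.
    by apply: hr; rewrite /ball/= opprD addrA subrr sub0r normrN ger0_norm; lra.
  have h2 : `|Phi x - Phi (x - 2 * (r / 4))| <= e / 4.
    by apply: hr; rewrite /ball/= opprB addrCA subrr addr0 ger0_norm; lra.
  by move: h1 h2; rewrite !ler_norml => /andP[? ?] /andP[? ?]; split; lra.
(* Error budget: three errors of e/8 (step against indicator, convergence of the mean, mean against
   distribution function) and e/4 for the continuity of [Phi] remain below e. *)
have eta0 : 0 < e / 8 by rewrite divr_gt0.
(* Shifting the centre by [delta] makes [s1] nearly 1 on all of ]-oo, x] and [s2] nearly 0 on all of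
   [x, +oo[. *)
have [s1 [m1 [ms1 b1 l1 r1 [lo1 up1 n1]]]] := step (x + delta) delta (e / 8) d0 eta0.
have [s2 [m2 [ms2 b2 l2 r2 [lo2 up2 n2]]]] := step (x - delta) delta (e / 8) d0 eta0.
have is_ i (s : R -> R) : measurable_fun setT s -> (forall y, 0 <= s y <= 1) ->
    (P i).-integrable setT (EFin \o (fun w => s (T i w))).
  move=> ms sb; apply: (@bounded_integrable _ _ _ _ _ 1).
    exact: (measurableT_comp ms (mT i)).
  by move=> w; have /andP[h1 h2] := sb (T i w); rewrite ger0_norm.
have i1 i : (P i).-integrable setT (EFin \o \1_[set w | T i w <= x]).
  exact: integrable_indic.
have ic i : (P i).-integrable setT (EFin \o (cst (e / 8))).
  exact: finite_measure_integrable_cst.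
have eR i : e / 8 = \int[P i]_w (cst (e / 8) w) by rewrite Rintegral_cst// probability_fine mulr1.
have up i : p i <= \int[P i]_w s1 (T i w) + e / 8.
  rewrite /p -Rintegral_indic// (eR i) -RintegralD//; last exact: is_.
  apply: le_Rintegral => //.
    by apply: intbleD => //; exact: is_.
  move=> w _; rewrite indicE; have /andP[? ?] := b1 (T i w).
  case: (boolP (w \in _)) => [|_]; last by rewrite /=; lra.
  by rewrite inE/= => wx; have := l1 (T i w); rewrite addrK => /(_ wx); lra.
have lo i : \int[P i]_w s2 (T i w) - e / 8 <= p i.
  rewrite /p -Rintegral_indic// (eR i) -RintegralB//; last exact: is_.
  apply: le_Rintegral => //.
    by apply: intbleB => //; exact: is_.
  move=> w _; rewrite indicE; have /andP[? ?] := b2 (T i w).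
  case: (boolP (w \in _)) => [_|]; first by rewrite /=; lra.
  rewrite notin_setE/= => /negP; rewrite -ltNge => /ltW wx.
  by have := r2 (T i w); rewrite subrK => /(_ wx); lra.
near=> i.
have := up i; have := lo i.
have : `|\int[P i]_w s1 (T i w) - m1| <= e / 8 by near: i.
have : `|\int[P i]_w s2 (T i w) - m2| <= e / 8 by near: i.
move: lo1 up1 lo2 up2 hd; rewrite addrK subrK.
have -> : x + delta + delta = x + 2 * delta by ring.
have -> : x - delta - delta = x - 2 * delta by ring.
rewrite /= ler_norml => ? ? ? ? [? ?].
by rewrite !ler_norml => /andP[? ?] /andP[? ?] ? ?; apply/andP; split; lra.
Unshelve. all: by end_near. Qed.

End Sandwich.

(** * Finite measures on tuples are determined by boxes *)

Section Boxes.
Context d (T : measurableType d) (m : nat).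

Definition box (B : 'I_m -> set T) : set (m.-tuple T) :=
  [set x | forall i, B i (tnth x i)].

Definition boxes : set (set (m.-tuple T)) :=
  [set box B | B in [set B | forall i, measurable (B i)]].

Lemma measurable_box (B : 'I_m -> set T) :
  (forall i, measurable (B i)) -> measurable (box B).
Proof.
move=> mB.
have -> : box B = \bigcap_(i in [set: 'I_m]) ((fun x => tnth x i) @^-1` B i).
  by apply/seteqP; split => x /= h; [move=> i _; exact: h|move=> i; exact: h].
apply: fin_bigcap_measurable => // i _.
by rewrite -[X in measurable X]setTI; exact: measurable_tnth.
Qed.

(** The product sigma-algebra is generated by preimages under single coordinates, and each of these
    is a box with at most one nontrivial side. *)
Lemma measurable_tuple_boxes : @measurable _ (m.-tuple T) = <<s boxes >>.
Proof.
apply/seteqP; split; last first.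
  apply: smallest_sub; first exact: sigma_algebra_measurable.
  by move=> _ [B mB <-]; exact: measurable_box.
apply: sub_sigma_algebra2 => A; rewrite -bigcup_seq => -[i /= _ [B mB <-]].
exists (fun j => if j == i then B else setT) => [j|]; first by case: ifP.
rewrite setTI; apply/seteqP; split => x /=.
  by move=> /(_ i); rewrite eqxx.
by move=> Bx j; case: eqP => [->|].
Qed.

Lemma setI_closed_boxes : setI_closed boxes.
Proof.
move=> _ _ [A mA <-] [B mB <-]; exists (fun i => A i `&` B i).
  by move=> i; exact: measurableI.
apply/seteqP; split => x /= h; first by split => i; have [] := h i.
by move=> i; case: h => hA hB; split; [exact: hA|exact: hB].
Qed.

(** Uniqueness of measures on a generating class closed under intersection. The whole space is
    itself a box, so finiteness of the total mass provides the required exhaustion. *)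
Lemma measure_eq_boxes (R : realType) (m1 m2 : {measure set (m.-tuple T) -> \bar R}) :
  (m1 setT < +oo)%E ->
  (forall B, (forall i, measurable (B i)) -> m1 (box B) = m2 (box B)) ->
  forall A, measurable A -> m1 A = m2 A.
Proof.
move=> m1oo h A mA.
apply: (measure_unique boxes (fun=> setT)) => //.
- exact: measurable_tuple_boxes.
- exact: setI_closed_boxes.
- move=> _; exists (fun=> setT) => //.
  by apply/seteqP; split.
- by apply/seteqP; split => // x _; exists 0%N.
- by move=> _ [B mB <-]; exact: h.
Qed.

End Boxes.

(** * Fubini for a pair of independent random elements *)

Section IndependentPair.
Context d d1 d2 (Omega : measurableType d) (T1 : measurableType d1)
  (T2 : measurableType d2) (R : realType) (P : probability Omega R).

Lemma independent_pair_sym (X : Omega -> T1) (Y : Omega -> T2) :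
  independent_pair P X Y -> independent_pair P Y X.
Proof. by move=> h A B mA mB; rewrite setIC h// muleC. Qed.

Variables (X : {mfun Omega >-> T1}) (Y : {mfun Omega >-> T2}).

Lemma measurable_mfun_preimage d' (T' : measurableType d') (Z : {mfun Omega >-> T'}) A :
  measurable A -> measurable (Z @^-1` A).
Proof. by move=> mA; rewrite -[X in measurable X]setTI; exact: measurable_funP. Qed.

Let XY : Omega -> T1 * T2 := fun w => (X w, Y w).

Let measurable_XY : measurable_fun setT XY.
Proof. by apply: measurable_fun_pair; exact: measurable_funP. Qed.

HB.instance Definition _ := isMeasurableFun.Build _ _ _ _ XY measurable_XY.

Hypothesis indXY : independent_pair P X Y.

Lemma distribution_pair (A : set (T1 * T2)) : measurable A ->
  (distribution P X \x distribution P Y)%E A = distribution P XY A.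
Proof.
move=> mA.
by apply: (@product_measure_unique _ _ _ _ _ (distribution P X) (distribution P Y) (distribution P XY)).
Qed.

Local Notation intble mu f := (integrable mu setT (EFin \o f)).

Lemma intble_distribution d' (T' : measurableType d') (Z : {mfun Omega >-> T'}) (f : T' -> R) :
  measurable_fun setT f ->
  intble (distribution P Z) f <-> intble P (fun w => f (Z w)).
Proof.
move=> mf; have mEf : measurable_fun setT (EFin \o f) by exact/measurable_EFinP.
have mEfZ : measurable_fun setT (EFin \o (fun w => f (Z w))).
  apply/measurable_EFinP; exact: measurableT_comp.
have E : (\int[distribution P Z]_x `|(f x)%:E| = \int[P]_w `|(f (Z w))%:E|)%E.
  rewrite ge0_integral_pushforward//.
  by apply: measurableT_comp.
by split => /integrableP[_ h]; apply/integrableP; split => //; rewrite ?E// -E.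
Qed.

Lemma Rintegral_distribution d' (T' : measurableType d') (Z : {mfun Omega >-> T'}) (f : T' -> R) :
  measurable_fun setT f -> intble P (fun w => f (Z w)) ->
  \int[distribution P Z]_x f x = \int[P]_w f (Z w).
Proof.
move=> mf ifZ; rewrite /Rintegral integral_pushforward//; exact/measurable_EFinP.
Qed.

Lemma intble_pair (G : T1 * T2 -> R) : measurable_fun setT G ->
  intble P (fun w => G (X w, Y w)) ->
  intble (distribution P X \x distribution P Y)%E G.
Proof.
move=> mG iG.
have mEG : measurable_fun setT (EFin \o G) by exact/measurable_EFinP.
have h : intble (distribution P XY) G by apply: integrable_pushforward.
move/integrableP : h => [h1 h2]; apply/integrableP; split => //.
apply: le_lt_trans h2; rewrite le_eqVlt; apply/orP; left; apply/eqP.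
by apply: eq_measure_integral => A mA _; exact: distribution_pair.
Qed.

Section fubini.
Variable G : T1 * T2 -> R.
Hypotheses (mG : measurable_fun setT G) (iG : intble P (fun w => G (X w, Y w))).

Let mEG : measurable_fun setT (EFin \o G).
Proof. exact/measurable_EFinP. Qed.

Let iGprod := intble_pair mG iG.

Let EG : (\int[P]_w (G (X w, Y w))%:E =
  \int[distribution P X]_x \int[distribution P Y]_y (G (x, y))%:E)%E.
Proof.
rewrite -/(fubini_F _ _) (integral12_prod_meas1 iGprod).
transitivity (\int[distribution P XY]_z (G z)%:E)%E.
  by rewrite integral_pushforward.
by apply: eq_measure_integral => A mA _; apply/esym; exact: distribution_pair.
Qed.

(* Only almost every fibre has to be centred: [N] is the exceptional set. *)
Lemma expectation_fibre0 (N : set T1) : measurable N -> P (X @^-1` N) = 0%E ->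
  (forall x, ~ N x -> \int[P]_w G (x, Y w) = 0) ->
  \int[P]_w G (X w, Y w) = 0.
Proof.
move=> mN PN G0; rewrite /Rintegral EG.
have [M [mM PM hM]] : {ae distribution P X, forall x,
    (distribution P Y).-integrable setT (fun y => (G (x, y))%:E)}.
  exact: (ae_integrable1 iGprod).
suff -> : (\int[distribution P X]_x \int[distribution P Y]_y (G (x, y))%:E)%E = 0%E by [].
rewrite (negligible_integral (measurableU _ _ mM mN)) //; last 2 first.
- exact: (integrable_fubini_F iGprod).
- apply/eqP; rewrite eq_le measure_ge0 andbT.
  apply: (le_trans (measureU2 _ mM mN)).
  have PM' : P (X @^-1` M) = 0%E by exact: PM.
  suff : (P (X @^-1` M) + P (X @^-1` N) <= 0)%E by [].
  by rewrite PM' PN adde0.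
apply: integral0_eq => x [_ /= /not_orP[Mx Nx]].
have mx : measurable_fun setT (fun y => G (x, y)) by exact: measurableT_comp.
have ix : (distribution P Y).-integrable setT (EFin \o (fun y => G (x, y))).
  by apply: contrapT => h; apply: Mx; exact: hM.
have := integrable_fin_num measurableT ix.
move=> /fineK <-; congr EFin.
have := Rintegral_distribution mx ((intble_distribution Y mx).1 ix).
by rewrite (G0 x Nx) /Rintegral.
Qed.

End fubini.

(** Both factors are merely integrable, so no Hölder inequality applies; by Tonelli on the product
    law the integral of the absolute value factorises. *)
Lemma intble_indep_mul (f : T1 -> R) (g : T2 -> R) :
  measurable_fun setT f -> measurable_fun setT g ->
  intble P (fun w => f (X w)) -> intble P (fun w => g (Y w)) ->
  intble P (fun w => f (X w) * g (Y w)).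
Proof.
move=> mf mg iF iG.
have mfg : measurable_fun setT (fun z : T1 * T2 => f z.1 * g z.2).
  by apply: measurable_funM; apply: measurableT_comp.
have mE : measurable_fun setT (EFin \o (fun z : T1 * T2 => f z.1 * g z.2)) by exact/measurable_EFinP.
have /= := intble_distribution _ mfg; rewrite /XY => /(_ XY) [+ _]; apply.
apply/integrableP; split => //.
rewrite (eq_measure_integral (distribution P X \x distribution P Y)%E); last first.
  by move=> A mA _; apply/esym; exact: distribution_pair.
rewrite fubini_tonelli1//; last exact: measurableT_comp.
have iY : (\int[distribution P Y]_y `|(g y)%:E| < +oo)%E.
  by have /integrableP[] := (intble_distribution Y mg).2 iG.
have iX : (\int[distribution P X]_x `|(f x)%:E| < +oo)%E.
  by have /integrableP[] := (intble_distribution X mf).2 iF.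
have IY0 : (0 <= \int[distribution P Y]_y `|(g y)%:E|)%E by exact: integral_ge0.
rewrite [ltLHS](_ : _ = (\int[distribution P X]_x (`|(f x)%:E| * \int[distribution P Y]_y `|(g y)%:E|))%E); last first.
  apply: eq_integral => x _; rewrite /fubini_F /=.
  under eq_integral do rewrite normrM EFinM.
  by rewrite ge0_integralZl//; apply/measurable_EFinP; exact: measurableT_comp.
rewrite ge0_integralZr//=; last by apply/measurable_EFinP; exact: measurableT_comp.
by rewrite lte_mul_pinfty ?integral_ge0// ge0_fin_numE// integral_ge0.
Qed.

Lemma expectation_indep_mul (f : T1 -> R) (g : T2 -> R) :
  measurable_fun setT f -> measurable_fun setT g ->
  intble P (fun w => f (X w)) -> intble P (fun w => g (Y w)) ->
  \int[P]_w (f (X w) * g (Y w)) = (\int[P]_w f (X w)) * (\int[P]_w g (Y w)).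
Proof.
move=> mf mg iF iG.
pose c := \int[P]_w g (Y w).
have iFG := intble_indep_mul mf mg iF iG.
have cst_ic k : intble P (fun=> k) by exact: finite_measure_integrable_cst.
have iFc : intble P (fun w => f (X w) * c).
  by apply: intble_ext (intbleZ c iF) => w; rewrite mulrC.
(* After subtracting the constant [c] from the second factor every fibre is centred, and
   [expectation_fibre0] applies with the empty exceptional set. *)
suff : \int[P]_w (f (X w) * (g (Y w) - c)) = 0.
  under eq_Rintegral do rewrite mulrBr.
  rewrite RintegralB// RintegralZr// => /eqP; rewrite subr_eq0 => /eqP ->.
  by [].
apply: (@expectation_fibre0 (fun z => f z.1 * (g z.2 - c)) _ _ set0) => //.
- apply: measurable_funM; first exact: measurableT_comp.
  apply: measurable_funB => //; exact: measurableT_comp.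
- apply: intble_ext (intbleB iFG iFc) => w; by rewrite mulrBr.
- by rewrite preimage_set0 measure0.
- move=> x _ /=; rewrite RintegralZl//; last exact: intbleB.
  by rewrite RintegralB// Rintegral_cst// probability_fine mulr1 subrr mulr0.
Qed.

End IndependentPair.

(** * Independence and laws of tuples taken from a sequence *)

Section IndependentTuples.
Context d (Omega : measurableType d) (R : realType) (P : probability Omega R).

(** For fixed [A] both sides are finite measures in [S]: the restriction of [P] to [A] pushed
    forward by [Z], and the law of [Z] scaled by the mass of [A]. They agree on boxes. *)
Lemma indep_event_tuple d1 (T : measurableType d1) m (A : set Omega)
    (Z : {mfun Omega >-> m.-tuple T}) : measurable A ->
  (forall B, (forall i, measurable (B i)) ->
     P (A `&` Z @^-1` box B) = (P A * P (Z @^-1` box B))%E) ->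
  forall S, measurable S -> P (A `&` Z @^-1` S) = (P A * P (Z @^-1` S))%E.
Proof.
move=> mA h S mS.
have PA0 : 0 <= fine (P A) by rewrite fine_ge0.
pose m1_ : {measure set (m.-tuple T) -> \bar R} := pushforward (mrestr P mA) Z.
pose m1 := m1_ (measurable_funPT Z).
pose m2 : {measure set (m.-tuple T) -> \bar R} := mscale (NngNum PA0) (distribution P Z).
have m1E B : m1 B = P (A `&` Z @^-1` B) by rewrite setIC.
have m2E B : m2 B = (P A * P (Z @^-1` B))%E.
  by rewrite /m2 /= /mscale/= fineK// fin_num_measure.
rewrite -m1E -m2E; apply: measure_eq_boxes => //.
- rewrite m1E; apply: (le_lt_trans (probability_le1 P _)); rewrite ?ltry//.
  by apply: measurableI => //; exact: measurable_mfun_preimage.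
- by move=> B mB; rewrite m1E m2E; exact: h.
Qed.

(** The extension from boxes to measurable sets is done one component at a time, the event of the
    other component being held fixed. *)
Lemma independent_pair_tuples d1 d2 (T1 : measurableType d1) (T2 : measurableType d2)
    m1 m2 (Z1 : {mfun Omega >-> m1.-tuple T1}) (Z2 : {mfun Omega >-> m2.-tuple T2}) :
  (forall B1 B2, (forall i, measurable (B1 i)) -> (forall i, measurable (B2 i)) ->
     P (Z1 @^-1` box B1 `&` Z2 @^-1` box B2) =
     (P (Z1 @^-1` box B1) * P (Z2 @^-1` box B2))%E) ->
  independent_pair P Z1 Z2.
Proof.
move=> h S1 S2 mS1 mS2.
apply: indep_event_tuple => //; first exact: measurable_mfun_preimage.
move=> B2 mB2; rewrite setIC muleC; apply: indep_event_tuple => //.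
  by apply: measurable_mfun_preimage; exact: measurable_box.
by move=> B1 mB1; rewrite setIC muleC; exact: h.
Qed.

Context d1 (T : measurableType d1).
Variable Z : nat -> {mfun Omega >-> T}.

Definition sample_tuple m (tau : 'I_m -> nat) (w : Omega) : m.-tuple T :=
  [tuple Z (tau i) w | i < m].

Let measurable_sample_tuple m (tau : 'I_m -> nat) : measurable_fun setT (sample_tuple tau).
Proof.
apply/measurable_fun_tnthP => i.
rewrite (_ : _ \o _ = Z (tau i)); first exact: measurable_funP.
by apply/funext => w; rewrite /= tnth_mktuple.
Qed.

HB.instance Definition _ m (tau : 'I_m -> nat) :=
  isMeasurableFun.Build _ _ _ _ (sample_tuple tau) (@measurable_sample_tuple m tau).

Hypothesis indZ : mutually_independent P (fun s => Z s).

Lemma prob_sample_tuple_box m (tau : 'I_m -> nat) (B : 'I_m -> set T) :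
  injective tau -> (forall i, measurable (B i)) ->
  P (sample_tuple tau @^-1` box B) = (\prod_(i < m) P (Z (tau i) @^-1` B i))%E.
Proof.
move=> tau_inj mB.
pose J := seq_fset tt (map tau (index_enum 'I_m)).
(* Mutual independence is indexed by observations, the box by positions; [C] transports the sides
   along the injective [tau], with the trivial side elsewhere. *)
pose C s := if [pick i | tau i == s] is Some i then B i else setT.
have CE i : C (tau i) = B i.
  rewrite /C; case: pickP => [j /eqP/tau_inj -> //|/(_ i)]; by rewrite eqxx.
have mC s : measurable (C s) by rewrite /C; case: pickP.
have := indZ J mC.
have -> : (\prod_(s <- J) P (Z s @^-1` C s) = \prod_(i < m) P (Z (tau i) @^-1` B i))%E.
  rewrite (perm_big (map tau (index_enum 'I_m))).
    by rewrite big_map; apply: eq_bigr => i _; rewrite CE.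
  apply: uniq_perm; [exact: fset_uniq|by rewrite map_inj_uniq// index_enum_uniq|].
  by move=> s; rewrite seq_fsetE.
move=> <-; congr (P _); apply/seteqP; split => w /=.
  move=> h s; rewrite /= seq_fsetE => /mapP[i _ ->] /=.
  by rewrite CE; have := h i; rewrite tnth_mktuple.
move=> h i; rewrite tnth_mktuple; have := h (tau i).
by rewrite /= seq_fsetE CE; apply; apply: map_f; rewrite mem_index_enum.
Qed.

(** Disjoint injective selections concatenate to one injective selection, whose box probability is a
    product over both groups of positions. *)
Lemma indep_sample_tuple m1 m2 (tau1 : 'I_m1 -> nat) (tau2 : 'I_m2 -> nat) :
  injective tau1 -> injective tau2 -> (forall i j, tau1 i <> tau2 j) ->
  independent_pair P (sample_tuple tau1) (sample_tuple tau2).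
Proof.
move=> inj1 inj2 dis; apply: independent_pair_tuples => B1 B2 mB1 mB2.
pose tau (i : 'I_(m1 + m2)) := match fintype.split i with inl j => tau1 j | inr k => tau2 k end.
pose B (i : 'I_(m1 + m2)) := match fintype.split i with inl j => B1 j | inr k => B2 k end.
have taul j : tau (lshift m2 j) = tau1 j.
  by rewrite /tau; case: splitP => [k /= /val_inj <-//|k /= E]; have := ltn_ord j; rewrite E ltnNge leq_addr.
have taur k : tau (rshift m1 k) = tau2 k.
  by rewrite /tau; case: splitP => [j /= E|j /= /addnI/val_inj <-//]; have := ltn_ord j; rewrite -E ltnNge leq_addr.
have Bl j : B (lshift m2 j) = B1 j.
  by rewrite /B; case: splitP => [k /= /val_inj <-//|k /= E]; have := ltn_ord j; rewrite E ltnNge leq_addr.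
have Br k : B (rshift m1 k) = B2 k.
  by rewrite /B; case: splitP => [j /= E|j /= /addnI/val_inj <-//]; have := ltn_ord j; rewrite -E ltnNge leq_addr.
have mB i : measurable (B i) by rewrite /B; case: (fintype.split i).
have inj : injective tau.
  move=> i j; rewrite /tau -{2}(fintype.splitK i) -{2}(fintype.splitK j).
  case: (fintype.split i) => a; case: (fintype.split j) => b.
  - by move=> /inj1 ->.
  - by move=> /dis.
  - by move=> /esym/dis.
  - by move=> /inj2 ->.
rewrite !prob_sample_tuple_box//.
rewrite [RHS](_ : _ = (\prod_(i < m1 + m2) P (Z (tau i) @^-1` B i))%E); last first.
  by rewrite big_split_ord /=; congr (_ * _)%E; apply: eq_bigr => i _; rewrite ?taul ?Bl ?taur ?Br.
rewrite -prob_sample_tuple_box//; congr (P _); apply/seteqP; split => w /=.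
  move=> [h1 h2] i; rewrite tnth_mktuple /tau /B.
  by case: (fintype.split i) => j; [have := h1 j|have := h2 j]; rewrite tnth_mktuple.
move=> h; split => j; rewrite tnth_mktuple.
  by have := h (lshift m2 j); rewrite tnth_mktuple taul Bl.
by have := h (rshift m1 j); rewrite tnth_mktuple taur Br.
Qed.

Hypothesis idZ : identically_distributed P (fun s => Z s).

(** Box probabilities are products of marginal probabilities, which are the same for all indices; so
    the law of the tuple does not depend on which distinct observations are selected. *)
Lemma law_sample_tuple m (tau tau' : 'I_m -> nat) (f : m.-tuple T -> R) :
  injective tau -> injective tau' -> measurable_fun setT f ->
  integrable P setT (EFin \o (fun w => f (sample_tuple tau w))) ->
  integrable P setT (EFin \o (fun w => f (sample_tuple tau' w))) /\
  \int[P]_w f (sample_tuple tau' w) = \int[P]_w f (sample_tuple tau w).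
Proof.
move=> inj inj' mf itau.
have law A : measurable A -> distribution P (sample_tuple tau) A = distribution P (sample_tuple tau') A.
  apply: measure_eq_boxes => [|B mB].
    apply: (le_lt_trans (probability_le1 _ _)); rewrite ?ltry//.
  suff : P (sample_tuple tau @^-1` box B) = P (sample_tuple tau' @^-1` box B) by [].
  rewrite !prob_sample_tuple_box//.
  by apply: eq_bigr => i _; exact: idZ.
have iD := (intble_distribution P (sample_tuple tau) mf).2 itau.
have iD' : integrable (distribution P (sample_tuple tau')) setT (EFin \o f).
  move/integrableP : iD => [h1 h2]; apply/integrableP; split => //.
  apply: le_lt_trans h2; rewrite le_eqVlt; apply/orP; left; apply/eqP.
  by apply: eq_measure_integral => A mA _; solve [exact: law | apply/esym; exact: law].
have itau' := (intble_distribution P (sample_tuple tau') mf).1 iD'.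
split=> //.
rewrite -!Rintegral_distribution//; congr fine.
by apply: eq_measure_integral => A mA _; solve [exact: law | apply/esym; exact: law].
Qed.

End IndependentTuples.

(** * Versions of conditional expectations *)

Section ConditionalExpectation.
Context d (Omega : measurableType d) (R : realType) (P : probability Omega R).
Local Notation intble f := (integrable P setT (EFin \o f)).

Lemma integral_setE (f : Omega -> R) (D : set Omega) : measurable D -> intble f ->
  (\int[P]_(w in D) (f w)%:E = (\int[P]_w (\1_D w * f w))%:E)%E.
Proof.
move=> mD fi.
have iD : P.-integrable D (EFin \o f) by apply: (integrableS measurableT).
rewrite -(fineK (integrable_fin_num mD iD)); congr EFin.
rewrite -/(Rintegral P D f) Rintegral_mkcond; apply: eq_Rintegral => w _.
by rewrite patchE indicE; case: (w \in D); rewrite ?mul1r ?mul0r.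
Qed.

Lemma intble_indicM (f : Omega -> R) (D : set Omega) : measurable D -> intble f ->
  intble (fun w => \1_D w * f w).
Proof.
move=> mD fi.
have : intble (fun w => f w * \1_D w).
  apply: (@intbleM_bounded _ _ _ _ _ _ 1) => //.
  by move=> x; rewrite indicE; case: (x \in D); rewrite /= ?normr1 ?normr0.
by apply: intble_ext => w; rewrite mulrC.
Qed.

(** The defining identities say that [g] and [g'] have equal integrals over every measurable set
    under the law of [xi]. *)
Lemma condE_unique (h : Omega -> R) (xi : {mfun Omega >-> R}) (g g' : R -> R) :
  is_condE P h xi g -> is_condE P h xi g' ->
  exists2 N, measurable N /\ P (xi @^-1` N) = 0%E & forall u, ~ N u -> g u = g' u.
Proof.
move=> [mg ig Hg] [mg' ig' Hg'].
have mEg : measurable_fun setT (EFin \o g) by exact/measurable_EFinP.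
have mEg' : measurable_fun setT (EFin \o g') by exact/measurable_EFinP.
have [] := @integral_ae_eq _ _ _ (distribution P xi) setT measurableT
   (EFin \o g) (EFin \o g') => //.
- exact: ((intble_distribution P xi mg').2 ig').
- move=> E _ mE; rewrite !integral_pushforward//.
  + by rewrite (Hg' _ mE) (Hg _ mE).
  + apply: (integrableS measurableT) => //; exact: measurable_mfun_preimage.
  + apply: (integrableS measurableT) => //; exact: measurable_mfun_preimage.
- move=> N [mN PN hN]; exists N; first by split.
  move=> u Nu; apply: contrapT => gg; apply: Nu; apply: hN => /= /(_ Logic.I) [] /esym.
  exact: gg.
Qed.

(** Under independence, integrating out the second variable gives a version. This provides both the
    existence that [condE] needs and a concrete formula valid off a null set. *)
Lemma condE_fubini (k : R -> R -> R) (xi0 xi1 : {mfun Omega >-> R}) :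
  measurable_fun setT (fun z : R * R => k z.1 z.2) ->
  independent_pair P xi0 xi1 ->
  intble (fun w => k (xi0 w) (xi1 w)) ->
  exists h : R -> R, is_condE P (fun w => k (xi0 w) (xi1 w)) xi0 h /\
  exists2 N, measurable N /\ P (xi0 @^-1` N) = 0%E &
    forall u, ~ N u -> intble (fun w => k u (xi1 w)) /\
       \int[P]_w k u (xi1 w) = h u.
Proof.
move=> mk ind ik.
pose K (z : R * R) := k z.1 z.2.
have iK := intble_pair ind mk ik.
pose D0 := distribution P xi0; pose D1 := distribution P xi1.
pose H := fubini_F D1 (EFin \o K).
have mH : measurable_fun setT H by exact: measurable_fubini_F iK.
have iH : integrable D0 setT H by exact: integrable_fubini_F iK.
have [N [mN PN hN]] : {ae D0, forall u, D1.-integrable setT (fun v => (K (u, v))%:E)}.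
  exact: (ae_integrable1 iK).
pose h u := fine (H u).
have mh : measurable_fun setT h by apply: measurableT_comp.
have ih : intble (fun w => h (xi0 w)).
  apply/(intble_distribution P xi0 mh).
  apply: le_integrable iH => //; first exact/measurable_EFinP.
  by move=> x _; rewrite /h /=; case: (H x) => [r| |] /=; rewrite ?leey ?lexx.
have hE u : ~ N u -> intble (fun w => k u (xi1 w)) /\ \int[P]_w k u (xi1 w) = h u.
  move=> Nu.
  have mku : measurable_fun setT (k u).
    by apply: (measurableT_comp mk (measurable_pair1 _)) .
  have iu : D1.-integrable setT (EFin \o k u).
    by apply: contrapT => h'; apply: Nu; exact: hN.
  have iu' := (intble_distribution P xi1 mku).1 iu.
  by split=> //; rewrite -Rintegral_distribution.
exists h; split; last by exists N.
split => // A mA.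
have mxA : measurable (xi0 @^-1` A) by exact: measurable_mfun_preimage.
rewrite !integral_setE//.
have i1 := intble_indicM mxA ih.
have i2 := intble_indicM mxA ik.
congr EFin.
apply/esym/eqP; rewrite -subr_eq0; apply/eqP; rewrite -RintegralB//.
(* The defining identity over [A] is E[G] = 0; off [N] each fibre of [G] is a constant times a
   centred function. *)
pose G (z : R * R) := (\1_A z.1 : R) * (k z.1 z.2 - h z.1).
transitivity (\int[P]_w G (xi0 w, xi1 w)).
  by apply: eq_Rintegral => w _; rewrite /G/= mulrBr.
have mI : measurable_fun setT (\1_A : R -> R) by exact: measurable_indic.
apply: (@expectation_fibre0 _ _ _ _ _ _ _ _ _ _ ind G _ _ N) => //.
- apply: measurable_funM; first exact: (measurableT_comp mI).
  apply: measurable_funB => //; exact: (measurableT_comp mh).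
- by apply: intble_ext (intbleB i2 i1) => w; rewrite /G/= mulrBr.
- move=> u /hE[iu Eu]; rewrite /G /= RintegralZl//; last first.
    by apply: intbleB => //; exact: finite_measure_integrable_cst.
  rewrite RintegralB//; last exact: finite_measure_integrable_cst.
  by rewrite Eu Rintegral_cst// probability_fine mulr1 subrr mulr0.
Qed.

End ConditionalExpectation.

Lemma injective_nth (m : nat) (ss : seq nat) : size ss = m -> uniq ss ->
  injective (fun i : 'I_m => nth 0%N ss i).
Proof.
move=> sm us i j /eqP; rewrite nth_uniq ?sm// => /eqP; exact: val_inj.
Qed.

(** * Laws of pairs of observations *)

Section SequenceLaws.
Context d (Omega : measurableType d) (R : realType) (P : probability Omega R).
Context d1 (T : measurableType d1).
Variable Z : nat -> {mfun Omega >-> T}.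
Local Notation intble f := (integrable P setT (EFin \o f)).

Lemma independent_pair_comp d0 d2 d3 d4 (T0 : measurableType d0) (T2 : measurableType d2)
    (T3 : measurableType d3)
    (T4 : measurableType d4) (X : Omega -> T0) (Y : Omega -> T2) (f : T0 -> T3) (g : T2 -> T4) :
  measurable_fun setT f -> measurable_fun setT g ->
  independent_pair P X Y -> independent_pair P (f \o X) (g \o Y).
Proof.
move=> mf mg ind A B mA mB.
by apply: (ind (f @^-1` A) (g @^-1` B)); rewrite -[X in measurable X]setTI; [exact: mf|exact: mg].
Qed.

Hypothesis iidZ : iid P (fun s => Z s).

Let ind1 := iidZ.1.
Let ident := iidZ.2.

Lemma law_pair (G : T * T -> R) (s t s' t' : nat) : s != t -> s' != t' ->
  measurable_fun setT G -> intble (fun w => G (Z s w, Z t w)) ->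
  intble (fun w => G (Z s' w, Z t' w)) /\
  \int[P]_w G (Z s' w, Z t' w) = \int[P]_w G (Z s w, Z t w).
Proof.
move=> st st' mG iG.
pose o0 : 'I_2 := ord0; pose o1 : 'I_2 := lift ord0 ord0.
pose f (x : 2.-tuple T) := G (tnth x o0, tnth x o1).
have mf : measurable_fun setT f.
  apply: (measurableT_comp mG); apply: measurable_fun_pair; exact: measurable_tnth.
have inj a b : a != b -> injective (fun i : 'I_2 => nth 0%N [:: a; b] i).
  by move=> ab; apply: injective_nth; rewrite //= inE ab.
have E a b w : f (sample_tuple Z (fun i : 'I_2 => nth 0%N [:: a; b] i) w) = G (Z a w, Z b w).
  by rewrite /f /sample_tuple !tnth_mktuple.
have [|h1 h2] := @law_sample_tuple _ _ _ P _ _ Z ind1 ident 2 _ _ f (inj _ _ st) (inj _ _ st') mf.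
  by apply: intble_ext iG => w; rewrite E.
split; first by apply: intble_ext h1 => w; rewrite E.
have e a b : \int[P]_w f (sample_tuple Z (fun i : 'I_2 => nth 0%N [:: a; b] i) w) = \int[P]_w G (Z a w, Z b w).
  by apply: eq_Rintegral => w _; rewrite E.
by rewrite -!e.
Qed.

Lemma independent_pair_seq (s t : nat) : s != t -> independent_pair P (Z s) (Z t).
Proof.
move=> st.
have inj a : injective (fun _ : 'I_1 => a : nat) by move=> i j _; rewrite !ord1.
have h := @indep_sample_tuple _ _ _ P _ _ Z ind1 1 1 (fun=> s) (fun=> t) (inj s) (inj t) (fun _ _ => elimN eqP st).
have E a : Z a = (fun x => tnth x ord0) \o sample_tuple Z (fun _ : 'I_1 => a) :> (Omega -> T).
  by apply/funext => w; rewrite /= tnth_mktuple.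
rewrite (E s) (E t); apply: independent_pair_comp h; exact: measurable_tnth.
Qed.

End SequenceLaws.

(** The default in [condE] is a constant function, so measurability holds whether or not a version
    exists. *)
Lemma measurable_condE d (Omega : measurableType d) (R : realType) (P : probability Omega R)
  (h xi : Omega -> R) : measurable_fun setT (condE P h xi).
Proof.
rewrite /condE; case: xgetP => [g _ [] //|_]; exact: measurable_cst.
Qed.

Lemma condEP d (Omega : measurableType d) (R : realType) (P : probability Omega R)
  (h xi : Omega -> R) (g : R -> R) : is_condE P h xi g -> is_condE P h xi (condE P h xi).
Proof. by move=> hg; rewrite /condE; case: xgetP => [//|/(_ g)]. Qed.

(** * Symmetry and degeneracy of the centred kernel *)

Section DegenerateKernel.
Context d (Omega : measurableType d) (R : realType) (P : probability Omega R) (m : nat).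
Variables (k : R -> R -> R) (X : nat -> {RV P >-> m.-tuple R}).
Hypothesis mk : measurable_fun [set: R * R] (fun z => k z.1 z.2).
Hypothesis k_sym : forall u v, k u v = k v u.
Hypothesis iidX : iid P (fun s => X s).
Hypothesis k_int : kernel_integrable k X.
Local Notation intble f := (integrable P setT (EFin \o f)).

Local Notation coord := Defs.coord.

Lemma measurable_coord s i : measurable_fun setT (coord X s i).
Proof.
by apply: (measurableT_comp (measurable_tnth i)); exact: measurable_funPT.
Qed.

HB.instance Definition _ s i :=
  isMeasurableFun.Build _ _ _ _ (coord X s i) (measurable_coord s i).

Let indep_coord i s t : s != t -> independent_pair P (coord X s i) (coord X t i).
Proof.
move=> st; apply: (independent_pair_comp (measurable_tnth i) (measurable_tnth i)).
exact: (independent_pair_seq iidX).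
Qed.

Let law_coord i (G : R * R -> R) s t s' t' : s != t -> s' != t' ->
  measurable_fun setT G -> intble (fun w => G (coord X s i w, coord X t i w)) ->
  intble (fun w => G (coord X s' i w, coord X t' i w)) /\
  \int[P]_w G (coord X s' i w, coord X t' i w) =
  \int[P]_w G (coord X s i w, coord X t i w).
Proof.
move=> st st' mG iG.
apply: (@law_pair _ _ _ P _ _ X iidX (fun z => G (tnth z.1 i, tnth z.2 i)) s t s' t') => //.
apply: (measurableT_comp mG); apply: measurable_fun_pair.
  exact: (measurableT_comp (measurable_tnth i)).
exact: (measurableT_comp (measurable_tnth i)).
Qed.

(** Exchanging the two observations preserves their joint law, and [k] is symmetric; so each
    defining identity given the first observation turns into the one given the second. *)
Let is_condE_swap i g s t : s != t ->
  intble (fun w => k (coord X s i w) (coord X t i w)) ->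
  is_condE P (fun w => k (coord X s i w) (coord X t i w)) (coord X s i) g ->
  is_condE P (fun w => k (coord X s i w) (coord X t i w)) (coord X t i) g.
Proof.
move=> st ik [mg ig Hg]; have ts : t != s by rewrite eq_sym.
have mg1 : measurable_fun setT (fun z : R * R => g z.1) by exact: measurableT_comp.
have [ig' _] := law_coord (G := fun z => g z.1) st ts mg1 ig.
split => // A mA.
have mA' r : measurable (coord X r i @^-1` A).
  by apply: (@measurable_mfun_preimage _ _ _ _ (coord X r i)).
have mI : measurable_fun setT (\1_A : R -> R) by exact: measurable_indic.
have := Hg A mA; rewrite !integral_setE// => -[E].
congr EFin.
have [_ E1] := law_coord (G := fun z => \1_A z.1 * g z.1) st ts
  (measurable_funM (measurableT_comp mI measurable_fst) mg1) (intble_indicM (mA' s) ig).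
have [_ E2] := law_coord (G := fun z => \1_A z.1 * k z.1 z.2) st ts
  (measurable_funM (measurableT_comp mI measurable_fst) mk) (intble_indicM (mA' s) ik).
transitivity (\int[P]_w (\1_(coord X s i @^-1` A) w * g (coord X s i w))); first exact: E1.
rewrite E; apply/esym; apply: etrans E2.
by apply: eq_Rintegral => w _ /=; rewrite k_sym.
Qed.

(** By [is_condE_swap] the two sets of versions coincide, so [xget] picks literally the same
    function from both. This is an equality everywhere, which makes [kcenter] symmetric at every
    point and not just almost surely. *)
Let condE_swap i : condE P (kpair k X i) (coord X 0 i) = condE P (kpair k X i) (coord X 1 i).
Proof.
rewrite /condE; congr (xget _ _); apply/seteqP; split => g /= h.
  by apply: (@is_condE_swap i g 0%N 1%N) => //; exact: k_int.
have ik : intble (fun w => k (coord X 1%N i w) (coord X 0%N i w)).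
  by apply: intble_ext (k_int i) => w; rewrite /kpair k_sym.
have e : kpair k X i = (fun w => k (coord X 1%N i w) (coord X 0%N i w)).
  by apply/funext => w; rewrite /kpair k_sym.
by move: h; rewrite !e => h; apply: (@is_condE_swap i g 1%N 0%N).
Qed.

Lemma kcenterC i u v : kcenter k X i u v = kcenter k X i v u.
Proof. by rewrite /kcenter condE_swap k_sym; congr (_ + _); rewrite addrAC. Qed.

Lemma UfunC x y : Ufun k X x y = Ufun k X y x.
Proof. by rewrite /Ufun; congr (_ * _); apply: eq_bigr => i _; rewrite kcenterC. Qed.

Lemma measurable_kcenter i : measurable_fun setT (fun z : R * R => kcenter k X i z.1 z.2).
Proof.
apply: measurable_funD => //; apply: measurable_funB.
  apply: measurable_funB => //.
  exact: (measurableT_comp (@measurable_condE _ _ _ P _ _) measurable_fst).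
exact: (measurableT_comp (@measurable_condE _ _ _ P _ _) measurable_snd).
Qed.

Lemma measurable_Ufun : measurable_fun setT (fun z => Ufun k X z.1 z.2).
Proof.
apply: measurable_funM => //; apply: measurable_sum => i.
have m1 : measurable_fun setT (fun z : m.-tuple R * m.-tuple R => tnth z.1 i).
  exact: (measurableT_comp (measurable_tnth i)).
have m2 : measurable_fun setT (fun z : m.-tuple R * m.-tuple R => tnth z.2 i).
  exact: (measurableT_comp (measurable_tnth i)).
exact: (measurableT_comp (measurable_kcenter i) (measurable_fun_pair m1 m2)).
Qed.

(** Two null sets are discarded: where the fibre integral of [k] fails to be given by Fubini, and
    where the chosen version of the conditional expectation differs from that integral. Elsewhere
    the first two terms of [kcenter] cancel in the mean, and so do the last two. *)
Let kcenter_degenerate i : exists2 N, measurable N /\ P (coord X 0 i @^-1` N) = 0%E &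
  forall u, ~ N u -> intble (fun w => kcenter k X i u (coord X 1 i w)) /\ \int[P]_w kcenter k X i u (coord X 1 i w) = 0.
Proof.
have ind : independent_pair P (coord X 0 i) (coord X 1 i) by exact: indep_coord.
have [h [Hh [N1 [mN1 PN1] hN1]]] := @condE_fubini _ _ _ P k (coord X 0%N i) (coord X 1%N i) mk ind (k_int i).
have cE0 : is_condE P (kpair k X i) (coord X 0 i) (condE P (kpair k X i) (coord X 0 i)).
  exact: condEP Hh.
have [N2 [mN2 PN2] hN2] := @condE_unique _ _ _ P _ (coord X 0%N i) _ _ cE0 Hh.
have cE1 : is_condE P (kpair k X i) (coord X 1 i) (condE P (kpair k X i) (coord X 1 i)).
  by rewrite -condE_swap; apply: (@is_condE_swap i _ 0%N 1%N) => //; exact: k_int.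
have [mg1 ig1 Hg1] := cE1.
exists (N1 `|` N2).
  split; first exact: measurableU.
  apply/eqP; rewrite eq_le measure_ge0 andbT preimage_setU.
  apply: (le_trans (measureU2 _ _ _)); try exact: (@measurable_mfun_preimage _ _ _ _ (coord X 0%N i)).
  suff : (P (coord X 0 i @^-1` N1) + P (coord X 0 i @^-1` N2) <= 0)%E by [].
  by rewrite PN1 PN2 adde0.
move=> u /not_orP[Nu1 Nu2].
have [iu Eu] := hN1 u Nu1.
pose a := condE P (kpair k X i) (coord X 0%N i) u.
pose c := fine ('E_P[kpair k X i])%E.
have ic r : intble (fun=> r) by exact: finite_measure_integrable_cst.
have i1 : intble (fun w => k u (coord X 1 i w) - a) by exact: intbleB.
have i2 : intble (fun w => k u (coord X 1 i w) - a - condE P (kpair k X i) (coord X 1 i) (coord X 1 i w)).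
  exact: intbleB.
split; first exact: (intbleD i2 (ic c)).
have -> : \int[P]_w kcenter k X i u (coord X 1 i w) =
  \int[P]_w (k u (coord X 1 i w) - a - condE P (kpair k X i) (coord X 1 i) (coord X 1 i w) + c) by [].
rewrite RintegralD// RintegralB// RintegralB// Eu !Rintegral_cst// probability_fine !mulr1.
have -> : a = h u by exact: hN2.
have -> : \int[P]_w condE P (kpair k X i) (coord X 1 i) (coord X 1 i w) = c.
  by rewrite /Rintegral; have := Hg1 setT measurableT; rewrite preimage_setT /c unlock => ->.
by rewrite subrr sub0r addNr.
Qed.

(** The exceptional set collects, over the finitely many coordinates, the points having a coordinate
    in the null set of that coordinate's kernel. *)
Lemma Ufun_degenerate : exists2 N, measurable N /\ P (X 0%N @^-1` N) = 0%E &
  forall x, ~ N x -> intble (fun w => Ufun k X x (X 1%N w)) /\ \int[P]_w Ufun k X x (X 1%N w) = 0.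
Proof.
have /choice[N HN] : forall i, exists N : set R, [/\ measurable N, P (coord X 0 i @^-1` N) = 0%E &
  forall u, ~ N u -> intble (fun w => kcenter k X i u (coord X 1 i w)) /\ \int[P]_w kcenter k X i u (coord X 1 i w) = 0].
  by move=> i; have [N [mN PN] hN] := kcenter_degenerate i; exists N.
pose NN := \big[setU/set0]_(i < m) ((fun x : m.-tuple R => tnth x i) @^-1` N i).
exists NN.
  split.
    apply: bigsetU_measurable => i _; have [mN _ _] := HN i.
    by rewrite -[X in measurable X]setTI; exact: measurable_tnth.
  apply/eqP; rewrite eq_le measure_ge0 andbT /NN.
  have h : forall i, P (X 0%N @^-1` ((fun x : m.-tuple R => tnth x i) @^-1` N i)) = 0%E.
    by move=> i; have [_ PN _] := HN i.
  have hm : forall i, measurable (X 0%N @^-1` ((fun x : m.-tuple R => tnth x i) @^-1` N i)).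
    by move=> i; have [mN _ _] := HN i; exact: (@measurable_mfun_preimage _ _ _ _ (coord X 0%N i)).
  suff [] : measurable (X 0%N @^-1` NN) /\ (P (X 0%N @^-1` NN) <= 0)%E by [].
  rewrite /NN; elim/big_rec: _ => [|i S _ [mS PS]].
    by rewrite preimage_set0 measure0.
  rewrite preimage_setU; split; first exact: measurableU.
  apply: (le_trans (measureU2 _ (hm i) mS)).
  suff : (P (X 0%N @^-1` ((fun x : m.-tuple R => tnth x i) @^-1` N i)) + P (X 0%N @^-1` S) <= 0)%E by [].
  by rewrite h add0e.
move=> x Nx.
have hx i : intble (fun w => kcenter k X i (tnth x i) (coord X 1 i w)) /\ \int[P]_w kcenter k X i (tnth x i) (coord X 1 i w) = 0.
  have [_ _] := HN i; apply => Nxi; apply: Nx.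
  by rewrite /NN -bigcup_seq; exists i => //=; rewrite mem_index_enum.
have isum : intble (fun w => \sum_(i < m) kcenter k X i (tnth x i) (coord X 1 i w)).
  by apply: intble_sum => i _; have [] := hx i.
split; first exact: (intbleZ _ isum).
rewrite /Ufun RintegralZl// Rintegral_sum; last by move=> i _; have [] := hx i.
by rewrite big1 ?mulr0// => i _; have [] := hx i.
Qed.

End DegenerateKernel.

(** * Counting and elementary inequalities *)

Lemma sum_indicator (R : pzSemiRingType) (I : finType) (A : pred I) :
  \sum_z (A z)%:R = #|A|%:R :> R.
Proof.
rewrite -natr_sum -sum1_card [in RHS]big_mkcond /=.
by congr _%:R; apply: eq_bigr => z _; rewrite unfold_in; case: (A z).
Qed.

(** For counting index patterns: the number of solutions is bounded through a parametrisation by the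
    indices that remain free. *)
Lemma card_le_codom (I J : finType) (A : pred I) (f : J -> I) :
  (forall z, A z -> exists x, z = f x) -> (#|A| <= #|J|)%N.
Proof.
move=> Af; apply: (@leq_trans #|codom f|); last exact: leq_image_card.
by apply: subset_leq_card; apply/fintype.subsetP => z; rewrite unfold_in => /Af[x ->]; exact: codom_f.
Qed.

Lemma prod4_amgm (R : realType) (a b c e : R) :
  a * b * (c * e) <= 4^-1 * (a ^+ 4 + b ^+ 4 + c ^+ 4 + e ^+ 4).
Proof.
have := sqr_ge0 (a * b - c * e).
have := sqr_ge0 (a ^+ 2 - b ^+ 2); have := sqr_ge0 (c ^+ 2 - e ^+ 2); lra.
Qed.

Lemma prod4_le (R : realType) (a b c e : R) : `|a * b * (c * e)| <= a ^+ 4 + b ^+ 4 + c ^+ 4 + e ^+ 4.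
Proof.
have := prod4_amgm a b c e; have := prod4_amgm (- a) b c e.
have := exprn_even_ge0 a (n := 4) isT; have := exprn_even_ge0 b (n := 4) isT.
have := exprn_even_ge0 c (n := 4) isT; have := exprn_even_ge0 e (n := 4) isT.
by rewrite ler_norml => ? ? ? ? ? ?; apply/andP; split; lra.
Qed.

Lemma mean_value (R : realType) (g dg : R -> R) (x y : R) : (forall x : R, is_derive x 1 g (dg x)) ->
  exists2 z, `|z - x| <= `|y - x| & g y - g x = dg z * (y - x).
Proof.
move=> Hg.
have cg : continuous g.
  by move=> z; apply: differentiable_continuous; apply/derivable1_diffP; exact: ex_derive.
case: (leP x y) => [xy|/ltW yx].
  have [z zxy E] := @MVT_segment R g dg x y xy (fun z _ => Hg z) (continuous_subspaceT cg).
  exists z => //; move: zxy; rewrite in_itv /= => /andP[? ?].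
  by rewrite !ger0_norm; lra.
have [z zxy E] := @MVT_segment R g dg y x yx (fun z _ => Hg z) (continuous_subspaceT cg).
exists z; last by rewrite -opprB E -mulrN opprB.
move: zxy; rewrite in_itv /= => /andP[? ?].
by rewrite !ler0_norm; lra.
Qed.

(** Stands in for Cauchy-Schwarz: a first absolute moment becomes small once the second moment tends
    to 0, with [lam] fixed beforehand. *)
Lemma amgm (R : realType) (lam x : R) : 0 < lam -> `|x| <= lam + lam^-1 * x ^+ 2.
Proof.
move=> l0; rewrite -(ler_pM2r l0) mulrDl mulrAC mulVf ?gt_eqF// mul1r.
have -> : x ^+ 2 = `|x| ^+ 2 by rewrite real_normK ?num_real.
have := sqr_ge0 (`|x| - lam); have := normr_ge0 x; nra.
Qed.

(** * Stein bound for an abstract degenerate array *)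

Section DegenerateArray.
Context d (Omega : measurableType d) (R : realType) (P : probability Omega R) (n : nat).
Variable h : 'I_n -> 'I_n -> Omega -> R.
Variables (M kap : R).
Local Notation intble f := (integrable P setT (EFin \o f)).
Local Notation "''E' f" := (\int[P]_w (f w)) (at level 10, f at level 8).

Hypothesis h_diag : forall s w, h s s w = 0.
Hypothesis hC : forall s t w, h s t w = h t s w.
Hypothesis mh : forall s t, measurable_fun setT (h s t).
Hypothesis h4 : forall s t, intble (fun w => h s t w ^+ 4).
Hypothesis h4M : forall s t, 'E (fun w => h s t w ^+ 4) <= M.
Hypothesis h_isolated : forall s t a b a' b' a'' b'',
  s \notin [:: a; b; a'; b'; a''; b''] ->
  'E (fun w => h s t w * (h a b w * h a' b' w * h a'' b'' w)) = 0.
Hypothesis h_disjoint : forall s t r u, uniq [:: s; t; r; u] ->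
  'E (fun w => h s t w ^+ 2 * h r u w ^+ 2) <= 1.
Hypothesis h_cycle : forall s t r u, uniq [:: s; t; r; u] ->
  'E (fun w => h s t w * h t r w * h r u w * h u s w) <= kap.
Hypothesis kap0 : 0 <= kap.

Lemma intble_prod4 a b a' b' c e c' e' :
  intble (fun w => h a b w * h a' b' w * (h c e w * h c' e' w)).
Proof.
apply: (@intble_le _ _ _ _ _ (fun w => h a b w ^+ 4 + h a' b' w ^+ 4 + h c e w ^+ 4 + h c' e' w ^+ 4)).
- by do !apply: measurable_funM.
- by do !apply: intbleD.
- by move=> w; exact: prod4_le.
Qed.

(* AM-GM with weights 1/4, so that the constant stays [M]. *)
Lemma prod4_leM a b a' b' c e c' e' :
  'E (fun w => h a b w * h a' b' w * (h c e w * h c' e' w)) <= M.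
Proof.
pose m w := 4^-1 * (h a b w ^+ 4 + h a' b' w ^+ 4 + h c e w ^+ 4 + h c' e' w ^+ 4).
have i4 : intble (fun w => h a b w ^+ 4 + h a' b' w ^+ 4 + h c e w ^+ 4 + h c' e' w ^+ 4).
  by do !apply: intbleD.
apply: (@le_trans _ _ ('E m)).
  apply: le_Rintegral; [by []|exact: intble_prod4|exact: intbleZ|].
  by move=> w _; exact: prod4_amgm.
rewrite RintegralZl// !RintegralD//; do ?by do !apply: intbleD.
have := h4M a b; have := h4M a' b'; have := h4M c e; have := h4M c' e'; lra.
Qed.

(** The mean of one summand of [quad w ^+ 2]; the number refers to the six index slots. *)
Definition moment6 (s t t' r u u' : 'I_n) : R :=
  'E (fun w => h s t w * h s t' w * (h r u w * h r u' w)).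

Lemma moment6_isolated1 s t t' r u u' :
  t \notin [:: t'; r; u; u'] -> moment6 s t t' r u u' = 0.
Proof.
have [->|st] := eqVneq t s => tN.
  by rewrite /moment6 /Rintegral integral0_eq// => w _; rewrite h_diag !mul0r.
rewrite -[RHS](@h_isolated t s s t' r u r u'); last first.
  by move: tN; rewrite !inE !negb_or st => /and4P[-> -> -> ->].
by apply: eq_Rintegral => w _; rewrite (hC s t); ring.
Qed.

Lemma moment6C1 s t t' r u u' : moment6 s t t' r u u' = moment6 s t' t r u u'.
Proof. by apply: eq_Rintegral => w _; ring. Qed.

Lemma moment6C s t t' r u u' : moment6 s t t' r u u' = moment6 r u u' s t t'.
Proof. by apply: eq_Rintegral => w _; ring. Qed.

Lemma moment6_diag s t t' r u u' : s = t -> moment6 s t t' r u u' = 0.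
Proof.
by move=> ->; rewrite /moment6 /Rintegral integral0_eq// => w _; rewrite h_diag !mul0r.
Qed.

Lemma moment6_leM s t t' r u u' : moment6 s t t' r u u' <= M.
Proof. exact: prod4_leM. Qed.

(** For n = 0 no fourth moment is there to bound [M] from below, hence the disjunction. *)
Let M0 : ('I_n -> False) \/ 0 <= M.
Proof.
case: n h h4M => [|n'] h' hM; first by left=> -[].
by right; apply: le_trans (hM ord0 ord0); apply: Rintegral_ge0 => w _; exact: exprn_even_ge0.
Qed.

Local Notation T3 := ('I_n * ('I_n * 'I_n))%type.

(* The index patterns with at most three distinct values and no isolated index. *)
Definition degenerate_index (x : T3) : seq (T3 * T3) :=
  let: (a, (b, c)) := x in
  [:: ((a, (b, b)), (a, (c, c))); ((a, (b, b)), (c, (a, a)));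
      ((a, (b, b)), (b, (c, c))); ((a, (b, b)), (c, (b, b)));
      ((a, (b, b)), (c, (a, b))); ((a, (b, b)), (c, (b, a)));
      ((c, (a, b)), (a, (b, b))); ((c, (b, a)), (a, (b, b)));
      ((a, (b, c)), (b, (c, a))); ((a, (b, c)), (b, (a, c)));
      ((a, (c, b)), (b, (c, a))); ((a, (c, b)), (b, (a, c)));
      ((a, (b, c)), (a, (b, c))); ((a, (b, c)), (a, (c, b)))].

Definition degenerate_indices : seq (T3 * T3) := flatten [seq degenerate_index x | x <- enum {: T3}].

Lemma mem_degenerate_indices x z : z \in degenerate_index x -> z \in degenerate_indices.
Proof. by move=> zx; apply/flatten_mapP; exists x => //; rewrite mem_enum. Qed.

(** The constant 14 is the number of patterns listed in [degenerate_index], each with three free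
    values. *)
Lemma card_degenerate_indices : (#|[pred z in degenerate_indices]| <= 14 * n ^ 3)%N.
Proof.
apply: (leq_trans (card_size _)); rewrite size_flatten /shape -map_comp.
rewrite (@eq_map _ _ _ (fun=> 14%N)); last by move=> [a [b c]].
rewrite sumnE big_map big_const_seq count_predT iter_addn_0 -cardE !card_prod card_ord leq_mul2l.
by rewrite !expnS expn0 muln1 leqnn orbT.
Qed.

(** If one of t, t', u, u' occurs nowhere else, the moment vanishes. Otherwise the indices pair up:
    t = t' and u = u' give two squares (mean at most 1 when disjoint), while {t, t'} = {u, u'} gives
    a 4-cycle (mean at most [kap]). All other coincidences leave at most three values, are in the
    list and cost at most [M]. *)
Lemma moment6_bound s t t' r u u' :
  moment6 s t t' r u u' <= ((t == t') && (u == u'))%:R + kap * ((t == u) && (t' == u'))%:R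
    + kap * ((t == u') && (t' == u))%:R + M * (((s, (t, t')), (r, (u, u'))) \in degenerate_indices)%:R.
Proof.
have M0' : 0 <= M by case: M0 => // /(_ s).
have kb (b : bool) : 0 <= kap * b%:R by rewrite mulr_ge0.
case: (boolP (_ \in degenerate_indices)) => [_|nbad].
  rewrite mulr1 -[leLHS]add0r lerD ?moment6_leM// !addr_ge0//.
rewrite mulr0 addr0.
have bad x : ((s, (t, t')), (r, (u, u'))) \notin degenerate_index x.
  by apply: contra nbad; exact: mem_degenerate_indices.
suff : moment6 s t t' r u u' <= 0 \/ (t = t' /\ u = u' /\ moment6 s t t' r u u' <= 1) \/
   (t = u /\ t' = u' /\ moment6 s t t' r u u' <= kap) \/
   (t = u' /\ t' = u /\ moment6 s t t' r u u' <= kap).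
  move=> [h0|[[-> [-> h1]]|[[-> [-> h1]]|[-> [-> h1]]]]].
  - by apply: (le_trans h0); rewrite !addr_ge0.
  - by rewrite !eqxx; apply: (le_trans h1); rewrite -addrA lerDl addr_ge0.
  - rewrite !eqxx mulr1; apply: (le_trans h1); rewrite addrAC lerDr addr_ge0//.
  - rewrite !eqxx mulr1; apply: (le_trans h1); rewrite lerDr addr_ge0//.
have [st|st] := eqVneq s t; first by left; rewrite (moment6_diag _ _ _ _ st).
have [st'|st'] := eqVneq s t'; first by left; rewrite moment6C1 (moment6_diag _ _ _ _ st').
have [ru|ru] := eqVneq r u; first by left; rewrite moment6C (moment6_diag _ _ _ _ ru).
have [ru'|ru'] := eqVneq r u'; first by left; rewrite moment6C moment6C1 (moment6_diag _ _ _ _ ru').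
have iso1 : t \notin [:: t'; r; u; u'] -> moment6 s t t' r u u' <= 0.
  by move=> /moment6_isolated1 ->.
have iso2 : t' \notin [:: t; r; u; u'] -> moment6 s t t' r u u' <= 0.
  by rewrite moment6C1 => /moment6_isolated1 ->.
have iso3 : u \notin [:: u'; s; t; t'] -> moment6 s t t' r u u' <= 0.
  by rewrite moment6C => /moment6_isolated1 ->.
have iso4 : u' \notin [:: u; s; t; t'] -> moment6 s t t' r u u' <= 0.
  by rewrite moment6C moment6C1 => /moment6_isolated1 ->.
have [tt'|tt'] := eqVneq t t'.
  subst t'; have [uu'|uu'] := eqVneq u u'.
    subst u'; right; left; split=> //; split=> //.
    have sr : s != r.
      by apply: contraNneq (bad (s, (t, u))) => ->; rewrite !inE eqxx.
    have su : s != u.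
      by apply: contraNneq (bad (u, (t, r))) => ->; rewrite !inE eqxx !orbT.
    have tr : t != r.
      by apply: contraNneq (bad (s, (r, u))) => ->; rewrite !inE eqxx !orbT.
    have tu : t != u.
      by apply: contraNneq (bad (s, (u, r))) => ->; rewrite !inE eqxx !orbT.
    apply: le_trans (@h_disjoint s t r u _); last first.
      by rewrite /= !inE !negb_or st sr su tr tu ru.
    by rewrite le_eqVlt; apply/orP; left; apply/eqP; apply: eq_Rintegral => w _; ring.
  (* Here t = t' and u differs from u'. That neither u nor u' is isolated forces {u, u'} = {s, t}:
     three values only, hence a listed pattern. *)
  left.
  case: (boolP (u \in [:: u'; s; t; t])) => [|/iso3//].
  rewrite !inE (negbTE uu') /= orbb => /orP[/eqP us|/eqP ut].
    subst u; case: (boolP (u' \in [:: s; s; t; t])) => [|/iso4//].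
    rewrite !inE eq_sym (negbTE uu') /= orbb => /eqP ut; subst u'.
    by have := bad (s, (t, r)); rewrite !inE eqxx !orbT.
  subst u; case: (boolP (u' \in [:: t; s; t; t])) => [|/iso4//].
  rewrite !inE eq_sym (negbTE uu') /= !orbF => /eqP us; subst u'.
  by have := bad (s, (t, r)); rewrite !inE eqxx !orbT.
have [uu'|uu'] := eqVneq u u'.
  subst u'; left.
  case: (boolP (t \in [:: t'; r; u; u])) => [|/iso1//].
  rewrite !inE (negbTE tt') /= orbb => /orP[/eqP tr|/eqP tu].
    subst t; case: (boolP (t' \in [:: r; r; u; u])) => [|/iso2//].
    rewrite !inE eq_sym (negbTE tt') /= orbb => /eqP tu; subst t'.
    by have := bad (r, (u, s)); rewrite !inE eqxx !orbT.
  subst t; case: (boolP (t' \in [:: u; r; u; u])) => [|/iso2//].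
  rewrite !inE eq_sym (negbTE tt') /= !orbF => /eqP us; subst t'.
  by have := bad (r, (u, s)); rewrite !inE eqxx !orbT.
(* Up to reordering the factors, this moment is the closed walk s, a, r, b. *)
have cyc : forall a b, a != b -> s != a -> s != b -> r != a -> r != b -> s != r ->
    moment6 s a b r a b <= kap.
  move=> a b ab sa sb ra rb sr; apply: le_trans (@h_cycle s a r b _); last first.
    by rewrite /= !inE !negb_or sa sr sb (eq_sym a r) ra ab rb.
  rewrite le_eqVlt; apply/orP; left; apply/eqP; apply: eq_Rintegral => w _.
  by rewrite (hC a r) (hC b s); ring.
(* Both pairs now consist of distinct indices, each of which must recur outside its own pair. Either
   the two pairs agree as sets, which is the 4-cycle, or three values remain and the pattern is
   listed. *)
case: (boolP (t \in [:: t'; r; u; u'])) => [|/iso1]; last by left.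
rewrite inE (negbTE tt') /= => tin.
case: (boolP (t' \in [:: t; r; u; u'])) => [|/iso2]; last by left.
rewrite inE eq_sym (negbTE tt') /= => tin'.
case: (boolP (u \in [:: u'; s; t; t'])) => [|/iso3]; last by left.
rewrite inE (negbTE uu') /= => uin.
case: (boolP (u' \in [:: u; s; t; t'])) => [|/iso4]; last by left.
rewrite inE eq_sym (negbTE uu') /= => uin'.
move: tin; rewrite !inE => /or3P[/eqP tr|/eqP tu|/eqP tu'].
- subst t; move: tin'; rewrite !inE [t' == r]eq_sym (negbTE tt') /= => /orP[/eqP tu|/eqP tu].
    subst t'; move: uin'; rewrite !inE [u' == r]eq_sym (negbTE ru') [u' == u]eq_sym (negbTE uu') !orbF => /eqP us.
    by subst u'; have := bad (s, (r, u)); rewrite !inE eqxx !orbT.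
  subst t'; move: uin; rewrite !inE [u == r]eq_sym (negbTE ru) (negbTE uu') !orbF => /eqP us.
  by subst u; have := bad (s, (r, u')); rewrite !inE eqxx !orbT.
- subst t; move: tin'; rewrite !inE [t' == u]eq_sym (negbTE tt') /= => /orP[/eqP tr|/eqP tu].
    subst t'; move: uin'; rewrite !inE [u' == u]eq_sym (negbTE uu') [u' == r]eq_sym (negbTE ru') !orbF => /eqP us.
    by subst u'; have := bad (s, (r, u)); rewrite !inE eqxx !orbT.
  subst t'; right; right; left; split => //; split => //.
  apply: cyc => //; apply: contraNneq (bad (s, (u, u'))) => ->.
  by rewrite !inE eqxx !orbT.
- subst t; move: tin'; rewrite !inE [t' == u']eq_sym (negbTE tt') orbF => /orP[/eqP tr|/eqP tu].
    subst t'; move: uin; rewrite !inE (negbTE uu') [u == r]eq_sym (negbTE ru) !orbF => /eqP us.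
    by subst u; have := bad (s, (r, u')); rewrite !inE eqxx !orbT.
  subst t'; right; right; right; split => //; split => //.
  rewrite moment6C1; apply: cyc => //; apply: contraNneq (bad (s, (u', u))) => ->.
  by rewrite !inE eqxx !orbT.
Qed.

(** In the notation of the overview, A_s is [c * row s], and Q is [2^-1 * c ^+ 2 * quad], with [c]
    the normalising constant introduced below. *)
Definition row (s : 'I_n) (w : Omega) : R := \sum_t h s t w.

Definition quad (w : Omega) : R := \sum_s row s w ^+ 2.

Lemma quadE w : quad w = \sum_(x : T3) h x.1 x.2.1 w * h x.1 x.2.2 w.
Proof.
rewrite -(pair_bigA _ (fun s p => h s p.1 w * h s p.2 w)) /=; apply: eq_bigr => s _.
by rewrite /row expr2 big_distrlr /= (pair_bigA _ (fun t t' => h s t w * h s t' w)).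
Qed.

Lemma quad_sqrE w : quad w ^+ 2 = \sum_(z : T3 * T3)
  h z.1.1 z.1.2.1 w * h z.1.1 z.1.2.2 w * (h z.2.1 z.2.2.1 w * h z.2.1 z.2.2.2 w).
Proof.
rewrite quadE expr2 big_distrlr /=.
by rewrite (pair_bigA _ (fun x y : T3 => h x.1 x.2.1 w * h x.1 x.2.2 w * (h y.1 y.2.1 w * h y.1 y.2.2 w))).
Qed.

Lemma intble_quad_sqr : intble (fun w => quad w ^+ 2).
Proof.
apply: intble_ext (fun w => esym (quad_sqrE w)) _.
by apply: intble_sum => z _; exact: intble_prod4.
Qed.

(** Each of the three pairings in [moment6_bound] leaves four free indices, with weights 1, [kap]
    and [kap]; the listed patterns contribute the lower order n^3. The leading n^4 is what cancels
    against E[Q] = 1 later. *)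
Lemma expectation_quad_sqr :
  'E (fun w => quad w ^+ 2) <= n%:R ^+ 4 * (1 + 2 * kap) + 14 * n%:R ^+ 3 * M.
Proof.
under eq_Rintegral do rewrite quad_sqrE.
rewrite Rintegral_sum; last by move=> z _; exact: intble_prod4.
have [n0|M0'] := M0.
  rewrite big1 => [|[[s p] y] _]; last by case: (n0 s).
  have /eqP n00 : n == 0%N by rewrite -leqn0 leqNgt; apply/negP => np; exact: (n0 (Ordinal np)).
  by have -> : n%:R = 0 :> R; [rewrite n00|rewrite !expr0n/= mul0r mulr0 mul0r addr0].
apply: (@le_trans _ _ (\sum_(z : T3 * T3) (
   ((z.1.2.1 == z.1.2.2) && (z.2.2.1 == z.2.2.2))%:R
   + kap * ((z.1.2.1 == z.2.2.1) && (z.1.2.2 == z.2.2.2))%:R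
   + kap * ((z.1.2.1 == z.2.2.2) && (z.1.2.2 == z.2.2.1))%:R + M * (z \in degenerate_indices)%:R))).
  by apply: ler_sum => -[[s [t t']] [r [u u']]] _; exact: moment6_bound.
rewrite !big_split /= -!mulr_sumr.
rewrite (sum_indicator R (fun z : T3 * T3 => (z.1.2.1 == z.1.2.2) && (z.2.2.1 == z.2.2.2))).
rewrite (sum_indicator R (fun z : T3 * T3 => (z.1.2.1 == z.2.2.1) && (z.1.2.2 == z.2.2.2))).
rewrite (sum_indicator R (fun z : T3 * T3 => (z.1.2.1 == z.2.2.2) && (z.1.2.2 == z.2.2.1))).
rewrite (sum_indicator R (fun z : T3 * T3 => z \in degenerate_indices)).
have card4 (A : pred (T3 * T3)) (f : 'I_n * 'I_n * ('I_n * 'I_n) -> T3 * T3) :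
    (forall z, A z -> exists x, z = f x) -> #|A|%:R <= n%:R ^+ 4 :> R.
  move=> /card_le_codom; rewrite !card_prod card_ord -natrX ler_nat => h'.
  by apply: (leq_trans h'); rewrite !expnS expn0 muln1 !mulnA.
have c1 : #|fun z : T3 * T3 => (z.1.2.1 == z.1.2.2) && (z.2.2.1 == z.2.2.2)|%:R <= n%:R ^+ 4 :> R.
  apply: (card4 _ (fun x => ((x.1.1, (x.1.2, x.1.2)), (x.2.1, (x.2.2, x.2.2))))).
  move=> [[s [t t']] [r [u u']]] /= /andP[/eqP-> /eqP->].
  by exists ((s, t'), (r, u')).
have c2 : #|fun z : T3 * T3 => (z.1.2.1 == z.2.2.1) && (z.1.2.2 == z.2.2.2)|%:R <= n%:R ^+ 4 :> R.
  apply: (card4 _ (fun x => ((x.1.1, (x.1.2, x.2.1)), (x.2.2, (x.1.2, x.2.1))))).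
  move=> [[s [t t']] [r [u u']]] /= /andP[/eqP-> /eqP->].
  by exists ((s, u), (u', r)).
have c3 : #|fun z : T3 * T3 => (z.1.2.1 == z.2.2.2) && (z.1.2.2 == z.2.2.1)|%:R <= n%:R ^+ 4 :> R.
  apply: (card4 _ (fun x => ((x.1.1, (x.1.2, x.2.1)), (x.2.2, (x.2.1, x.1.2))))).
  move=> [[s [t t']] [r [u u']]] /= /andP[/eqP-> /eqP->].
  by exists ((s, u'), (u, r)).
have c4 : #|fun z : T3 * T3 => z \in degenerate_indices|%:R <= 14 * n%:R ^+ 3 :> R.
  by have := card_degenerate_indices; rewrite -(ler_nat R) natrM natrX.
have := ler_wpM2l kap0 c2; have := ler_wpM2l kap0 c3; have := ler_wpM2l M0' c4; lra.
Qed.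

Lemma row_quartE s w : row s w ^+ 4 = \sum_(z : ('I_n * 'I_n) * ('I_n * 'I_n))
  h s z.1.1 w * h s z.1.2 w * (h s z.2.1 w * h s z.2.2 w).
Proof.
have r2 : row s w ^+ 2 = \sum_(x : 'I_n * 'I_n) h s x.1 w * h s x.2 w.
  by rewrite /row expr2 big_distrlr /= (pair_bigA _ (fun t t' => h s t w * h s t' w)).
rewrite -[4%N]/(2 * 2)%N exprM r2 expr2 big_distrlr /=.
by rewrite (pair_bigA _ (fun x y => h s x.1 w * h s x.2 w * (h s y.1 w * h s y.2 w))).
Qed.

Lemma intble_row_quart s : intble (fun w => row s w ^+ 4).
Proof.
apply: intble_ext (fun w => esym (row_quartE s w)) _.
by apply: intble_sum => z _; exact: intble_prod4.
Qed.

(** A nonzero term needs the four column indices to match in pairs. There are three pairings, each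
    with n^2 choices, and every moment is at most [M]. *)
Lemma expectation_row_quart s : 'E (fun w => row s w ^+ 4) <= 3 * n%:R ^+ 2 * M.
Proof.
under eq_Rintegral do rewrite row_quartE.
rewrite Rintegral_sum; last by move=> z _; exact: intble_prod4.
have M0' : 0 <= M by case: M0 => // /(_ s).
pose A1 (z : ('I_n * 'I_n) * ('I_n * 'I_n)) := (z.1.1 == z.1.2) && (z.2.1 == z.2.2).
pose A2 (z : ('I_n * 'I_n) * ('I_n * 'I_n)) := (z.1.1 == z.2.1) && (z.1.2 == z.2.2).
pose A3 (z : ('I_n * 'I_n) * ('I_n * 'I_n)) := (z.1.1 == z.2.2) && (z.1.2 == z.2.1).
apply: (@le_trans _ _ (\sum_z (M * (A1 z)%:R + M * (A2 z)%:R + M * (A3 z)%:R))).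
  apply: ler_sum => -[[t1 t2] [t3 t4]] _; rewrite /A1 /A2 /A3 /=.
  rewrite -/(moment6 s t1 t2 s t3 t4); have hM := moment6_leM s t1 t2 s t3 t4.
  have kb (b : bool) : 0 <= M * b%:R by rewrite mulr_ge0.
  have iso1 : t1 \notin [:: t2; s; t3; t4] -> moment6 s t1 t2 s t3 t4 <= 0.
    by move=> /moment6_isolated1 ->.
  have iso2 : t2 \notin [:: t1; s; t3; t4] -> moment6 s t1 t2 s t3 t4 <= 0.
    by rewrite moment6C1 => /moment6_isolated1 ->.
  have iso3 : t3 \notin [:: t4; s; t1; t2] -> moment6 s t1 t2 s t3 t4 <= 0.
    by rewrite moment6C => /moment6_isolated1 ->.
  have iso4 : t4 \notin [:: t3; s; t1; t2] -> moment6 s t1 t2 s t3 t4 <= 0.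
    by rewrite moment6C moment6C1 => /moment6_isolated1 ->.
  have [s1|s1] := eqVneq s t1; first by rewrite (moment6_diag _ _ _ _ s1) !addr_ge0.
  have [s2|s2] := eqVneq s t2; first by rewrite moment6C1 (moment6_diag _ _ _ _ s2) !addr_ge0.
  have [s3|s3] := eqVneq s t3; first by rewrite moment6C (moment6_diag _ _ _ _ s3) !addr_ge0.
  have [s4|s4] := eqVneq s t4; first by rewrite moment6C moment6C1 (moment6_diag _ _ _ _ s4) !addr_ge0.
  have [b1|nb1] := boolP ((t1 == t2) && (t3 == t4)).
    by rewrite mulr1; apply: (le_trans hM); rewrite -addrA lerDl addr_ge0.
  have [b2|nb2] := boolP ((t1 == t3) && (t2 == t4)).
    by rewrite mulr1 mulr0 add0r; apply: (le_trans hM); rewrite lerDl.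
  have [b3|nb3] := boolP ((t1 == t4) && (t2 == t3)).
    by rewrite mulr1 !mulr0 !add0r.
  rewrite !mulr0 !addr0.
  have [e12|n12] := eqVneq t1 t2.
    have n34 : t3 != t4 by move: nb1; rewrite e12 eqxx.
    have [e13|n13] := eqVneq t3 t1.
      by apply: iso4; rewrite !inE !negb_or [t4 == s]eq_sym s4 -e12 -e13 [t4 == t3]eq_sym n34.
    by apply: iso3; rewrite !inE !negb_or n34 [t3 == s]eq_sym s3 -e12 n13.
  have [e13|n13] := eqVneq t1 t3.
    have n24 : t2 != t4 by move: nb2; rewrite e13 eqxx.
    by apply: iso2; rewrite !inE !negb_or [t2 == t1]eq_sym n12 [t2 == s]eq_sym s2 -e13 [t2 == t1]eq_sym n12.
  have [e14|n14] := eqVneq t1 t4.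
    have n23 : t2 != t3 by move: nb3; rewrite e14 eqxx.
    by apply: iso2; rewrite !inE !negb_or [t2 == t1]eq_sym n12 [t2 == s]eq_sym s2 n23 -e14 [t2 == t1]eq_sym n12.
  by apply: iso1; rewrite !inE !negb_or n12 [t1 == s]eq_sym s1 n13.
rewrite !big_split /= -!mulr_sumr !sum_indicator.
have card2 (A : pred (('I_n * 'I_n) * ('I_n * 'I_n))) (f : 'I_n * 'I_n -> _) :
    (forall z, A z -> exists x, z = f x) -> #|A|%:R <= n%:R ^+ 2 :> R.
  by move=> /card_le_codom; rewrite !card_prod card_ord -natrX ler_nat mulnn.
have c1 : #|A1|%:R <= n%:R ^+ 2 :> R.
  apply: (card2 _ (fun x => ((x.1, x.1), (x.2, x.2)))).
  by move=> [[t1 t2] [t3 t4]] /andP[/= /eqP-> /eqP->]; exists (t2, t4).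
have c2 : #|A2|%:R <= n%:R ^+ 2 :> R.
  apply: (card2 _ (fun x => ((x.1, x.2), (x.1, x.2)))).
  by move=> [[t1 t2] [t3 t4]] /andP[/= /eqP-> /eqP->]; exists (t3, t4).
have c3 : #|A3|%:R <= n%:R ^+ 2 :> R.
  apply: (card2 _ (fun x => ((x.1, x.2), (x.2, x.1)))).
  by move=> [[t1 t2] [t3 t4]] /andP[/= /eqP-> /eqP->]; exists (t4, t3).
have := ler_wpM2l M0' c1; have := ler_wpM2l M0' c2; have := ler_wpM2l M0' c3; lra.
Qed.

Hypothesis h_isolated2 : forall s t a b, s \notin [:: a; b] ->
  'E (fun w => h s t w * h a b w) = 0.
Hypothesis h_var : forall s t, s != t -> 'E (fun w => h s t w ^+ 2) = 1.

Lemma intble_prod2 a b a' b' : intble (fun w => h a b w * h a' b' w).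
Proof.
apply: (@intble_le _ _ _ _ _ (fun w => 1 + h a b w ^+ 4 + h a' b' w ^+ 4)).
- exact: measurable_funM.
- by do !apply: intbleD => //; exact: finite_measure_integrable_cst.
- move=> w; set x := h a b w; set y := h a' b' w.
  rewrite ler_norml; have := sqr_ge0 (x ^+ 2 - 1); have := sqr_ge0 (y ^+ 2 - 1).
  have := sqr_ge0 (x - y); have := sqr_ge0 (x + y).
  have := exprn_even_ge0 x (n := 4) isT; have := exprn_even_ge0 y (n := 4) isT.
  by move=> ? ? ? ? ? ?; apply/andP; split; lra.
Qed.

Lemma intble_quad : intble quad.
Proof.
apply: intble_ext (fun w => esym (quadE w)) _.
by apply: intble_sum => z _; exact: intble_prod2.
Qed.

(** Only the squares of off-diagonal entries survive. With the normalisation of [c] this is E[Q] = 1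
    exactly, so that E[(1 - Q)^2] = E[Q^2] - 1. *)
Lemma expectation_quad : 'E quad = n%:R * (n%:R - 1).
Proof.
under eq_Rintegral do rewrite quadE.
rewrite Rintegral_sum; last by move=> z _; exact: intble_prod2.
rewrite -(pair_bigA _ (fun s p => 'E (fun w => h s p.1 w * h s p.2 w))) /=.
transitivity (\sum_(s < n) (n%:R - 1 : R)); last by rewrite sumr_const card_ord mulr_natl.
apply: eq_bigr => s _.
rewrite -(pair_bigA _ (fun t t' => 'E (fun w => h s t w * h s t' w))) /=.
transitivity (\sum_(t < n) (t != s)%:R : R); last first.
  rewrite (bigD1 s)//= eqxx add0r.
  under eq_bigr => t ts do rewrite ts.
  rewrite sumr_const cardC1 card_ord.
  by rewrite -subn1 natrB// (leq_ltn_trans (leq0n s) (ltn_ord s)).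
apply: eq_bigr => t _.
have [->|ts] := eqVneq t s.
  by rewrite big1// => t' _; rewrite /Rintegral integral0_eq// => w _; rewrite h_diag mul0r.
rewrite (bigD1 t)//= big1 ?addr0 => [|t' t't].
  by rewrite -(h_var ts); apply: eq_Rintegral => w _; rewrite (hC s t) expr2.
rewrite -[RHS](@h_isolated2 t s s t'); last by rewrite !inE negb_or ts eq_sym.
by apply: eq_Rintegral => w _; rewrite (hC s t).
Qed.

Variable c : R.
Hypothesis c2 : c ^+ 2 * (n%:R * (n%:R - 1)) = 2.

(** The W of the overview; the factor 1/2 corrects for counting each unordered pair twice. *)
Definition dsum (w : Omega) : R := 2^-1 * c * \sum_s \sum_t h s t w.

(** The W - A_s of the overview: both the row and the column of index [s] are removed. *)
Definition core (s : 'I_n) (w : Omega) : R :=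
  2^-1 * c * \sum_(a | a != s) \sum_(b | b != s) h a b w.

Hypothesis h_core : forall s t (f : R -> R) (K : R), measurable_fun setT f ->
  (forall x, `|f x| <= K) -> 'E (fun w => h s t w * f (core s w)) = 0.

Lemma dsum_core s w : dsum w = core s w + c * row s w.
Proof.
rewrite /dsum /core (bigD1 s)//= -/(row s w).
have -> : \sum_(a | a != s) \sum_t h a t w =
    row s w + \sum_(a | a != s) \sum_(b | b != s) h a b w.
  have -> : row s w = \sum_(a | a != s) h s a w by rewrite /row (bigD1 s)//= h_diag add0r.
  rewrite -big_split /=; apply: eq_bigr => a _.
  by rewrite (bigD1 s)//= hC.
by field.
Qed.

Lemma measurable_row s : measurable_fun setT (row s).
Proof. exact: measurable_sum. Qed.

Lemma measurable_dsum : measurable_fun setT dsum.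
Proof. by apply: measurable_funM => //; apply: measurable_sum => s; exact: measurable_sum. Qed.

Lemma measurable_core s : measurable_fun setT (core s).
Proof.
apply: measurable_funM => //.
rewrite (_ : (fun _ => _) = (fun w => \sum_a \sum_b (if (a != s) && (b != s) then h a b w else 0))).
  apply: measurable_sum => a; apply: measurable_sum => b.
  by case: ((a != s) && (b != s)).
apply/funext => w; rewrite big_mkcond; apply: eq_bigr => a _; case: (a != s) => /=.
  by rewrite big_mkcond.
by apply/esym; exact: big1.
Qed.

Lemma intble_entry s t : intble (h s t).
Proof.
apply: (@intble_le _ _ _ _ _ (fun w => 1 + h s t w ^+ 4)) => //.
  by apply: intbleD => //; exact: finite_measure_integrable_cst.
move=> w; set x := h s t w; have := sqr_ge0 (x ^+ 2 - 1); have := sqr_ge0 (x - 1).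
have := sqr_ge0 (x + 1); have := exprn_even_ge0 x (n := 4) isT.
by rewrite ler_norml => ? ? ? ?; apply/andP; split; lra.
Qed.

Lemma intble_dsum : intble dsum.
Proof. by apply: intbleZ; apply: intble_sum => s _; apply: intble_sum => t _; exact: intble_entry. Qed.

Section SteinBound.
Variables (f df ddf : R -> R) (C lam : R).
Hypotheses (Hf : forall x : R, is_derive x 1 f (df x))
  (Hdf : forall x : R, is_derive x 1 df (ddf x))
  (fC : forall x, [/\ `|f x| <= C, `|df x| <= C & `|ddf x| <= C])
  (lam0 : 0 < lam).

Let C0 : 0 <= C.
Proof. by have [fc0 _ _] := fC 0; apply: le_trans fc0; exact: normr_ge0. Qed.

(** The expansion is made at [x + a], that is at W and not at W - A_s, so that f'(W) does not depend
    on s and factors out of the sum of the A_s^2. *)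
Let taylor (x a : R) : `|f (x + a) - f x - a * df (x + a)| <= C * a ^+ 2.
Proof.
have [z zx Ez] := mean_value (x + a) x Hf.
have {}Ez : f (x + a) - f x = df z * a by rewrite -opprB Ez; ring.
rewrite Ez mulrC -mulrBr.
have [y _ ->] := mean_value (x + a) z Hdf.
have -> : a ^+ 2 = `|a| * `|a| by rewrite -normrM -expr2 ger0_norm ?sqr_ge0.
rewrite !normrM mulrCA ler_pM// ?mulr_ge0//; first by have [_ _] := fC y.
rewrite ler_wpM2l//; apply: (le_trans zx).
by rewrite opprD addrA subrr sub0r normrN.
Qed.

Let Q w := 2^-1 * c ^+ 2 * quad w.

(* Since [core s] is independent of the [s]-th observation, [row s] is centred
   given [core s]; so the corrected variable has the same mean as
   [df W - W * f W]. *)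
Let corrected w := df (dsum w) - dsum w * f (dsum w) +
  2^-1 * c * \sum_s row s w * f (core s w).

Let amgm3 (x : R) : `|x| * x ^+ 2 <= lam * x ^+ 2 + lam^-1 * x ^+ 4.
Proof.
have := ler_wpM2r (sqr_ge0 x) (amgm x lam0); rewrite mulrDl -mulrA -exprD; exact.
Qed.

Let corrected_le w : `|corrected w| <=
  C * (lam + lam^-1 * (1 - Q w) ^+ 2) +
  2^-1 * (C * (lam * (c ^+ 2 * quad w) + lam^-1 * (c ^+ 4 * \sum_s row s w ^+ 4))).
Proof.
(* With W = (1/2) sum_s A_s, the linear Taylor terms add up to f'(W) Q; what remains is f'(W) (1 -
   Q) and half the sum of A_s times the Taylor remainders. *)
have -> : corrected w = df (dsum w) * (1 - Q w) -
   2^-1 * \sum_s c * row s w * (f (core s w + c * row s w) - f (core s w) - c * row s w * df (core s w + c * row s w)).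
  under eq_bigr => s _ do rewrite -dsum_core.
  rewrite (eq_bigr (fun s => c * (row s w * f (dsum w)) - c * (row s w * f (core s w))
     - c ^+ 2 * df (dsum w) * row s w ^+ 2)); last by move=> s _; ring.
  rewrite !sumrB -!mulr_sumr -mulr_suml -/(quad w).
  rewrite /corrected /Q {2}/dsum -/(row _ w); rewrite -/(\sum_s row s w).
  ring.
apply: (le_trans (ler_normB _ _)); apply: lerD.
  have [_ dfC _] := fC (dsum w); rewrite normrM; apply: ler_pM => //; exact: (amgm _ lam0).
rewrite normrM ger0_norm ?invr_ge0// ler_pM2l ?invr_gt0//.
apply: (le_trans (ler_norm_sum _ _ _)).
rewrite /quad !mulr_sumr -big_split /= mulr_sumr; apply: ler_sum => s _.
rewrite normrM; set x := c * row s w.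
have -> : lam * (c ^+ 2 * row s w ^+ 2) + lam^-1 * (c ^+ 4 * row s w ^+ 4) = lam * x ^+ 2 + lam^-1 * x ^+ 4.
  by rewrite /x !exprMn.
apply: le_trans (ler_wpM2l C0 (amgm3 x)).
by rewrite mulrCA ler_wpM2l//; exact: taylor.
Qed.

Let mf : measurable_fun setT f.
Proof.
apply: continuous_measurable_fun => z.
by apply: differentiable_continuous; apply/derivable1_diffP; exact: ex_derive.
Qed.

Let mdf : measurable_fun setT df.
Proof.
apply: continuous_measurable_fun => z.
by apply: differentiable_continuous; apply/derivable1_diffP; exact: ex_derive.
Qed.

(** Origin of the constant 5: 14/4 from the listed index patterns in E[Q^2], and 3/2 from the three
    pairings in the fourth moments of the rows. *)
Lemma stein_bound :
  `|'E (fun w => df (dsum w) - dsum w * f (dsum w))| <=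
  C * (2 * lam + lam^-1 * ((4^-1 * c ^+ 4 * n%:R ^+ 4 * (1 + 2 * kap) - 1)
      + 5 * c ^+ 4 * n%:R ^+ 3 * M)).
Proof.
have ibase : intble (fun w => df (dsum w) - dsum w * f (dsum w)).
  apply: intbleB.
    apply: (@bounded_integrable _ _ _ P _ C); first exact: (measurableT_comp mdf measurable_dsum).
    by move=> w; have [_ ? _] := fC (dsum w).
  apply: (intbleM_bounded (K := C)); [exact: intble_dsum|exact: (measurableT_comp mf measurable_dsum)|].
  by move=> w; have [? _ _] := fC (dsum w).
have icore s t : intble (fun w => h s t w * f (core s w)).
  apply: (intbleM_bounded (K := C)); [exact: intble_entry|exact: (measurableT_comp mf (measurable_core s))|].
  by move=> w; have [? _ _] := fC (core s w).
have irow s : intble (fun w => row s w * f (core s w)).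
  have hs : intble (fun w => \sum_t h s t w * f (core s w)) by apply: intble_sum => t _.
  by apply: intble_ext hs => w; rewrite /row mulr_suml.
have icorr : intble (fun w => 2^-1 * c * \sum_s row s w * f (core s w)).
  by apply: intbleZ; apply: intble_sum => s _.
have <- : 'E corrected = 'E (fun w => df (dsum w) - dsum w * f (dsum w)).
  rewrite /corrected RintegralD// RintegralZl//; last exact: intble_sum.
  rewrite Rintegral_sum// big1 ?mulr0 ?addr0// => s _.
  under eq_Rintegral do rewrite /row mulr_suml.
  rewrite Rintegral_sum// big1// => t _.
  by apply: (@h_core _ _ _ C) => // x; have [? _ _] := fC x.
have icorrected : intble corrected by exact: intbleD.
apply: (le_trans (le_normr_Rintegral _ icorrected)) => //.
have iq := intble_quad; have iq2 := intble_quad_sqr.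
have i4 : intble (fun w => \sum_s row s w ^+ 4).
  by apply: intble_sum => s _; exact: intble_row_quart.
have i1 : intble (fun=> 1) by exact: finite_measure_integrable_cst.
(* [a1] to [a4] are the coefficients of 1, [quad], [quad ^+ 2] and the sum of fourth powers of rows
   once (1 - Q)^2 is expanded. *)
pose a1 := C * lam + C * lam^-1.
pose a2 := C * lam * c ^+ 2 / 2 - C * lam^-1 * c ^+ 2.
pose a3 := C * lam^-1 * c ^+ 4 / 4.
pose a4 := C * lam^-1 * c ^+ 4 / 2.
pose bound w := a1 * 1 + a2 * quad w + a3 * quad w ^+ 2 + a4 * \sum_s row s w ^+ 4.
have ibound : intble bound by do !apply: intbleD; exact: intbleZ.
apply: (@le_trans _ _ ('E bound)).
  apply: le_Rintegral; [by []|exact: integrable_norm|exact: ibound|].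
  move=> w _; apply: (le_trans (corrected_le w)); rewrite le_eqVlt; apply/orP; left; apply/eqP.
  by rewrite /bound /Q /a1 /a2 /a3 /a4; field; rewrite gt_eqF.
have -> : 'E bound = a1 + a2 * (n%:R * (n%:R - 1)) + a3 * 'E (fun w => quad w ^+ 2) + a4 * \sum_s 'E (fun w => row s w ^+ 4).
  rewrite /bound !RintegralD ?RintegralZl//; do ?[by do !apply: intbleD; exact: intbleZ | by do !apply: intbleZ].
  rewrite expectation_quad Rintegral_cst// probability_fine !mulr1 Rintegral_sum// => s _.
  exact: intble_row_quart.
have q2 := expectation_quad_sqr.
have r4 : \sum_s 'E (fun w => row s w ^+ 4) <= n%:R * (3 * n%:R ^+ 2 * M).
  apply: (@le_trans _ _ (\sum_(s < n) (3 * n%:R ^+ 2 * M))); last by rewrite sumr_const card_ord -[leLHS]mulr_natl.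
  by apply: ler_sum => s _; exact: expectation_row_quart.
have li : 0 <= lam^-1 by rewrite invr_ge0 ltW.
have c40 : 0 <= c ^+ 4 by apply: exprn_even_ge0.
have a30 : 0 <= a3 by apply: mulr_ge0 => //; apply: mulr_ge0 => //; exact: mulr_ge0.
have a40 : 0 <= a4 by apply: mulr_ge0 => //; apply: mulr_ge0 => //; exact: mulr_ge0.
(* Since c^2 n (n - 1) = 2, this term equals C lam - 2 C / lam; added to [a1] it leaves 2 C lam - C
   / lam, the source of [2 * lam] and of [- 1] in the bound. *)
have e1 : a2 * (n%:R * (n%:R - 1)) = C * lam - 2 * C * lam^-1.
  have -> : a2 * (n%:R * (n%:R - 1)) = (C * lam / 2 - C * lam^-1) * (c ^+ 2 * (n%:R * (n%:R - 1))) by rewrite /a2; ring.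
  by rewrite c2; field; rewrite gt_eqF.
have := ler_wpM2l a30 q2; have := ler_wpM2l a40 r4; rewrite e1 /a1 /a3 /a4.
move=> h1' h2'.
apply: (le_trans (lerD (lerD (lexx _) h2') h1')).
rewrite le_eqVlt; apply/orP; left; apply/eqP.
by field; rewrite gt_eqF.
Qed.

End SteinBound.

End DegenerateArray.

(** * Second moments of row sums *)

Section RowCovariance.
Context d (Omega : measurableType d) (R : realType) (P : probability Omega R) (n : nat).
Variable h : 'I_n -> 'I_n -> Omega -> R.
Variable v : R.
Local Notation intble f := (integrable P setT (EFin \o f)).
Local Notation "''E' f" := (\int[P]_w (f w)) (at level 10, f at level 8).
Hypothesis h_diag : forall s w, h s s w = 0.
Hypothesis hC : forall s t w, h s t w = h t s w.
Hypothesis h_int2 : forall a b a' b', intble (fun w => h a b w * h a' b' w).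
Hypothesis h_isolated2 : forall s t a b, s \notin [:: a; b] ->
  'E (fun w => h s t w * h a b w) = 0.
Hypothesis h_var : forall s t, s != t -> 'E (fun w => h s t w ^+ 2) = v.

Lemma pair_moment s t a b : 'E (fun w => h s t w * h a b w) =
  v * ((s != t)%:R * (((s == a) && (t == b))%:R + ((s == b) && (t == a))%:R)).
Proof.
have [<-|st] /= := eqVneq s t.
  by rewrite mul0r mulr0 /Rintegral integral0_eq// => w _; rewrite h_diag mul0r.
have ts : t != s by rewrite eq_sym.
rewrite mul1r.
have [sa|sa] /= := eqVneq s a.
  subst a; rewrite (negbTE ts) andbF addr0.
  have [tb|tb] := eqVneq t b.
    by rewrite -tb mulr1 -(h_var st); apply: eq_Rintegral => w _; rewrite expr2.
  rewrite mulr0 -[RHS](@h_isolated2 t s s b); last by rewrite !inE negb_or ts.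
  by apply: eq_Rintegral => w _; rewrite (hC s t).
rewrite add0r; have [sb|sb] /= := eqVneq s b.
  subst b; have [ta|ta] := eqVneq t a.
    by rewrite -ta mulr1 -(h_var st); apply: eq_Rintegral => w _; rewrite (hC t s) expr2.
  rewrite mulr0 -[RHS](@h_isolated2 t s a s); last by rewrite !inE negb_or ts ta.
  by apply: eq_Rintegral => w _; rewrite (hC s t).
by rewrite mulr0 h_isolated2// !inE negb_or sa.
Qed.

Lemma intble_rowM s s' : intble (fun w => row h s w * row h s' w).
Proof.
have hs : intble (fun w => \sum_t \sum_t' h s t w * h s' t' w).
  by apply: intble_sum => t _; apply: intble_sum => t' _.
by apply: intble_ext hs => w; rewrite /row big_distrlr.
Qed.

(** Distinct entries are uncorrelated. A row shares its n - 1 off-diagonal entries with itself, but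
    two different rows share only the entry at their crossing. *)
Lemma row_moment s s' : 'E (fun w => row h s w * row h s' w) =
  v * (if s == s' then n%:R - 1 else 1).
Proof.
transitivity (\sum_t \sum_t' 'E (fun w => h s t w * h s' t' w)).
  under eq_Rintegral do rewrite /row big_distrlr /=.
  rewrite Rintegral_sum; last by move=> t _; apply: intble_sum => t' _.
  by apply: eq_bigr => t _; rewrite Rintegral_sum.
under eq_bigr => t _ do under eq_bigr => t' _ do rewrite pair_moment.
have delta (b : bool) (x : 'I_n) : \sum_t' (b && (x == t'))%:R = b%:R :> R.
  rewrite (bigD1 x)//= eqxx andbT big1 ?addr0// => t' /negbTE.
  by rewrite eq_sym => ->; rewrite andbF.
have delta' (b : bool) (x : 'I_n) : \sum_t' ((x == t') && b)%:R = b%:R :> R.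
  by rewrite -(delta b x); apply: eq_bigr => t' _; rewrite andbC.
transitivity (\sum_t v * ((s != t)%:R * ((s == s')%:R + (t == s')%:R))).
  apply: eq_bigr => t _; rewrite -!mulr_sumr big_split /=.
  by rewrite delta delta'.
rewrite -mulr_sumr; congr (_ * _).
have [<-|ss'] := eqVneq s s'.
  rewrite (bigD1 s)//= eqxx mul0r add0r.
  under eq_bigr => t ts do rewrite eq_sym ts (negbTE ts) addr0 mulr1.
  by rewrite sumr_const cardC1 card_ord -subn1 natrB// (leq_ltn_trans (leq0n s) (ltn_ord s)).
rewrite (bigD1 s')//= eqxx ss' add0r mulr1 big1 ?addr0// => t /negbTE ->.
by rewrite addr0 mulr0.
Qed.

Lemma total_moment : 'E (fun w => (\sum_s row h s w) ^+ 2) = v * (2 * (n%:R * (n%:R - 1))).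
Proof.
transitivity (\sum_s \sum_s' 'E (fun w => row h s w * row h s' w)).
  under eq_Rintegral do rewrite expr2 big_distrlr /=.
  rewrite Rintegral_sum; last by move=> t _; apply: intble_sum => t' _; exact: intble_rowM.
  by apply: eq_bigr => t _; rewrite Rintegral_sum// => t' _; exact: intble_rowM.
transitivity (\sum_(s < n) v * (2 * (n%:R - 1))); last by rewrite sumr_const card_ord -mulr_natl; ring.
apply: eq_bigr => s _; under eq_bigr do rewrite row_moment.
rewrite -mulr_sumr; congr (_ * _).
rewrite (bigD1 s)//= eqxx.
under eq_bigr => t ts do rewrite eq_sym (negbTE ts).
rewrite sumr_const cardC1 card_ord -subn1 natrB ?(leq_ltn_trans (leq0n s) (ltn_ord s))//.
ring.
Qed.

End RowCovariance.

(** * The array of a degenerate kernel evaluated on an i.i.d. sequence *)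

Section DegenerateMoments.
Context d (Omega : measurableType d) (R : realType) (P : probability Omega R).
Context d1 (T : measurableType d1).
Variables (Z : nat -> {mfun Omega >-> T}) (U : T -> T -> R).
Local Notation intble f := (integrable P setT (EFin \o f)).
Local Notation "''E' f" := (\int[P]_w (f w)) (at level 10, f at level 8).

Hypothesis iidZ : iid P (fun s => Z s).
Hypothesis mU : measurable_fun setT (fun z : T * T => U z.1 z.2).
Hypothesis U_sym : forall x y, U x y = U y x.
Hypothesis U_degenerate : exists2 N, measurable N /\ P (Z 0%N @^-1` N) = 0%E &
  forall x, ~ N x -> intble (fun w => U x (Z 1%N w)) /\ 'E (fun w => U x (Z 1%N w)) = 0.
Hypothesis U4 : intble (fun w => U (Z 0%N w) (Z 1%N w) ^+ 4).

Let mUX (e : nat) : measurable_fun setT (fun z : T * T => U z.1 z.2 ^+ e).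
Proof. exact: measurable_funX. Qed.

Lemma moment4 s t : s != t -> intble (fun w => U (Z s w) (Z t w) ^+ 4) /\
  'E (fun w => U (Z s w) (Z t w) ^+ 4) = 'E (fun w => U (Z 0%N w) (Z 1%N w) ^+ 4).
Proof.
by move=> st; exact: (@law_pair _ _ _ _ _ _ _ iidZ (fun z => U z.1 z.2 ^+ 4) 0%N 1%N).
Qed.

Lemma intble_expr2 : intble (fun w => U (Z 0%N w) (Z 1%N w) ^+ 2).
Proof.
apply: (@intble_le _ _ _ _ _ (fun w => 1 + U (Z 0%N w) (Z 1%N w) ^+ 4)).
- exact: (measurableT_comp (mUX 2) (measurable_fun_pair (measurable_funPT (Z 0%N)) (measurable_funPT (Z 1%N)))).
- by apply: intbleD => //; exact: finite_measure_integrable_cst.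
- move=> w; set x := U _ _; rewrite ger0_norm ?sqr_ge0//.
  have := sqr_ge0 (x ^+ 2 - 1); have := sqr_ge0 x; have := exprn_even_ge0 x (n := 4) isT; lra.
Qed.

Lemma moment2 s t : s != t -> intble (fun w => U (Z s w) (Z t w) ^+ 2) /\
  'E (fun w => U (Z s w) (Z t w) ^+ 2) = 'E (fun w => U (Z 0%N w) (Z 1%N w) ^+ 2).
Proof.
move=> st; apply: (@law_pair _ _ _ _ _ _ _ iidZ (fun z => U z.1 z.2 ^+ 2) 0%N 1%N) => //.
exact: intble_expr2.
Qed.

(** [U_degenerate] speaks of the indices 0 and 1; identical distribution carries the null set and
    the centred fibres to every index. *)
Let U_fibre : exists2 N, measurable N & (forall t, P (Z t @^-1` N) = 0%E) /\
  forall s x, ~ N x -> intble (fun w => U x (Z s w)) /\ 'E (fun w => U x (Z s w)) = 0.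
Proof.
have [N [mN PN] hN] := U_degenerate; exists N => //; split.
  by move=> t; rewrite -PN; exact: iidZ.2.
move=> s x /hN[ix Ex].
have mx : measurable_fun setT (fun z : T * T => U x z.2).
  exact: (measurableT_comp mU (measurable_fun_pair (measurable_cst x) measurable_snd)).
have [ss|ss] := eqVneq s 0%N.
  have [h1 h2] := @law_pair _ _ _ _ _ _ _ iidZ (fun z => U x z.2) 0%N 1%N 1%N s isT (ltac:(by rewrite ss)) mx ix.
  by split => //; apply: etrans h2 Ex.
have [h1 h2] := @law_pair _ _ _ _ _ _ _ iidZ (fun z => U x z.2) 0%N 1%N 0%N s isT (ltac:(by rewrite eq_sym)) mx ix.
by split => //; apply: etrans h2 Ex.
Qed.

Variable n : nat.

(* The sample with its [s]-th observation replaced by the fresh one [Z n]. *)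
Definition fresh (s i : 'I_n) : nat := if i == s then n else i.

Lemma fresh_inj s : injective (fresh s).
Proof.
move=> i j; rewrite /fresh; case: eqP => [->|_]; case: eqP => [-> //|_].
- by move=> E; have := ltn_ord j; rewrite -E ltnn.
- by move=> E; have := ltn_ord i; rewrite E ltnn.
- exact: val_inj.
Qed.

(** The modified sample still has length n and contains [Z t], but is independent of [Z s]. Once it
    is frozen, only [U] depends on [Z s], and its fibre is centred unless [Z t] falls in the null
    set. *)
Lemma fresh_vanish (s t : 'I_n) (psi : n.-tuple T -> R) : s != t ->
  measurable_fun setT psi ->
  intble (fun w => U (Z s w) (Z t w) * psi (sample_tuple Z (fresh s) w)) ->
  'E (fun w => U (Z s w) (Z t w) * psi (sample_tuple Z (fresh s) w)) = 0.
Proof.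
move=> st mpsi ipsi.
have [N mN [PN hN]] := U_fibre.
have ind : independent_pair P (sample_tuple Z (fresh s)) (Z s).
  have inj1 : injective (fun _ : 'I_1 => s : nat) by move=> i j _; rewrite !ord1.
  have dis (i : 'I_n) (j : 'I_1) : fresh s i <> s.
    rewrite /fresh; case: eqP => [_ E|ne /val_inj //].
    by have := ltn_ord s; rewrite -E ltnn.
  have h := indep_sample_tuple iidZ.1 (@fresh_inj s) inj1 dis.
  have -> : (Z s : Omega -> T) = (fun x => tnth x ord0) \o sample_tuple Z (fun _ : 'I_1 => s : nat).
    by apply/funext => w; rewrite /= tnth_mktuple.
  have h2 := independent_pair_comp (@measurable_id _ _ setT) (measurable_tnth ord0) h.
  exact: h2.
have tE w : tnth (sample_tuple Z (fresh s) w) t = Z t w.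
  by rewrite tnth_mktuple /fresh eq_sym (negbTE st).
pose G (z : n.-tuple T * T) := U (tnth z.1 t) z.2 * psi z.1.
transitivity ('E (fun w => G (sample_tuple Z (fresh s) w, Z s w))).
  by apply: eq_Rintegral => w _; rewrite /G /= tE U_sym.
apply: (@expectation_fibre0 _ _ _ _ _ _ _ P _ _ ind G _ _ ((fun x => tnth x t) @^-1` N)).
- apply: measurable_funM; last exact: (measurableT_comp mpsi).
  apply: (measurableT_comp mU (measurable_fun_pair (measurableT_comp (measurable_tnth t) measurable_fst) measurable_snd)).
- by apply: intble_ext ipsi => w; rewrite /G /= tE U_sym.
- by rewrite -[X in measurable X]setTI; exact: measurable_tnth.
- rewrite -(PN t); congr (P _).
  by apply/seteqP; split => w /=; rewrite tE.
- move=> x Nx; have [ix Ex] := hN s _ Nx; rewrite /G /=.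
  by rewrite RintegralZr// Ex mul0r.
Qed.

Lemma moment22 s t r u : uniq [:: s; t; r; u] ->
  'E (fun w => U (Z s w) (Z t w) ^+ 2 * U (Z r w) (Z u w) ^+ 2) =
  'E (fun w => U (Z 0%N w) (Z 1%N w) ^+ 2) ^+ 2.
Proof.
rewrite /= !inE !negb_or => /and4P[/and3P[st sr su] /andP[tr tu] ru _].
pose o0 : 'I_2 := ord0; pose o1 : 'I_2 := lift ord0 ord0.
pose f (x : 2.-tuple T) := U (tnth x o0) (tnth x o1) ^+ 2.
have mf : measurable_fun setT f.
  apply: (measurableT_comp (mUX 2) (measurable_fun_pair (measurable_tnth o0) (measurable_tnth o1))).
pose tau (a b : nat) (i : 'I_2) : nat := nth 0%N [:: a; b] i.
have inj a b : a != b -> injective (tau a b).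
  by move=> ab; apply: injective_nth; rewrite //= inE ab.
have fE a b w : f (sample_tuple Z (tau a b) w) = U (Z a w) (Z b w) ^+ 2.
  by rewrite /f /sample_tuple !tnth_mktuple.
have dis (i j : 'I_2) : tau s t i <> tau r u j.
  case: i => [[|[|//]] ?]; case: j => [[|[|//]] ?]; rewrite /tau /=; by apply/eqP.
have ind := indep_sample_tuple iidZ.1 (inj _ _ st) (inj _ _ ru) dis.
have i1 : intble (fun w => f (sample_tuple Z (tau s t) w)).
  by apply: intble_ext (moment2 st).1 => w; rewrite fE.
have i2 : intble (fun w => f (sample_tuple Z (tau r u) w)).
  by apply: intble_ext (moment2 ru).1 => w; rewrite fE.
have := expectation_indep_mul ind mf mf i1 i2.
have e1 a b : 'E (fun w => f (sample_tuple Z (tau a b) w)) = 'E (fun w => U (Z a w) (Z b w) ^+ 2).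
  by apply: eq_Rintegral => w _; rewrite fE.
rewrite !e1 (moment2 st).2 (moment2 ru).2 expr2 => <-.
by apply: eq_Rintegral => w _; rewrite !fE.
Qed.

Lemma moment_cycle s t r u : uniq [:: s; t; r; u] ->
  intble (fun w => U (Z 0%N w) (Z 1%N w) * U (Z 1%N w) (Z 2%N w) * U (Z 2%N w) (Z 3%N w) * U (Z 3%N w) (Z 0%N w)) ->
  'E (fun w => U (Z s w) (Z t w) * U (Z t w) (Z r w) * U (Z r w) (Z u w) * U (Z u w) (Z s w)) =
  'E (fun w => U (Z 0%N w) (Z 1%N w) * U (Z 1%N w) (Z 2%N w) * U (Z 2%N w) (Z 3%N w) * U (Z 3%N w) (Z 0%N w)).
Proof.
move=> us ic.
pose o0 : 'I_4 := ord0; pose o1 : 'I_4 := lift ord0 ord0.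
pose o2 : 'I_4 := lift ord0 (lift ord0 ord0); pose o3 : 'I_4 := lift ord0 (lift ord0 (lift ord0 ord0)).
pose f (x : 4.-tuple T) := U (tnth x o0) (tnth x o1) * U (tnth x o1) (tnth x o2)
  * U (tnth x o2) (tnth x o3) * U (tnth x o3) (tnth x o0).
have m2 a b : measurable_fun setT (fun x : 4.-tuple T => U (tnth x a) (tnth x b)).
  exact: (measurableT_comp mU (measurable_fun_pair (measurable_tnth a) (measurable_tnth b))).
have mf : measurable_fun setT f by do !apply: measurable_funM => //.
pose tau (a b c e : nat) (i : 'I_4) : nat := nth 0%N [:: a; b; c; e] i.
have fE a b c e w : f (sample_tuple Z (tau a b c e) w) =
    U (Z a w) (Z b w) * U (Z b w) (Z c w) * U (Z c w) (Z e w) * U (Z e w) (Z a w).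
  by rewrite /f /sample_tuple !tnth_mktuple.
have inj a b c e : uniq [:: a; b; c; e] -> injective (tau a b c e).
  by move=> abce; exact: injective_nth.
have [|_ h] := law_sample_tuple iidZ.1 iidZ.2 (inj 0%N 1%N 2%N 3%N isT) (inj _ _ _ _ us) mf.
  by apply: intble_ext ic => w; rewrite fE.
transitivity ('E (fun w => f (sample_tuple Z (tau s t r u) w))).
  by apply: eq_Rintegral => w _; rewrite fE.
by rewrite h; apply: eq_Rintegral => w _; rewrite fE.
Qed.

(** The diagonal is set to 0 as in [kmat], since [U] need not vanish on equal arguments. *)
Definition kernel_array (s t : 'I_n) (w : Omega) : R :=
  if s == t then 0 else U (Z s w) (Z t w).

Local Notation arr := kernel_array.

Lemma kernel_array_diag s w : arr s s w = 0.
Proof. by rewrite /arr eqxx. Qed.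

Lemma kernel_arrayC s t w : arr s t w = arr t s w.
Proof. by rewrite /arr eq_sym U_sym. Qed.

(** The same entry as a function on sample tuples, the form in which measurability and independence
    of a coordinate can be stated. *)
Definition kernel_entry (s t : 'I_n) (x : n.-tuple T) : R :=
  if s == t then 0 else U (tnth x s) (tnth x t).

Lemma measurable_kernel_entry s t : measurable_fun setT (kernel_entry s t).
Proof.
rewrite /kernel_entry; case: (s == t) => //.
exact: (measurableT_comp mU (measurable_fun_pair (measurable_tnth s) (measurable_tnth t))).
Qed.

Lemma kernel_arrayE s t w : arr s t w = kernel_entry s t (sample_tuple Z (@nat_of_ord n) w).
Proof. by rewrite /kernel_entry /sample_tuple !tnth_mktuple. Qed.

Lemma kernel_array_tuple s t :
  exists2 F, measurable_fun setT F & forall w, arr s t w = F (sample_tuple Z (@nat_of_ord n) w).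
Proof.
by exists (kernel_entry s t); [exact: measurable_kernel_entry|exact: kernel_arrayE].
Qed.

Lemma measurable_kernel_array s t : measurable_fun setT (arr s t).
Proof.
have [F mF FE] := kernel_array_tuple s t.
rewrite (_ : arr s t = F \o sample_tuple Z (@nat_of_ord n)); last by apply/funext.
exact: measurableT_comp.
Qed.

Lemma kernel_array4 s t : intble (fun w => arr s t w ^+ 4).
Proof.
have [st|st] := eqVneq s t.
  apply: intble_ext (@intble0 _ _ _ P) => w; by rewrite st kernel_array_diag expr0n.
by apply: intble_ext (moment4 st).1 => w; rewrite /arr (negbTE st).
Qed.

Lemma kernel_array4_le s t :
  'E (fun w => arr s t w ^+ 4) <= 'E (fun w => U (Z 0%N w) (Z 1%N w) ^+ 4).
Proof.
have [st|st] := eqVneq s t.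
  under eq_Rintegral do rewrite st kernel_array_diag expr0n.
  rewrite /Rintegral integral0_eq//; apply: Rintegral_ge0 => w _; exact: exprn_even_ge0.
rewrite -(moment4 st).2 le_eqVlt; apply/orP; left; apply/eqP.
by apply: eq_Rintegral => w _; rewrite /arr (negbTE st).
Qed.

Lemma kernel_array_var s t : s != t ->
  'E (fun w => arr s t w ^+ 2) = 'E (fun w => U (Z 0%N w) (Z 1%N w) ^+ 2).
Proof.
move=> st; rewrite -(moment2 st).2.
by apply: eq_Rintegral => w _; rewrite /arr (negbTE st).
Qed.

(** A function that ignores coordinate [s] takes the same value on the sample and on the one with a
    fresh observation at [s], which reduces the claim to [fresh_vanish]. *)
Lemma kernel_array_vanish (s t : 'I_n) (psi : n.-tuple T -> R) :
  measurable_fun setT psi ->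
  (forall x y, (forall i, i != s -> tnth x i = tnth y i) -> psi x = psi y) ->
  intble (fun w => arr s t w * psi (sample_tuple Z (@nat_of_ord n) w)) ->
  'E (fun w => arr s t w * psi (sample_tuple Z (@nat_of_ord n) w)) = 0.
Proof.
move=> mpsi loc ipsi.
have [st|st] := eqVneq s t.
  by rewrite /Rintegral integral0_eq// => w _; rewrite st kernel_array_diag mul0r.
have E w : arr s t w * psi (sample_tuple Z (@nat_of_ord n) w) = U (Z s w) (Z t w) * psi (sample_tuple Z (fresh s) w).
  rewrite /arr (negbTE st); congr (_ * _); apply: loc => i si.
  by rewrite !tnth_mktuple /fresh (negbTE si).
under eq_Rintegral do rewrite E.
by apply: fresh_vanish => //; exact: intble_ext ipsi.
Qed.

Lemma kernel_entry_local (s a b : 'I_n) x y : s != a -> s != b ->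
  (forall i, i != s -> tnth x i = tnth y i) -> kernel_entry a b x = kernel_entry a b y.
Proof. by move=> sa sb xy; rewrite /kernel_entry !xy// eq_sym. Qed.

Lemma kernel_array_isolated s t a b a' b' a'' b'' :
  s \notin [:: a; b; a'; b'; a''; b''] ->
  'E (fun w => arr s t w * (arr a b w * arr a' b' w * arr a'' b'' w)) = 0.
Proof.
rewrite !inE !negb_or => /and5P[sa sb sa' sb' /andP[sa'' sb'']].
pose psi x := kernel_entry a b x * kernel_entry a' b' x * kernel_entry a'' b'' x.
have E w : arr s t w * (arr a b w * arr a' b' w * arr a'' b'' w) =
    arr s t w * psi (sample_tuple Z (@nat_of_ord n) w).
  by rewrite /psi /kernel_entry /sample_tuple !tnth_mktuple.
under eq_Rintegral do rewrite E.
apply: kernel_array_vanish.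
- by do !apply: measurable_funM; exact: measurable_kernel_entry.
- by move=> x y xy; rewrite /psi !(@kernel_entry_local s _ _ x y).
- apply: intble_ext (intble_prod4 measurable_kernel_array kernel_array4 s t a b a' b' a'' b'') => w.
  by rewrite -E; ring.
Qed.

Lemma kernel_array_isolated2 s t a b : s \notin [:: a; b] ->
  'E (fun w => arr s t w * arr a b w) = 0.
Proof.
rewrite !inE !negb_or => /andP[sa sb].
have E w : arr s t w * arr a b w = arr s t w * kernel_entry a b (sample_tuple Z (@nat_of_ord n) w).
  by rewrite /kernel_entry /sample_tuple !tnth_mktuple.
under eq_Rintegral do rewrite E.
apply: kernel_array_vanish; first exact: measurable_kernel_entry.
- by move=> x y xy; exact: (@kernel_entry_local s _ _ x y).
- apply: intble_ext (intble_prod2 measurable_kernel_array kernel_array4 s t a b) => w.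
  by rewrite -E.
Qed.

Lemma kernel_array_disjoint (s t r u : 'I_n) : uniq [:: s; t; r; u] ->
  'E (fun w => arr s t w ^+ 2 * arr r u w ^+ 2) =
  'E (fun w => U (Z 0%N w) (Z 1%N w) ^+ 2) ^+ 2.
Proof.
move=> us; have us' : uniq (map (@nat_of_ord n) [:: s; t; r; u]) by rewrite map_inj_uniq//; exact: val_inj.
rewrite -(moment22 us'); apply: eq_Rintegral => w _.
by move: us; rewrite /= !inE !negb_or /arr => /and4P[/and3P[/negbTE-> _ _] _ /negbTE-> _].
Qed.

Lemma kernel_array_cycle (s t r u : 'I_n) : uniq [:: s; t; r; u] ->
  'E (fun w => arr s t w * arr t r w * arr r u w * arr u s w) =
  'E (fun w => U (Z 0%N w) (Z 1%N w) * U (Z 1%N w) (Z 2%N w) * U (Z 2%N w) (Z 3%N w) * U (Z 3%N w) (Z 0%N w)).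
Proof.
move=> us; have us' : uniq (map (@nat_of_ord n) [:: s; t; r; u]) by rewrite map_inj_uniq//; exact: val_inj.
have icyc : intble (fun w => U (Z 0%N w) (Z 1%N w) * U (Z 1%N w) (Z 2%N w) * U (Z 2%N w) (Z 3%N w) * U (Z 3%N w) (Z 0%N w)).
  have m a b : measurable_fun setT (fun w => U (Z a w) (Z b w)).
    exact: (measurableT_comp mU (measurable_fun_pair (measurable_funPT (Z a)) (measurable_funPT (Z b)))).
  apply: (@intble_le _ _ _ _ _ (fun w => U (Z 0%N w) (Z 1%N w) ^+ 4 + U (Z 1%N w) (Z 2%N w) ^+ 4 + U (Z 2%N w) (Z 3%N w) ^+ 4 + U (Z 3%N w) (Z 0%N w) ^+ 4)).
  - by do !apply: measurable_funM.
  - have m4 a b (ab : a != b) := (@moment4 a b ab).1.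
    by do !apply: intbleD; exact: m4.
  - by move=> w; rewrite -mulrA; exact: prod4_le.
rewrite -(moment_cycle us' icyc); apply: eq_Rintegral => w _.
move: us; rewrite /= !inE !negb_or /arr => /and4P[/and3P[/negbTE-> _ su] /andP[/negbTE-> _] /negbTE-> _].
by rewrite eq_sym (negbTE su).
Qed.

End DegenerateMoments.

(** * Independence of the two whole samples *)

Section TwoSamples.
Context d (Omega : measurableType d) (R : realType) (P : probability Omega R).
Context d1 d2 (T1 : measurableType d1) (T2 : measurableType d2).
Variables (X : nat -> {mfun Omega >-> T1}) (Y : nat -> {mfun Omega >-> T2}).
Hypothesis XY_iid : iid P (fun s w => (X s w, Y s w)).
Hypothesis XY_indep : independent_pair P (X 0%N) (Y 0%N).

Lemma iid_fst : iid P (fun s => X s).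
Proof.
have [ind ide] := XY_iid; split.
  move=> J B mB; have := ind J (fun s => B s `*` setT) (fun s => measurableX (mB s) measurableT).
  have E s : (fun w => (X s w, Y s w)) @^-1` (B s `*` setT) = X s @^-1` B s.
    by apply/seteqP; split => w //= [].
  under eq_bigcapr do rewrite E.
  by under eq_bigr do rewrite E.
move=> s t B mB; have := ide s t (B `*` setT) (measurableX mB measurableT).
by congr (P _ = P _); apply/seteqP; split => w //= [].
Qed.

Lemma iid_snd : iid P (fun s => Y s).
Proof.
have [ind ide] := XY_iid; split.
  move=> J B mB; have := ind J (fun s => setT `*` B s) (fun s => measurableX measurableT (mB s)).
  have E s : (fun w => (X s w, Y s w)) @^-1` (setT `*` B s) = Y s @^-1` B s.
    by apply/seteqP; split => w //= [].
  under eq_bigcapr do rewrite E.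
  by under eq_bigr do rewrite E.
move=> s t B mB; have := ide s t (setT `*` B) (measurableX measurableT mB).
by congr (P _ = P _); apply/seteqP; split => w //= [].
Qed.

(** Independence is given at index 0 only. The pairs being i.i.d., the probability of a product of
    boxes factorises over the observations, and each factor equals its value at index 0, where it
    splits. *)
Lemma independent_samples m (tau : 'I_m -> nat) : injective tau ->
  independent_pair P (sample_tuple X tau) (sample_tuple Y tau).
Proof.
move=> inj; apply: independent_pair_tuples => A B mA mB.
have mXY s : measurable_fun setT (fun w => (X s w, Y s w)).
  by apply: measurable_fun_pair; exact: measurable_funPT.
pose XY_mfun s := isMeasurableFun.Build _ _ _ _ (fun w => (X s w, Y s w)) (mXY s).
pose XY s : {mfun Omega >-> (T1 * T2)%type} := HB.pack (fun w => (X s w, Y s w)) (XY_mfun s).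
have := @prob_sample_tuple_box _ _ _ P _ _ XY XY_iid.1 m tau (fun i => A i `*` B i) inj
  (fun i => measurableX (mA i) (mB i)).
rewrite (prob_sample_tuple_box iid_fst.1)// (prob_sample_tuple_box iid_snd.1)// -big_split /=.
have -> : sample_tuple XY tau @^-1` box (fun i => A i `*` B i) =
    sample_tuple X tau @^-1` box A `&` sample_tuple Y tau @^-1` box B.
  apply/seteqP; split => w /=.
    by move=> hw; split => i; have := hw i; rewrite !tnth_mktuple => -[].
  by move=> [h1 h2] i; have := h1 i; have := h2 i; rewrite !tnth_mktuple.
move=> ->; apply: eq_bigr => i _.
have e0 : P (XY (tau i) @^-1` (A i `*` B i)) = P (XY 0%N @^-1` (A i `*` B i)).
  exact: (XY_iid.2 _ _ _ (measurableX (mA i) (mB i))).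
rewrite e0 (iid_fst.2 (tau i) 0%N _ (mA i)) (iid_snd.2 (tau i) 0%N _ (mB i)).
by rewrite -XY_indep//; congr (P _); apply/seteqP; split => w.
Qed.

End TwoSamples.

(** * Algebra of U-centring *)

Section UCenterAlgebra.
Context (R : realType) (n : nat).
Implicit Types A B : 'M[R]_n.

Lemma ucenterD A B : ucenter (A + B) = ucenter A + ucenter B.
Proof.
apply/matrixP => s t; rewrite !mxE; case: (s == t); first by rewrite addr0.
under eq_bigr do rewrite mxE; under [X in _ - _ * X]eq_bigr do rewrite mxE.
under [X in _ + _ * X]eq_bigr do (under eq_bigr do rewrite mxE; rewrite big_split).
by rewrite !big_split /=; ring.
Qed.

Lemma ucenterZ (a : R) A : ucenter (a *: A) = a *: ucenter A.
Proof.
apply/matrixP => s t; rewrite !mxE; case: (s == t); first by rewrite mulr0.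
under eq_bigr do rewrite mxE; under [X in _ - _ * X]eq_bigr do rewrite mxE.
under [X in _ + _ * X]eq_bigr do (under eq_bigr do rewrite mxE; rewrite -mulr_sumr).
by rewrite -!mulr_sumr; ring.
Qed.

Lemma ucenter_sum (I : Type) (r : seq I) (A : I -> 'M[R]_n) :
  ucenter (\sum_(i <- r) A i) = \sum_(i <- r) ucenter (A i).
Proof.
have c0 : ucenter (0 : 'M[R]_n) = 0 by have := ucenterZ 0 0; rewrite !scale0r.
exact: (big_morph _ ucenterD c0).
Qed.

Lemma uprodC A B : uprod A B = uprod B A.
Proof.
by congr (_ * _); apply: eq_bigr => s _; apply: eq_bigr => t _; rewrite mulrC.
Qed.

Lemma uprodDl A A' B : uprod (A + A') B = uprod A B + uprod A' B.
Proof.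
rewrite /uprod -mulrDr -big_split; congr (_ * _); apply: eq_bigr => s _ /=.
by rewrite -big_split /=; apply: eq_bigr => t _; rewrite mxE mulrDl.
Qed.

Lemma uprodZl (a : R) A B : uprod (a *: A) B = a * uprod A B.
Proof.
rewrite /uprod mulrCA; congr (_ * _); rewrite mulr_sumr; apply: eq_bigr => s _ /=.
by rewrite mulr_sumr; apply: eq_bigr => t _; rewrite mxE mulrA.
Qed.

Lemma uprod_suml (I : Type) (r : seq I) (A : I -> 'M[R]_n) B :
  uprod (\sum_(i <- r) A i) B = \sum_(i <- r) uprod (A i) B.
Proof.
have u0 : uprod 0 B = 0 by have := uprodZl 0 0 B; rewrite scale0r mul0r.
exact: (big_morph (fun A => uprod A B) (fun A A' => uprodDl A A' B) u0).
Qed.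

(* The rows of [ucenter A] sum to zero, so only one factor needs centring. *)
Lemma uprod_ucenterE A B : (2 < n)%N ->
  (forall s t, A s t = A t s) -> (forall s, A s s = 0) ->
  (forall s t, B s t = B t s) -> (forall s, B s s = 0) ->
  uprod (ucenter A) (ucenter B) = (n%:R * (n%:R - 3))^-1 *
   (\sum_s \sum_t A s t * B s t
    - 2 / (n%:R - 2) * (\sum_s (\sum_t A s t) * (\sum_t B s t))
    + ((n%:R - 1) * (n%:R - 2))^-1 * ((\sum_s \sum_t A s t) * (\sum_s \sum_t B s t))).
Proof.
move=> n2 AC A0 BC B0; rewrite /uprod; congr (_ * _).
have n1n0 : n%:R - 1 != 0 :> R by rewrite subr_eq0 (eqr_nat R n 1); case: n n2 => [|[|]].
have n2n0 : n%:R - 2 != 0 :> R by rewrite subr_eq0 (eqr_nat R n 2); case: n n2 => [|[|[|]]].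
set k := (n%:R - 2)^-1; set l := ((n%:R - 1) * (n%:R - 2))^-1.
pose r s := \sum_t A s t; pose rho s := \sum_t B s t.
(* The two grand totals are made opaque, so that [ring] and [field] treat them as atoms. *)
have [g gE] : exists g, g = \sum_s r s by eexists.
have [gam gamE] : exists gam, gam = \sum_s rho s by eexists.
rewrite -[\sum_s \sum_t A s t]gE -[\sum_s \sum_t B s t]gamE.
pose At s t := A s t - k * r s - k * r t + l * g.
pose Bt s t := B s t - k * rho s - k * rho t + l * gam.
have AtE s t : s != t -> ucenter A s t = At s t.
  move=> /negbTE st; rewrite mxE st /At gE /r -/k -/l; congr (_ - _ * _ + _ * _).
  by apply: eq_bigr => v _; rewrite AC.
have BtE s t : s != t -> ucenter B s t = Bt s t.
  move=> /negbTE st; rewrite mxE st /Bt gamE /rho -/k -/l; congr (_ - _ * _ + _ * _).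
  by apply: eq_bigr => v _; rewrite BC.
transitivity (\sum_s \sum_(t | s != t) At s t * Bt s t).
  by apply: eq_bigr => s _; apply: eq_bigr => t st; rewrite AtE// BtE.
have AtC s t : At s t = At t s by rewrite /At AC; ring.
(* The off-diagonal row sum equals r_s (1 - (n - 2) k) + g ((n - 1) l - k); the factors in the
   definition of U-centring are exactly those that make both brackets vanish. *)
have At0 s : \sum_(t | s != t) At s t = 0.
  have -> : \sum_(t | s != t) At s t = \sum_t At s t - At s s.
    by rewrite [in RHS](bigD1 s)//= addrC addrK; apply: eq_bigl => t; rewrite eq_sym.
  rewrite /At big_split /= !sumrB -/(r s) !sumr_const card_ord A0 -mulr_sumr -gE.
  by rewrite -(mulr_natl (k * r s) n) -(mulr_natl (l * g) n) /k /l; field; rewrite n1n0 n2n0.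
have At0' t : \sum_(s | s != t) At s t = 0.
  by rewrite -[RHS](At0 t); apply: eq_big => s; [rewrite eq_sym|move=> _; rewrite AtC].
transitivity (\sum_s \sum_(t | s != t) At s t * B s t).
  transitivity (\sum_s \sum_(t | s != t) At s t * B s t
     - \sum_s \sum_(t | s != t) k * rho s * At s t - \sum_s \sum_(t | s != t) k * rho t * At s t
     + \sum_s \sum_(t | s != t) l * gam * At s t).
    rewrite -!sumrB -big_split /=; apply: eq_bigr => s _.
    rewrite -!sumrB -big_split /=; apply: eq_bigr => t _.
    by rewrite /Bt; ring.
  rewrite [X in _ - X - _ + _]big1 => [|s _]; last by rewrite -mulr_sumr At0 mulr0.
  rewrite [X in _ - _ - X + _](exchange_big_dep xpredT)//= [X in _ - _ - X + _]big1 => [|t _]; last first.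
    by rewrite -mulr_sumr At0' mulr0.
  rewrite [X in _ + X]big1 => [|s _]; last by rewrite -mulr_sumr At0 mulr0.
  by rewrite !subr0 addr0.
transitivity (\sum_s \sum_t At s t * B s t).
  apply: eq_bigr => s _; rewrite [RHS](bigD1 s)//= B0 mulr0 add0r.
  by apply: eq_bigl => t; rewrite eq_sym.
transitivity (\sum_s \sum_t A s t * B s t - k * (\sum_s \sum_t r s * B s t)
    - k * (\sum_s \sum_t r t * B s t) + l * g * (\sum_s \sum_t B s t)).
  rewrite !mulr_sumr -!sumrB -big_split /=; apply: eq_bigr => s _.
  rewrite !mulr_sumr -!sumrB -big_split /=; apply: eq_bigr => t _.
  by rewrite /At; ring.
have e1 : \sum_s \sum_t r s * B s t = \sum_s r s * rho s.
  by apply: eq_bigr => s _; rewrite -mulr_sumr.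
have e2 : \sum_s \sum_t r t * B s t = \sum_s r s * rho s.
  rewrite exchange_big; apply: eq_bigr => t _ /=; rewrite -mulr_sumr; congr (_ * _).
  by apply: eq_bigr => s _; rewrite BC.
by rewrite e1 e2 -[\sum_s \sum_t B s t]gamE /k; ring.
Qed.

End UCenterAlgebra.

(** * The product array of two independent samples *)

Section ProductKernel.
Context d (Omega : measurableType d) (R : realType) (P : probability Omega R).
Context d1 d2 (T1 : measurableType d1) (T2 : measurableType d2).
Variables (X : nat -> {mfun Omega >-> T1}) (Y : nat -> {mfun Omega >-> T2}).
Variables (U : T1 -> T1 -> R) (V : T2 -> T2 -> R).
Local Notation intble f := (integrable P setT (EFin \o f)).
Local Notation "''E' f" := (\int[P]_w (f w)) (at level 10, f at level 8).

Hypothesis XY_iid : iid P (fun s w => (X s w, Y s w)).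
Hypothesis XY_indep : independent_pair P (X 0%N) (Y 0%N).
Hypothesis mU : measurable_fun setT (fun z : T1 * T1 => U z.1 z.2).
Hypothesis U_sym : forall x y, U x y = U y x.
Hypothesis U_degenerate : exists2 N, measurable N /\ P (X 0%N @^-1` N) = 0%E &
  forall x, ~ N x -> intble (fun w => U x (X 1%N w)) /\ 'E (fun w => U x (X 1%N w)) = 0.
Hypothesis U4 : intble (fun w => U (X 0%N w) (X 1%N w) ^+ 4).
Hypothesis mV : measurable_fun setT (fun z : T2 * T2 => V z.1 z.2).
Hypothesis V_sym : forall x y, V x y = V y x.
Hypothesis V_degenerate : exists2 N, measurable N /\ P (Y 0%N @^-1` N) = 0%E &
  forall x, ~ N x -> intble (fun w => V x (Y 1%N w)) /\ 'E (fun w => V x (Y 1%N w)) = 0.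
Hypothesis V4 : intble (fun w => V (Y 0%N w) (Y 1%N w) ^+ 4).

Let mU2 := 'E (fun w => U (X 0%N w) (X 1%N w) ^+ 2).
Let mV2 := 'E (fun w => V (Y 0%N w) (Y 1%N w) ^+ 2).
Let mU4 := 'E (fun w => U (X 0%N w) (X 1%N w) ^+ 4).
Let mV4 := 'E (fun w => V (Y 0%N w) (Y 1%N w) ^+ 4).
Let cycU := 'E (fun w => U (X 0%N w) (X 1%N w) * U (X 1%N w) (X 2%N w) * U (X 2%N w) (X 3%N w) * U (X 3%N w) (X 0%N w)).
Let cycV := 'E (fun w => V (Y 0%N w) (Y 1%N w) * V (Y 1%N w) (Y 2%N w) * V (Y 2%N w) (Y 3%N w) * V (Y 3%N w) (Y 0%N w)).

Variable n : nat.
Let Xv := sample_tuple X (@nat_of_ord n).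
Let Yv := sample_tuple Y (@nat_of_ord n).
Local Notation u := (@kernel_array _ Omega R _ T1 X U n).
Local Notation v := (@kernel_array _ Omega R _ T2 Y V n).

Let iidX := iid_fst XY_iid.
Let iidY := iid_snd XY_iid.

Let indXY : independent_pair P Xv Yv.
Proof. by apply: independent_samples => //; exact: val_inj. Qed.

(** Dependence on one sample only, in a form stable under products and sums; [via_factor] then
    splits expectations between the X and the Y sample. *)
Let via d0 (T0 : measurableType d0) (Z : Omega -> T0) (f : Omega -> R) :=
  exists2 F, measurable_fun setT F & forall w, f w = F (Z w).

Let viaM d0 (T0 : measurableType d0) (Z : Omega -> T0) f g :
  via Z f -> via Z g -> via Z (fun w => f w * g w).
Proof.
move=> [F mF FE] [G mG GE]; exists (fun x => F x * G x); first exact: measurable_funM.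
by move=> w; rewrite FE GE.
Qed.

Let via_sum d0 (T0 : measurableType d0) (Z : Omega -> T0) (I : Type) (r : seq I) (f : I -> Omega -> R) :
  (forall i, via Z (f i)) -> via Z (fun w => \sum_(i <- r) f i w).
Proof.
move=> hf; elim: r => [|i r [F mF FE]].
  by exists (fun=> 0) => // w; rewrite big_nil.
have [G mG GE] := hf i; exists (fun x => G x + F x); first exact: measurable_funD.
by move=> w; rewrite big_cons FE GE.
Qed.

Let via_factor f g : via Xv f -> via Yv g -> intble f -> intble g ->
  intble (fun w => f w * g w) /\ 'E (fun w => f w * g w) = ('E f) * ('E g).
Proof.
move=> [F mF FE] [G mG GE] iF iG.
have eF : f = (fun w => F (Xv w)) by apply/funext.
have eG : g = (fun w => G (Yv w)) by apply/funext.
split; rewrite eF eG; rewrite eF in iF; rewrite eG in iG.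
  exact: (intble_indep_mul indXY mF mG iF iG).
exact: (expectation_indep_mul indXY mF mG iF iG).
Qed.

Let uX s t : via Xv (u s t). Proof. exact: kernel_array_tuple. Qed.
Let vY s t : via Yv (v s t). Proof. exact: kernel_array_tuple. Qed.

Let mu_ s t : measurable_fun setT (u s t). Proof. exact: measurable_kernel_array. Qed.
Let mv_ s t : measurable_fun setT (v s t). Proof. exact: measurable_kernel_array. Qed.
Let u4 s t : intble (fun w => u s t w ^+ 4). Proof. exact: (kernel_array4 iidX mU U4). Qed.
Let v4 s t : intble (fun w => v s t w ^+ 4). Proof. exact: (kernel_array4 iidY mV V4). Qed.

Let factor4 a b a' b' c e c' e' :
  'E (fun w => (u a b w * u a' b' w * (u c e w * u c' e' w)) *
               (v a b w * v a' b' w * (v c e w * v c' e' w))) =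
  ('E (fun w => u a b w * u a' b' w * (u c e w * u c' e' w))) *
  ('E (fun w => v a b w * v a' b' w * (v c e w * v c' e' w))).
Proof.
apply: (via_factor _ _ _ _).2.
- by do !apply: viaM.
- by do !apply: viaM.
- exact: (intble_prod4 mu_ u4).
- exact: (intble_prod4 mv_ v4).
Qed.

Let factor2 a b a' b' :
  'E (fun w => (u a b w * u a' b' w) * (v a b w * v a' b' w)) =
  ('E (fun w => u a b w * u a' b' w)) * ('E (fun w => v a b w * v a' b' w)).
Proof.
apply: (via_factor _ _ _ _).2.
- by do !apply: viaM.
- by do !apply: viaM.
- exact: (intble_prod2 mu_ u4).
- exact: (intble_prod2 mv_ v4).
Qed.

Variable S : R.
Hypotheses (S0 : 0 < S) (S2 : S ^+ 2 = mU2 * mV2).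

Definition product_array (s t : 'I_n) (w : Omega) : R := S^-1 * (u s t w * v s t w).
Local Notation H := product_array.

Let Sn0 : S != 0. Proof. by rewrite gt_eqF. Qed.

Let S4 : S^-1 ^+ 4 = (mU2 * mV2)^-1 ^+ 2.
Proof. by rewrite -S2 -[4%N]/(2 * 2)%N exprM exprVn. Qed.

Let mUVn0 : mU2 * mV2 != 0. Proof. by rewrite -S2 expf_neq0. Qed.
Let mU2n0 : mU2 != 0. Proof. by move: mUVn0; rewrite mulf_eq0 negb_or => /andP[]. Qed.
Let mV2n0 : mV2 != 0. Proof. by move: mUVn0; rewrite mulf_eq0 negb_or => /andP[]. Qed.

Lemma product_array_diag s w : H s s w = 0.
Proof. by rewrite /H kernel_array_diag mul0r mulr0. Qed.

Lemma product_arrayC s t w : H s t w = H t s w.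
Proof. by rewrite /H (kernel_arrayC _ U_sym) (kernel_arrayC _ V_sym). Qed.

Lemma measurable_product_array s t : measurable_fun setT (H s t).
Proof. by apply: measurable_funM => //; exact: measurable_funM. Qed.

Let quartic s t : intble (fun w => u s t w ^+ 4 * v s t w ^+ 4) /\
  'E (fun w => u s t w ^+ 4 * v s t w ^+ 4) = 'E (fun w => u s t w ^+ 4) * 'E (fun w => v s t w ^+ 4).
Proof.
apply: via_factor => //.
- have [F mF FE] := uX s t; exists (fun x => F x ^+ 4) => [|w]; last by rewrite FE.
  exact: measurable_funX.
- have [F mF FE] := vY s t; exists (fun x => F x ^+ 4) => [|w]; last by rewrite FE.
  exact: measurable_funX.
Qed.

Lemma product_array4 s t : intble (fun w => H s t w ^+ 4).
Proof.
apply: intble_ext (intbleZ (S^-1 ^+ 4) (quartic s t).1) => w.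
by rewrite /H !exprMn.
Qed.

(** The fourth moment splits into one factor per sample, and S^4 is the product of the squared
    second moments. This is the [M] of the abstract bound; divided by n it is the product of the two
    ratios assumed to vanish. *)
Lemma product_array4_le s t : 'E (fun w => H s t w ^+ 4) <= (mU4 / mU2 ^+ 2) * (mV4 / mV2 ^+ 2).
Proof.
have -> : 'E (fun w => H s t w ^+ 4) = S^-1 ^+ 4 * 'E (fun w => u s t w ^+ 4 * v s t w ^+ 4).
  rewrite -RintegralZl//; last exact: (quartic s t).1.
  by apply: eq_Rintegral => w _; rewrite /H !exprMn.
have -> : mU4 / mU2 ^+ 2 * (mV4 / mV2 ^+ 2) = S^-1 ^+ 4 * (mU4 * mV4).
  by rewrite S4; field; rewrite mU2n0 mV2n0.
rewrite ler_pM2l ?exprn_gt0 ?invr_gt0// (quartic s t).2 ler_pM//.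
- by apply: Rintegral_ge0 => w _; exact: exprn_even_ge0.
- by apply: Rintegral_ge0 => w _; exact: exprn_even_ge0.
- exact: (kernel_array4_le iidX mU U4).
- exact: (kernel_array4_le iidY mV V4).
Qed.

Lemma product_array_isolated s t a b a' b' a'' b'' :
  s \notin [:: a; b; a'; b'; a''; b''] ->
  'E (fun w => H s t w * (H a b w * H a' b' w * H a'' b'' w)) = 0.
Proof.
move=> sN.
transitivity ('E (fun w => S^-1 ^+ 4 * ((u s t w * u a b w * (u a' b' w * u a'' b'' w)) *
               (v s t w * v a b w * (v a' b' w * v a'' b'' w))))).
  by apply: eq_Rintegral => w _; rewrite /H; ring.
rewrite RintegralZl//; last first.
  apply: (via_factor _ _ _ _).1; [by do !apply: viaM|by do !apply: viaM| |].
    exact: (intble_prod4 mu_ u4).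
  exact: (intble_prod4 mv_ v4).
rewrite factor4.
have -> : 'E (fun w => u s t w * u a b w * (u a' b' w * u a'' b'' w)) = 0.
  rewrite -(kernel_array_isolated iidX mU U_sym U_degenerate U4 t sN).
  by apply: eq_Rintegral => w _; ring.
by rewrite mul0r mulr0.
Qed.

Lemma product_array_isolated2 s t a b : s \notin [:: a; b] ->
  'E (fun w => H s t w * H a b w) = 0.
Proof.
move=> sN.
transitivity ('E (fun w => S^-1 ^+ 2 * ((u s t w * u a b w) * (v s t w * v a b w)))).
  by apply: eq_Rintegral => w _; rewrite /H; ring.
rewrite RintegralZl//; last first.
  apply: (via_factor _ _ _ _).1; [by do !apply: viaM|by do !apply: viaM| |].
    exact: (intble_prod2 mu_ u4).
  exact: (intble_prod2 mv_ v4).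
by rewrite factor2 (kernel_array_isolated2 iidX mU U_sym U_degenerate U4 t sN) mul0r mulr0.
Qed.

Lemma product_array_var s t : s != t -> 'E (fun w => H s t w ^+ 2) = 1.
Proof.
move=> st.
transitivity ('E (fun w => S^-1 ^+ 2 * ((u s t w * u s t w) * (v s t w * v s t w)))).
  by apply: eq_Rintegral => w _; rewrite /H; ring.
rewrite RintegralZl//; last first.
  apply: (via_factor _ _ _ _).1; [by do !apply: viaM|by do !apply: viaM| |].
    exact: (intble_prod2 mu_ u4).
  exact: (intble_prod2 mv_ v4).
rewrite factor2.
have -> : 'E (fun w => u s t w * u s t w) = mU2.
  by rewrite /mU2 -(kernel_array_var iidX mU U4 st); apply: eq_Rintegral => w _; rewrite expr2.
have -> : 'E (fun w => v s t w * v s t w) = mV2.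
  by rewrite /mV2 -(kernel_array_var iidY mV V4 st); apply: eq_Rintegral => w _; rewrite expr2.
by rewrite -S2 -exprMn mulVf// expr1n.
Qed.

Lemma product_array_disjoint s t r q : uniq [:: s; t; r; q] ->
  'E (fun w => H s t w ^+ 2 * H r q w ^+ 2) <= 1.
Proof.
move=> us; rewrite le_eqVlt; apply/orP; left; apply/eqP.
transitivity ('E (fun w => S^-1 ^+ 4 * ((u s t w * u s t w * (u r q w * u r q w)) *
               (v s t w * v s t w * (v r q w * v r q w))))).
  by apply: eq_Rintegral => w _; rewrite /H; ring.
rewrite RintegralZl//; last first.
  apply: (via_factor _ _ _ _).1; [by do !apply: viaM|by do !apply: viaM| |].
    exact: (intble_prod4 mu_ u4).
  exact: (intble_prod4 mv_ v4).
rewrite factor4.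
have -> : 'E (fun w => u s t w * u s t w * (u r q w * u r q w)) = mU2 ^+ 2.
  by rewrite /mU2 -(kernel_array_disjoint iidX mU U4 us); apply: eq_Rintegral => w _; rewrite !expr2.
have -> : 'E (fun w => v s t w * v s t w * (v r q w * v r q w)) = mV2 ^+ 2.
  by rewrite /mV2 -(kernel_array_disjoint iidY mV V4 us); apply: eq_Rintegral => w _; rewrite !expr2.
by rewrite -[4%N]/(2 * 2)%N exprM -!exprMn -S2 -exprMn mulVf ?expr1n.
Qed.

(** Up to the absolute values this is an equality by independence; they make the bound nonnegative,
    as the abstract Stein bound requires of [kap]. *)
Lemma product_array_cycle s t r q : uniq [:: s; t; r; q] ->
  'E (fun w => H s t w * H t r w * H r q w * H q s w) <=
  `|cycU / mU2 ^+ 2| * `|cycV / mV2 ^+ 2|.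
Proof.
move=> us; rewrite -normrM; apply: le_trans (ler_norm _).
rewrite le_eqVlt; apply/orP; left; apply/eqP.
transitivity ('E (fun w => S^-1 ^+ 4 * ((u s t w * u t r w * (u r q w * u q s w)) *
               (v s t w * v t r w * (v r q w * v q s w))))).
  by apply: eq_Rintegral => w _; rewrite /H; ring.
rewrite RintegralZl//; last first.
  apply: (via_factor _ _ _ _).1; [by do !apply: viaM|by do !apply: viaM| |].
    exact: (intble_prod4 mu_ u4).
  exact: (intble_prod4 mv_ v4).
rewrite factor4.
have -> : 'E (fun w => u s t w * u t r w * (u r q w * u q s w)) = cycU.
  by rewrite /cycU -(kernel_array_cycle iidX mU U4 us); apply: eq_Rintegral => w _; rewrite mulrA.
have -> : 'E (fun w => v s t w * v t r w * (v r q w * v q s w)) = cycV.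
  by rewrite /cycV -(kernel_array_cycle iidY mV V4 us); apply: eq_Rintegral => w _; rewrite mulrA.
by rewrite S4; field; rewrite mU2n0 mV2n0.
Qed.

(** The whole Y sample is frozen first, which explains the order of arguments in [G]. For fixed [y],
    [core] is a function of the X sample that ignores coordinate [s], and degeneracy of [U] gives
    mean 0. *)
Lemma product_array_core c s t (f : R -> R) (K : R) : measurable_fun setT f ->
  (forall x, `|f x| <= K) -> 'E (fun w => H s t w * f (core H c s w)) = 0.
Proof.
move=> mf fK.
pose uF := @kernel_entry R _ T1 U n; pose vF := @kernel_entry R _ T2 V n.
pose Hyx (y : n.-tuple T2) (x : n.-tuple T1) a b := S^-1 * (uF a b x * vF a b y).
pose cyx y x := 2^-1 * c * \sum_(a | a != s) \sum_(b | b != s) Hyx y x a b.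
pose G (z : n.-tuple T2 * n.-tuple T1) := Hyx z.1 z.2 s t * f (cyx z.1 z.2).
have muF a b : measurable_fun setT (uF a b) by exact: measurable_kernel_entry.
have mvF a b : measurable_fun setT (vF a b) by exact: measurable_kernel_entry.
have mHyx a b : measurable_fun setT (fun z => Hyx z.1 z.2 a b).
  apply: measurable_funM => //; apply: measurable_funM.
    exact: (measurableT_comp (muF a b) measurable_snd).
  exact: (measurableT_comp (mvF a b) measurable_fst).
have sumE (g : 'I_n -> 'I_n -> R) : \sum_(a | a != s) \sum_(b | b != s) g a b =
    \sum_a \sum_b (if (a != s) && (b != s) then g a b else 0).
  rewrite big_mkcond; apply: eq_bigr => a _; case: (a != s) => /=.
    by rewrite big_mkcond.
  by apply/esym; exact: big1.
have mcyx : measurable_fun setT (fun z => cyx z.1 z.2).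
  apply: measurable_funM => //; under eq_fun do rewrite sumE.
  apply: measurable_sum => a; apply: measurable_sum => b.
  by case: ((a != s) && (b != s)).
have mG : measurable_fun setT G by apply: measurable_funM => //; exact: measurableT_comp.
have HE a b w : H a b w = Hyx (Yv w) (Xv w) a b.
  by rewrite /H !kernel_arrayE.
have GE w : H s t w * f (core H c s w) = G (Yv w, Xv w).
  rewrite /G /= HE /cyx /core; congr (_ * f (_ * _)).
  by apply: eq_bigr => a _; apply: eq_bigr => b _; rewrite HE.
under eq_Rintegral do rewrite GE.
apply: (@expectation_fibre0 _ _ _ _ _ _ _ P _ _ (independent_pair_sym indXY) G _ _ set0) => //.
- have iH : intble (fun w => H s t w * f (core H c s w)).
    apply: (intbleM_bounded (K := K)) => //.
      exact: (intble_entry measurable_product_array product_array4).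
    apply: (measurableT_comp mf); exact: (measurable_core measurable_product_array).
  by apply: intble_ext iH.
- by rewrite preimage_set0 measure0.
- move=> y _; pose psi x := S^-1 * vF s t y * f (cyx y x).
  have mpsi : measurable_fun setT psi.
    apply: measurable_funM => //; apply: (measurableT_comp mf).
    apply: (measurableT_comp mcyx (measurable_fun_pair (measurable_cst y) (@measurable_id _ _ setT))).
  transitivity ('E (fun w => u s t w * psi (Xv w))).
    by apply: eq_Rintegral => w _; rewrite /G /psi /Hyx /uF /= kernel_arrayE -/Xv; ring.
  apply: (kernel_array_vanish iidX mU U_sym U_degenerate) => //.
    move=> x x' xx'; rewrite /psi /cyx; congr (_ * f (_ * _)).
    apply: eq_bigr => a sa; apply: eq_bigr => b sb; rewrite /Hyx /uF.
    by rewrite (@kernel_entry_local _ _ _ U n s a b x x')// eq_sym.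
  apply: (intbleM_bounded (K := `|S^-1 * vF s t y| * K)).
  + exact: (intble_entry mu_ u4).
  + exact: (measurableT_comp mpsi (measurable_funPT Xv)).
  + by move=> w; rewrite normrM ler_wpM2l.
Qed.

Section SteinForProduct.
Variables (f df ddf : R -> R) (C lam c : R).
Hypotheses (Hf : forall x : R, is_derive x 1 f (df x))
  (Hdf : forall x : R, is_derive x 1 df (ddf x))
  (fC : forall x, [/\ `|f x| <= C, `|df x| <= C & `|ddf x| <= C])
  (lam0 : 0 < lam) (c2 : c ^+ 2 * (n%:R * (n%:R - 1)) = 2).

Lemma product_stein_bound :
  `|'E (fun w => df (dsum H c w) - dsum H c w * f (dsum H c w))| <=
  C * (2 * lam + lam^-1 *
    ((4^-1 * c ^+ 4 * n%:R ^+ 4 * (1 + 2 * (`|cycU / mU2 ^+ 2| * `|cycV / mV2 ^+ 2|)) - 1)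
      + 5 * c ^+ 4 * n%:R ^+ 3 * ((mU4 / mU2 ^+ 2) * (mV4 / mV2 ^+ 2)))).
Proof.
apply: (stein_bound product_array_diag product_arrayC measurable_product_array
  product_array4 product_array4_le product_array_isolated product_array_disjoint
  product_array_cycle _ product_array_isolated2 product_array_var c2 _ Hf Hdf fC lam0).
  by rewrite mulr_ge0.
exact: product_array_core.
Qed.

End SteinForProduct.

Section Remainder.
Hypothesis n6 : (6 <= n)%N.

(** The binomial coefficient as a polynomial in n, accessible to [field]; [nb_pairs_bin] identifies
    the two. *)
Definition nb_pairs : R := n%:R * (n%:R - 1) / 2.

Definition ustat (w : Omega) : R := Num.sqrt nb_pairs *
  (uprod (ucenter (\matrix_(s, t) u s t w)) (ucenter (\matrix_(s, t) v s t w)) / S).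

Let c := (Num.sqrt nb_pairs)^-1.
Let x : R := n%:R.

Let x6 : 6 <= x. Proof. by rewrite /x (ler_nat R 6). Qed.

Let N0 : 0 < nb_pairs.
Proof. by rewrite /nb_pairs -/x divr_gt0// mulr_gt0//; have := x6; lra. Qed.

Let sN0 : Num.sqrt nb_pairs != 0. Proof. by rewrite gt_eqF// sqrtr_gt0. Qed.

Let sN2 : Num.sqrt nb_pairs ^+ 2 = nb_pairs. Proof. by rewrite sqr_sqrtr// ltW. Qed.

Lemma pairs_scale : c ^+ 2 * (n%:R * (n%:R - 1)) = 2.
Proof. by rewrite /c exprVn sN2 /nb_pairs -/x; field; apply/andP; split; apply: lt0r_neq0; have := x6; lra. Qed.

Let rho1 w := \sum_s row u s w * row v s w.
Let rho2 w := (\sum_s row u s w) * (\sum_s row v s w).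

Let alpha := 2 / (x - 3).
Let beta := Num.sqrt nb_pairs / (S * x * (x - 3)) * (2 / (x - 2)).
Let gamma := Num.sqrt nb_pairs / (S * x * (x - 3) * (x - 1) * (x - 2)).

(** By [uprod_ucenterE] the main term is W times (n - 1) / (n - 3) = 1 + 2 / (n - 3), whence
    [alpha]; [beta] and [gamma] collect the factors of the row-sum products. *)
Lemma ustat_subE w : ustat w - dsum H c w =
  alpha * dsum H c w - beta * rho1 w + gamma * rho2 w.
Proof.
have nx3 : x - 3 != 0 by apply: lt0r_neq0; have := x6; lra.
have nx2 : x - 2 != 0 by apply: lt0r_neq0; have := x6; lra.
have nx1 : x - 1 != 0 by apply: lt0r_neq0; have := x6; lra.
have nx0 : x != 0 by apply: lt0r_neq0; have := x6; lra.
have n2 : (2 < n)%N by exact: leq_trans n6.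
pose A : 'M[R]_n := \matrix_(s, t) u s t w; pose B : 'M[R]_n := \matrix_(s, t) v s t w.
have AE s t : A s t = u s t w by rewrite mxE.
have BE s t : B s t = v s t w by rewrite mxE.
rewrite /ustat -/A -/B uprod_ucenterE//; last 4 first.
- by move=> s t; rewrite !AE (kernel_arrayC _ U_sym).
- by move=> s; rewrite AE kernel_array_diag.
- by move=> s t; rewrite !BE (kernel_arrayC _ V_sym).
- by move=> s; rewrite BE kernel_array_diag.
have eA s : \sum_t A s t = row u s w by apply: eq_bigr => t _; rewrite AE.
have eB s : \sum_t B s t = row v s w by apply: eq_bigr => t _; rewrite BE.
under [\sum_s (\sum_t A s t) * _]eq_bigr do rewrite eA eB.
under [\sum_s \sum_t A s t]eq_bigr do rewrite eA.
under [\sum_s \sum_t B s t]eq_bigr do rewrite eB.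
rewrite -/(rho1 w) -/(rho2 w) -/x.
have -> : \sum_s \sum_t A s t * B s t = 2 * Num.sqrt nb_pairs * S * dsum H c w.
  have -> : \sum_s \sum_t A s t * B s t = S * \sum_s \sum_t H s t w.
    rewrite mulr_sumr; apply: eq_bigr => s _; rewrite mulr_sumr; apply: eq_bigr => t _.
    by rewrite AE BE /H mulVKf.
  by rewrite /dsum /c; field.
have e : nb_pairs = x * (x - 1) / 2 by [].
move: (rho1 w) (rho2 w) (dsum H c w) => r1 r2 D.
have -> : D = (Num.sqrt nb_pairs ^+ 2) * (2 / (x * (x - 1))) * D.
  by rewrite sN2 e; field; rewrite nx0 nx1.
rewrite /alpha /beta /gamma.
have : Num.sqrt nb_pairs ^+ 2 = x * (x - 1) / 2 by rewrite sN2.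
move: (Num.sqrt nb_pairs) => q q2.
have -> : q * ((x * (x - 3))^-1 * (2 * q * S * (q ^+ 2 * (2 / (x * (x - 1))) * D) -
   2 / (x - 2) * r1 + ((x - 1) * (x - 2))^-1 * r2) / S) =
   q ^+ 2 * 2 / (x * (x - 3)) * (q ^+ 2 * (2 / (x * (x - 1))) * D)
   - q / (S * x * (x - 3)) * (2 / (x - 2)) * r1 + q / (S * x * (x - 3) * (x - 1) * (x - 2)) * r2.
  by field; rewrite Sn0 nx0 nx1 nx2 nx3.
rewrite q2; field.
by rewrite Sn0 nx0 nx1 nx2 nx3.
Qed.

Let via_row_u s : via Xv (row u s). Proof. by apply: via_sum. Qed.
Let via_row_v s : via Yv (row v s). Proof. by apply: via_sum. Qed.

Let u2 := intble_prod2 mu_ u4.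
Let v2 := intble_prod2 mv_ v4.
Let iso2u := kernel_array_isolated2 iidX mU U_sym U_degenerate U4 (n := n).
Let iso2v := kernel_array_isolated2 iidY mV V_sym V_degenerate V4 (n := n).
Let varu := kernel_array_var iidX mU U4 (n := n).
Let varv := kernel_array_var iidY mV V4 (n := n).
Let diagu := @kernel_array_diag _ Omega R _ T1 X U n.
Let diagv := @kernel_array_diag _ Omega R _ T2 Y V n.
Let Cu := @kernel_arrayC _ Omega R _ T1 X U U_sym n.
Let Cv := @kernel_arrayC _ Omega R _ T2 Y V V_sym n.

Let row_pair s t :
  intble (fun w => (row u s w * row u t w) * (row v s w * row v t w)) /\
  'E (fun w => (row u s w * row u t w) * (row v s w * row v t w)) =
  S ^+ 2 * (if s == t then x - 1 else 1) ^+ 2.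
Proof.
have [h1 h2] := via_factor (viaM (via_row_u s) (via_row_u t)) (viaM (via_row_v s) (via_row_v t))
  (intble_rowM u2 s t) (intble_rowM v2 s t).
split => //; rewrite h2 (row_moment diagu Cu u2 iso2u varu) (row_moment diagv Cv v2 iso2v varv).
transitivity (mU2 * (if s == t then x - 1 else 1) * (mV2 * (if s == t then x - 1 else 1))); first by [].
by rewrite S2 expr2; ring.
Qed.

(** The n diagonal terms contribute (n - 1)^2 each and the n (n - 1) others contribute 1 each, all
    times S^2. *)
Let rho1_sqr : intble (fun w => rho1 w ^+ 2) /\ 'E (fun w => rho1 w ^+ 2) = S ^+ 2 * (x ^+ 2 * (x - 1)).
Proof.
have E w : rho1 w ^+ 2 = \sum_s \sum_t (row u s w * row u t w) * (row v s w * row v t w).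
  rewrite /rho1 expr2 big_distrlr /=; apply: eq_bigr => s _; apply: eq_bigr => t _; ring.
have hs : intble (fun w => \sum_s \sum_t (row u s w * row u t w) * (row v s w * row v t w)).
  by apply: intble_sum => s _; apply: intble_sum => t _; exact: (row_pair s t).1.
split; first by apply: intble_ext hs => w; rewrite E.
under eq_Rintegral do rewrite E.
rewrite Rintegral_sum; last by move=> s _; apply: intble_sum => t _; exact: (row_pair s t).1.
transitivity (\sum_(s < n) S ^+ 2 * (x * (x - 1))).
  apply: eq_bigr => s _; rewrite Rintegral_sum; last by move=> t _; exact: (row_pair s t).1.
  under eq_bigr do rewrite (row_pair s _).2.
  rewrite -mulr_sumr; congr (_ * _); rewrite (bigD1 s)//= eqxx.
  under eq_bigr => t ts do rewrite eq_sym (negbTE ts) expr1n.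
  rewrite sumr_const cardC1 card_ord -subn1 natrB ?(leq_ltn_trans (leq0n s) (ltn_ord s))// -/x.
  ring.
by rewrite sumr_const card_ord -mulr_natl -/x; ring.
Qed.

Let rho2_sqr : intble (fun w => rho2 w ^+ 2) /\
  'E (fun w => rho2 w ^+ 2) = S ^+ 2 * (2 * (x * (x - 1))) ^+ 2.
Proof.
pose su w := \sum_s row u s w; pose sv w := \sum_s row v s w.
have iu : intble (fun w => su w * su w).
  have hs : intble (fun w => \sum_s \sum_t row u s w * row u t w).
    by apply: intble_sum => s _; apply: intble_sum => t _; exact: intble_rowM.
  by apply: intble_ext hs => w; rewrite /su big_distrlr.
have iv : intble (fun w => sv w * sv w).
  have hs : intble (fun w => \sum_s \sum_t row v s w * row v t w).
    by apply: intble_sum => s _; apply: intble_sum => t _; exact: intble_rowM.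
  by apply: intble_ext hs => w; rewrite /sv big_distrlr.
have vu : via Xv su by exact: via_sum.
have vv : via Yv sv by exact: via_sum.
have [h1 h2] := via_factor (viaM vu vu) (viaM vv vv) iu iv.
have E w : rho2 w ^+ 2 = (su w * su w) * (sv w * sv w) by rewrite /rho2 -/(su w) -/(sv w); ring.
split; first by apply: intble_ext h1 => w; rewrite E.
under eq_Rintegral do rewrite E.
rewrite h2.
have -> : 'E (fun w => su w * su w) = mU2 * (2 * (x * (x - 1))).
  rewrite -(total_moment diagu Cu u2 iso2u varu).
  by apply: eq_Rintegral => w _; rewrite expr2.
have -> : 'E (fun w => sv w * sv w) = mV2 * (2 * (x * (x - 1))).
  rewrite -(total_moment diagv Cv v2 iso2v varv).
  by apply: eq_Rintegral => w _; rewrite expr2.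
by rewrite S2; ring.
Qed.

Let dsum_sqr : intble (fun w => dsum H c w ^+ 2) /\ 'E (fun w => dsum H c w ^+ 2) = 1.
Proof.
have H2 := intble_prod2 measurable_product_array product_array4.
have E w : dsum H c w ^+ 2 = (2^-1 * c) ^+ 2 * (\sum_s row H s w) ^+ 2.
  by rewrite /dsum exprMn.
have hs : intble (fun w => (\sum_s row H s w) ^+ 2).
  have hs : intble (fun w => \sum_s \sum_t row H s w * row H t w).
    by apply: intble_sum => s _; apply: intble_sum => t _; exact: intble_rowM.
  by apply: intble_ext hs => w; rewrite expr2 big_distrlr.
split; first by apply: intble_ext (intbleZ ((2^-1 * c) ^+ 2) hs) => w; rewrite E.
under eq_Rintegral do rewrite E.
rewrite RintegralZl//.
rewrite (total_moment product_array_diag product_arrayC H2 product_array_isolated2 product_array_var).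
have -> : (2^-1 * c) ^+ 2 * (1 * (2 * (n%:R * (n%:R - 1)))) = 2^-1 * (c ^+ 2 * (n%:R * (n%:R - 1))) by field.
by rewrite pairs_scale mulVf.
Qed.

Lemma measurable_ustat : measurable_fun setT ustat.
Proof.
have E w : ustat w = dsum H c w + (alpha * dsum H c w - beta * rho1 w + gamma * rho2 w).
  by rewrite -ustat_subE addrC subrK.
rewrite (_ : ustat = fun w => dsum H c w + (alpha * dsum H c w - beta * rho1 w + gamma * rho2 w)); last by apply/funext.
have mru s : measurable_fun setT (row u s) by exact: measurable_row.
have mrv s : measurable_fun setT (row v s) by exact: measurable_row.
have mD : measurable_fun setT (dsum H c) by exact: (measurable_dsum measurable_product_array).
have m1 : measurable_fun setT rho1 by apply: measurable_sum => s; exact: measurable_funM.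
have m2 : measurable_fun setT rho2 by apply: measurable_funM; exact: measurable_sum.
apply: measurable_funD => //; apply: measurable_funD; last exact: measurable_funM.
by apply: measurable_funB; exact: measurable_funM.
Qed.

(** The row products [rho1] dominate, with order 1/n; the other two terms have order 1/n^2. The
    constant is 240 = 3 (16 + 32 + 32), the 3 coming from the square of a sum of three terms. *)
Lemma remainder_sqr : intble (fun w => (ustat w - dsum H c w) ^+ 2) /\
  'E (fun w => (ustat w - dsum H c w) ^+ 2) <= 240 / x.
Proof.
have [i1 E1] := rho1_sqr; have [i2 E2] := rho2_sqr; have [i3 E3] := dsum_sqr.
pose bound w := 3 * (alpha ^+ 2 * dsum H c w ^+ 2 + beta ^+ 2 * rho1 w ^+ 2 + gamma ^+ 2 * rho2 w ^+ 2).
have ib0 : intble (fun w => alpha ^+ 2 * dsum H c w ^+ 2 + beta ^+ 2 * rho1 w ^+ 2 + gamma ^+ 2 * rho2 w ^+ 2).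
  by do !apply: intbleD; exact: intbleZ.
have ib : intble bound by exact: intbleZ.
have le w : (ustat w - dsum H c w) ^+ 2 <= bound w.
  rewrite ustat_subE /bound -!exprMn.
  move: (alpha * _) (beta * _) (gamma * _) => a b e.
  have := sqr_ge0 (a + b); have := sqr_ge0 (a - e); have := sqr_ge0 (b + e); lra.
have isq : intble (fun w => (ustat w - dsum H c w) ^+ 2).
  apply: (intble_le _ ib).
    apply: measurable_funX; apply: measurable_funB; first exact: measurable_ustat.
    exact: (measurable_dsum measurable_product_array).
  by move=> w; rewrite ger0_norm ?sqr_ge0.
split => //; apply: (@le_trans _ _ ('E bound)).
  by apply: le_Rintegral => // w _; exact: le.
have -> : 'E bound = 3 * (alpha ^+ 2 + beta ^+ 2 * (S ^+ 2 * (x ^+ 2 * (x - 1)))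
    + gamma ^+ 2 * (S ^+ 2 * (2 * (x * (x - 1))) ^+ 2)).
  rewrite /bound RintegralZl// RintegralD//; [|by apply: intbleD; exact: intbleZ|exact: intbleZ].
  rewrite RintegralD//; [|exact: intbleZ|exact: intbleZ].
  by rewrite !RintegralZl// E1 E2 E3 mulr1.
have nx3 : x - 3 != 0 by apply: lt0r_neq0; have := x6; lra.
have nx2 : x - 2 != 0 by apply: lt0r_neq0; have := x6; lra.
have nx1 : x - 1 != 0 by apply: lt0r_neq0; have := x6; lra.
have nx0 : x != 0 by apply: lt0r_neq0; have := x6; lra.
pose i3' := (x - 3) ^- 2; pose i2' := (x - 2) ^- 2.
have bE : beta ^+ 2 * (S ^+ 2 * (x ^+ 2 * (x - 1))) = 2 * x * (x - 1) ^+ 2 * i3' * i2'.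
  have -> : beta ^+ 2 * (S ^+ 2 * (x ^+ 2 * (x - 1))) = Num.sqrt nb_pairs ^+ 2 * 4 * (x - 1) * i3' * i2'.
    by rewrite /beta /i3' /i2'; field; rewrite Sn0 nx0 nx2 nx3.
  by rewrite sN2 /nb_pairs -/x; field.
have gE : gamma ^+ 2 * (S ^+ 2 * (2 * (x * (x - 1))) ^+ 2) = 2 * x * (x - 1) * i3' * i2'.
  have -> : gamma ^+ 2 * (S ^+ 2 * (2 * (x * (x - 1))) ^+ 2) = Num.sqrt nb_pairs ^+ 2 * 4 * i3' * i2'.
    by rewrite /gamma /i3' /i2'; field; rewrite Sn0 nx0 nx1 nx2 nx3.
  by rewrite sN2 /nb_pairs -/x; field.
have aE : alpha ^+ 2 = 4 * i3' by rewrite /alpha /i3'; field.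
rewrite aE bE gE.
have x0 : 0 < x by have := x6; lra.
(* For x >= 6 one has x - 3 >= x / 2; this is the reason for requiring n >= 6. *)
have h3 : i3' <= 4 / x ^+ 2.
  rewrite /i3' -[4 / _]invrK invf_div lef_pV2 ?posrE ?exprn_gt0 ?divr_gt0 ?exprn_gt0//; last by have := x6; lra.
  rewrite ler_pdivrMr//; have := x6; nra.
have h2 : i2' <= 4 / x ^+ 2.
  rewrite /i2' -[4 / _]invrK invf_div lef_pV2 ?posrE ?exprn_gt0 ?divr_gt0 ?exprn_gt0//; last by have := x6; lra.
  rewrite ler_pdivrMr//; have := x6; nra.
have i30 : 0 <= i3' by rewrite /i3' invr_ge0 sqr_ge0.
have i20 : 0 <= i2' by rewrite /i2' invr_ge0 sqr_ge0.
have h23 : i3' * i2' <= 4 / x ^+ 2 * (4 / x ^+ 2) by exact: ler_pM.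
have t1 : 2 * x * (x - 1) ^+ 2 * i3' * i2' <= 32 / x.
  have -> : 32 / x = 2 * x * x ^+ 2 * (4 / x ^+ 2 * (4 / x ^+ 2)) by field.
  rewrite -mulrA; apply: ler_pM => //.
  - by apply: mulr_ge0; [apply: mulr_ge0 => //; exact: ltW|exact: sqr_ge0].
  - exact: mulr_ge0.
  - rewrite ler_pM2l ?mulr_gt0//; have := x6; nra.
have t2 : 2 * x * (x - 1) * i3' * i2' <= 32 / x.
  have -> : 32 / x = 2 * x * x ^+ 2 * (4 / x ^+ 2 * (4 / x ^+ 2)) by field.
  rewrite -mulrA; apply: ler_pM => //.
  - by apply: mulr_ge0; [apply: mulr_ge0 => //; exact: ltW|have := x6; lra].
  - exact: mulr_ge0.
  - rewrite ler_pM2l ?mulr_gt0//; have := x6; nra.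
have t3 : 4 * i3' <= 16 / x.
  have e : 16 / x = 4 * (4 / x ^+ 2) * x by field.
  rewrite e; apply: (@le_trans _ _ (4 * (4 / x ^+ 2) * 1)); first by rewrite mulr1 ler_pM2l.
  rewrite ler_pM2l ?mulr_gt0 ?invr_gt0 ?exprn_gt0//; have := x6; lra.
have -> : 240 / x = 3 * (16 / x + 32 / x + 32 / x) by field.
by rewrite ler_pM2l// !lerD.
Qed.

End Remainder.

End ProductKernel.

(** * The normalised statistic and its explicit error bound *)

Section KernelStatistic.
Context (R : realType) (d : measure_display) (Omega : measurableType d).
Context (P : probability Omega R).
Local Notation intble f := (integrable P setT (EFin \o f)).

Lemma fine_expectation (f : Omega -> R) : fine ('E_P[f])%E = \int[P]_w f w.
Proof. by rewrite unlock. Qed.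

Section OneSample.
Context (m : nat) (k : R -> R -> R) (X : nat -> {RV P >-> m.-tuple R}).
Hypothesis mk : measurable_fun [set: R * R] (fun z => k z.1 z.2).

Lemma intble_EU4 : (EU4 k X < +oo)%E -> intble (fun w => Ufun k X (X 0%N w) (X 1%N w) ^+ 4).
Proof.
move=> h; apply/integrableP; split.
  apply/measurable_EFinP; apply: measurable_funX.
  exact: (measurableT_comp (measurable_Ufun X mk) (measurable_fun_pair (measurable_funPT (X 0%N)) (measurable_funPT (X 1%N)))).
move: h; rewrite /EU4 unlock; apply: le_lt_trans; rewrite le_eqVlt; apply/orP; left; apply/eqP.
by apply: eq_integral => w _ /=; rewrite ger0_norm// exprn_even_ge0.
Qed.

Lemma measurable_kmat n i s t : measurable_fun setT (fun w => kmat k X n i w s t).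
Proof.
rewrite (_ : (fun w => _) = fun w => if s == t then 0 else
    kcenter k X i (Defs.coord X s i w) (Defs.coord X t i w)); last by apply/funext => w; rewrite mxE.
case: (s == t); first exact: measurable_cst.
exact: (measurableT_comp (measurable_kcenter X mk i) (measurable_fun_pair (measurable_coord X s i) (measurable_coord X t i))).
Qed.

Lemma measurable_ucenter n (A : Omega -> 'M[R]_n) :
  (forall s t, measurable_fun setT (fun w => A w s t)) ->
  forall s t, measurable_fun setT (fun w => ucenter (A w) s t).
Proof.
move=> mA s t; rewrite (_ : (fun w => _) = fun w => if s == t then 0 else
    A w s t - (n%:R - 2)^-1 * (\sum_v A w s v) - (n%:R - 2)^-1 * (\sum_u A w u t)
    + ((n%:R - 1) * (n%:R - 2))^-1 * (\sum_u \sum_v A w u v)); last by apply/funext => w; rewrite mxE.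
case: (s == t); first exact: measurable_cst.
apply: measurable_funD; last first.
  by apply: measurable_funM => //; apply: measurable_sum => a; exact: measurable_sum.
by do !apply: measurable_funB => //; apply: measurable_funM => //; exact: measurable_sum.
Qed.

(* The matrix of the values [U(X_s, X_t)] is the normalised sum of the
   matrices [K(i)], and U-centring is linear. *)
Lemma kmat_sum n w : \matrix_(s, t) kernel_array X (Ufun k X) s t w =
  (Num.sqrt m%:R)^-1 *: \sum_(i < m) kmat k X n i w.
Proof.
apply/matrixP => s t; rewrite !mxE summxE /kernel_array.
case: eqVneq => [st|st].
  by rewrite big1 ?mulr0// => i _; rewrite mxE st eqxx.
by rewrite /Ufun; congr (_ * _); apply: eq_bigr => i _; rewrite mxE (negbTE st).
Qed.

End OneSample.

Context (p q : nat) (k l : R -> R -> R).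
Context (X : nat -> {RV P >-> p.-tuple R}) (Y : nat -> {RV P >-> q.-tuple R}).
Hypothesis mk : measurable_fun [set: R * R] (fun z => k z.1 z.2).
Hypothesis ml : measurable_fun [set: R * R] (fun z => l z.1 z.2).

(** U-centring is linear and [uprod] bilinear, so the double sum over coordinates collapses, each
    sample absorbing its own square root. Linearity is stated for the left factor only, hence the
    repeated use of [uprodC]. *)
Lemma uCov2E n w : uCov2 k l X Y n w =
  uprod (ucenter (\matrix_(s < n, t < n) kernel_array X (Ufun k X) s t w))
        (ucenter (\matrix_(s < n, t < n) kernel_array Y (Ufun l Y) s t w)).
Proof.
rewrite !kmat_sum !ucenterZ !ucenter_sum uprodZl uprodC uprodZl uprodC uprod_suml.
rewrite /uCov2 sqrtrM ?ler0n// invfM -mulrA; congr (_ * (_ * _)).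
apply: eq_bigr => i _; rewrite uprodC uprod_suml; apply: eq_bigr => j _.
by rewrite uprodC.
Qed.

Lemma measurable_uCov2 n : measurable_fun setT (uCov2 k l X Y n).
Proof.
apply: measurable_funM => //; apply: measurable_sum => i; apply: measurable_sum => j.
apply: measurable_funM => //; apply: measurable_sum => s.
under eq_fun do rewrite big_mkcond; apply: measurable_sum => t.
case: (s != t) => //; apply: measurable_funM; apply: measurable_ucenter => a b.
  exact: measurable_kmat.
exact: measurable_kmat.
Qed.

Hypothesis k_sym : forall u v, k u v = k v u.
Hypothesis l_sym : forall u v, l u v = l v u.
Hypothesis XY_iid : iid P (fun s w => (X s w, Y s w)).
Hypothesis k_int : kernel_integrable k X.
Hypothesis l_int : kernel_integrable l Y.
Hypothesis H0 : independent_pair P (X 0%N) (Y 0%N).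
Hypothesis U_mom : (0 < EU2 k X /\ EU4 k X < +oo)%E.
Hypothesis V_mom : (0 < EU2 l Y /\ EU4 l Y < +oo)%E.
Variable n : nat.
Hypothesis n6 : (6 <= n)%N.

Let iidX := iid_fst XY_iid.
Let iidY := iid_snd XY_iid.

(** [fine] sends +oo to 0, so finiteness of the second moment, inherited from the fourth, is needed
    for positivity. *)
Let EU2_gt0 : 0 < fine (EU2 k X).
Proof.
have [h h4] := U_mom; rewrite fine_gt0// h /=.
rewrite /EU2 unlock ltey_eq; apply/orP; left; apply: integrable_fin_num => //.
exact: (intble_expr2 (measurable_Ufun X mk) (intble_EU4 mk h4)).
Qed.

Let EV2_gt0 : 0 < fine (EU2 l Y).
Proof.
have [h h4] := V_mom; rewrite fine_gt0// h /=.
rewrite /EU2 unlock ltey_eq; apply/orP; left; apply: integrable_fin_num => //.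
exact: (intble_expr2 (measurable_Ufun Y ml) (intble_EU4 ml h4)).
Qed.

Let S := Sscale k l X Y.

Let S_gt0 : 0 < S. Proof. by rewrite sqrtr_gt0 mulr_gt0. Qed.

Let S_sqr : S ^+ 2 = fine (EU2 k X) * fine (EU2 l Y).
Proof. by rewrite sqr_sqrtr// ltW// mulr_gt0. Qed.

Definition normalized_uCov2 (w : Omega) : R := Num.sqrt 'C(n, 2)%:R * (uCov2 k l X Y n w / S).

Lemma nb_pairs_bin : nb_pairs R n = 'C(n, 2)%:R.
Proof.
have h : 'C(n, 2)%:R * 2 = n%:R * (n%:R - 1) :> R.
  have := bin_ffact n 2; rewrite ffactnS ffactn1 => /(congr1 (fun m => m%:R : R)).
  rewrite !natrM -subn1 natrB//; exact: leq_trans n6.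
by rewrite /nb_pairs -h mulfK.
Qed.

Let a := fine (EU4 k X) / (Num.sqrt n%:R * fine (EU2 k X) ^+ 2).
Let b := fine (EU4 l Y) / (Num.sqrt n%:R * fine (EU2 l Y) ^+ 2).
Let kap := `|fine (EUcycle k X) / fine (EU2 k X) ^+ 2| * `|fine (EUcycle l Y) / fine (EU2 l Y) ^+ 2|.

Let x : R := n%:R.
Let x6 : 6 <= x. Proof. by rewrite /x (ler_nat R 6). Qed.

(** Everything is expressed by rho = (n / (n - 1))^2, since c^4 n^4 = 4 rho. For n >= 6, rho - 1 <=
    8 / n and rho <= 4; so 8 = 4 * 2 and 80 = 4 * 20, with 20 = 5 * 4. *)
Lemma error_le (A B kk : R) : 0 <= A -> 0 <= B -> 0 <= kk ->
  4^-1 * (Num.sqrt (nb_pairs R n))^-1 ^+ 4 * x ^+ 4 * (1 + 2 * kk) - 1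
    + 5 * (Num.sqrt (nb_pairs R n))^-1 ^+ 4 * x ^+ 3 * (x * (A * B)) <=
  8 / x + 8 * kk + 80 * (A * B).
Proof.
move=> A0 B0 kk0.
have x0 : 0 < x by have := x6; lra.
have x1 : 0 < x - 1 by have := x6; lra.
have xn0 : x != 0 by rewrite gt_eqF.
have x1n0 : x - 1 != 0 by rewrite gt_eqF.
have N0 : 0 < nb_pairs R n by rewrite /nb_pairs -/x divr_gt0// mulr_gt0.
pose rho := (x / (x - 1)) ^+ 2.
have c4 : (Num.sqrt (nb_pairs R n))^-1 ^+ 4 = 4 * rho / x ^+ 4.
  rewrite -[4%N]/(2 * 2)%N exprM exprVn sqr_sqrtr ?ltW// /nb_pairs -/x /rho.
  by field; rewrite xn0 x1n0.
have -> : 4^-1 * (Num.sqrt (nb_pairs R n))^-1 ^+ 4 * x ^+ 4 * (1 + 2 * kk) - 1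
    + 5 * (Num.sqrt (nb_pairs R n))^-1 ^+ 4 * x ^+ 3 * (x * (A * B)) =
    rho - 1 + rho * (2 * kk) + rho * (20 * (A * B)) by rewrite c4; field.
have r1 : rho - 1 <= 8 / x.
  have -> : rho - 1 = (2 * x - 1) / (x - 1) ^+ 2 by rewrite /rho; field.
  rewrite ler_pdivrMr ?exprn_gt0// mulrAC ler_pdivlMr//.
  have := x6; nra.
have r4 : rho <= 4.
  have : 8 / x <= 8 / 6 by rewrite ler_pM2l// lef_pV2// posrE.
  move: r1; lra.
have k2 : 0 <= 2 * kk by rewrite mulr_ge0.
have ab2 : 0 <= 20 * (A * B) by rewrite mulr_ge0// mulr_ge0.
have := ler_wpM2r k2 r4; have := ler_wpM2r ab2 r4; lra.
Qed.

Section Smooth.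
Variables (g dg f df ddf : R -> R) (K C lam : R).
Hypotheses (Hg : forall x : R, is_derive x 1 g (dg x))
  (gK : forall x, `|g x| <= K) (dgK : forall x, `|dg x| <= K)
  (Hf : forall x : R, is_derive x 1 f (df x))
  (Hdf : forall x : R, is_derive x 1 df (ddf x))
  (fC : forall x, [/\ `|f x| <= C, `|df x| <= C & `|ddf x| <= C])
  (stein : forall x, df x - x * f x = g x)
  (lam0 : 0 < lam).

Let D := dsum (product_array X Y (Ufun k X) (Ufun l Y) (n := n) S) (Num.sqrt (nb_pairs R n))^-1.

Let normalizedE w : normalized_uCov2 w = ustat X Y (Ufun k X) (Ufun l Y) n S w.
Proof. by rewrite /normalized_uCov2 /ustat -nb_pairs_bin uCov2E. Qed.

(** The first summand is the cost of replacing the statistic by W, through the Lipschitz bound on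
    [g] and the second moment of the remainder; the second is the Stein bound for W. *)
Lemma smooth_bound : `|\int[P]_w g (normalized_uCov2 w)| <=
  K * (lam + lam^-1 * (240 / n%:R)) +
  C * (2 * lam + lam^-1 * (8 / n%:R + 8 * kap + 80 * (a * b))).
Proof.
have [_ U4] := U_mom; have [_ V4] := V_mom.
have iU4 := intble_EU4 mk U4; have iV4 := intble_EU4 ml V4.
have mU := measurable_Ufun X mk; have mV := measurable_Ufun Y ml.
have UC := UfunC mk k_sym iidX k_int; have VC := UfunC ml l_sym iidY l_int.
have Udeg := Ufun_degenerate mk k_sym iidX k_int; have Vdeg := Ufun_degenerate ml l_sym iidY l_int.
have SS : S ^+ 2 = (\int[P]_w Ufun k X (X 0%N w) (X 1%N w) ^+ 2) * (\int[P]_w Ufun l Y (Y 0%N w) (Y 1%N w) ^+ 2).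
  by rewrite S_sqr !fine_expectation.
have c2 := pairs_scale R n6.
have bound := product_stein_bound XY_iid H0 mU UC Udeg iU4 mV VC iV4 S_gt0 SS Hf Hdf fC lam0 c2.
have [irem rem] := remainder_sqr XY_iid H0 mU UC Udeg iU4 mV VC Vdeg iV4 S_gt0 SS n6.
have li : 0 <= lam^-1 by rewrite invr_ge0 ltW.
have K0 : 0 <= K by apply: le_trans (gK 0); exact: normr_ge0.
have C0 : 0 <= C by have [h _ _] := fC 0; apply: le_trans h; exact: normr_ge0.
have mg : measurable_fun setT g.
  apply: continuous_measurable_fun => z.
  by apply: differentiable_continuous; apply/derivable1_diffP; exact: ex_derive.
have mT : measurable_fun setT normalized_uCov2.
  by apply: measurable_funM => //; apply: measurable_funM => //; exact: measurable_uCov2.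
have mD : measurable_fun setT D.
  by apply: measurable_dsum; exact: measurable_product_array.
have igT : intble (fun w => g (normalized_uCov2 w)).
  by apply: (@bounded_integrable _ _ _ P _ K) => //; exact: (measurableT_comp mg mT).
have igD : intble (fun w => g (D w)).
  by apply: (@bounded_integrable _ _ _ P _ K) => //; exact: (measurableT_comp mg mD).
have i1 r : intble (fun=> r) by exact: finite_measure_integrable_cst.
have -> : \int[P]_w g (normalized_uCov2 w) =
    \int[P]_w (g (normalized_uCov2 w) - g (D w)) + \int[P]_w g (D w).
  by rewrite RintegralB// subrK.
apply: (le_trans (ler_normD _ _)); apply: lerD.
  have idiff : intble (fun w => g (normalized_uCov2 w) - g (D w)) by exact: intbleB.
  apply: (le_trans (le_normr_Rintegral measurableT idiff)).
  pose m w := K * lam + K * lam^-1 * (normalized_uCov2 w - D w) ^+ 2.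
  have irem' : intble (fun w => (normalized_uCov2 w - D w) ^+ 2).
    by apply: intble_ext irem => w; rewrite normalizedE.
  have im : intble m by apply: intbleD => //; exact: intbleZ.
  apply: (@le_trans _ _ (\int[P]_w m w)).
    apply: le_Rintegral => //; first exact: integrable_norm.
    move=> w _; rewrite /m -mulrA -mulrDr.
    apply: le_trans (ler_wpM2l K0 (amgm _ lam0)).
    have [z _ ->] := mean_value (D w) (normalized_uCov2 w) Hg.
    by rewrite normrM ler_wpM2r.
  rewrite /m RintegralD//; last exact: intbleZ.
  rewrite Rintegral_cst// probability_fine mulr1 RintegralZl// mulrDr lerD2l -mulrA.
  rewrite ler_wpM2l// ler_wpM2l//.
  apply: le_trans rem; rewrite le_eqVlt; apply/orP; left; apply/eqP.
  by apply: eq_Rintegral => w _; rewrite normalizedE.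
have -> : \int[P]_w g (D w) = \int[P]_w (df (D w) - D w * f (D w)).
  by apply: eq_Rintegral => w _; rewrite stein.
apply: (le_trans bound); rewrite ler_wpM2l// lerD2l ler_wpM2l//.
have age0 : 0 <= a.
  apply: divr_ge0; last by apply: mulr_ge0; [exact: sqrtr_ge0|exact: sqr_ge0].
  by rewrite fine_expectation; apply: Rintegral_ge0 => w _; exact: exprn_even_ge0.
have bge0 : 0 <= b.
  apply: divr_ge0; last by apply: mulr_ge0; [exact: sqrtr_ge0|exact: sqr_ge0].
  by rewrite fine_expectation; apply: Rintegral_ge0 => w _; exact: exprn_even_ge0.
have kap0 : 0 <= kap by exact: mulr_ge0.
apply: le_trans (error_le age0 bge0 kap0).
rewrite /kap !fine_expectation -/x lerD2l.
rewrite le_eqVlt; apply/orP; left; apply/eqP; congr (_ * _).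
have x0 : 0 < x by have := x6; lra.
have sx : Num.sqrt x != 0 by rewrite gt_eqF// sqrtr_gt0.
have u2 : fine (EU2 k X) != 0 by rewrite gt_eqF.
have v2 : fine (EU2 l Y) != 0 by rewrite gt_eqF.
transitivity (fine (EU4 k X) / fine (EU2 k X) ^+ 2 * (fine (EU4 l Y) / fine (EU2 l Y) ^+ 2)).
  by rewrite !fine_expectation.
(* Writing n as the square of its root shows that the fourth-moment bound is n times [a * b]: each
   ratio takes one factor sqrt n. *)
rewrite /a /b -/x -{1}(sqr_sqrtr (ltW x0)).
by field; rewrite sx u2 v2.
Qed.

End Smooth.

End KernelStatistic.

(** * Passage to the limit *)

Lemma cvg_inv_nat (R : realType) (I : Type) (F : set_system I) (FF : ProperFilter F)
  (N : I -> nat) : N i @[i --> F] --> \oo -> (N i)%:R^-1 @[i --> F] --> (0 : R).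
Proof.
move=> NF; apply/cvgrPdist_le => e e0.
have [m _ hm] := near_infty_natSinv_lt (PosNum e0).
near=> i.
rewrite sub0r normrN ger0_norm ?invr_ge0//.
have mi : (m.+1 <= N i)%N by near: i; exact: NF (nbhs_infty_ge m.+1).
have /= := hm (N i).-1; rewrite prednK ?(leq_trans _ mi)// => h.
by apply/ltW/h; rewrite -ltnS prednK ?(leq_trans _ mi).
Unshelve. all: by end_near. Qed.

(* MathComp-Analysis.  The index t = ((n, p), q) runs along an arbitrary filter
   F on which min(n, p, q) tends to infinity: the joint limit over all (n, p, q)
   as well as the limit along any sequence of triples. *)
Theorem theorem3p2p1 (R : realType) (k l : R -> R -> R)
  (k_meas : measurable_fun [set: R * R] (fun z => k z.1 z.2))
  (l_meas : measurable_fun [set: R * R] (fun z => l z.1 z.2))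
  (k_sym : forall u v, k u v = k v u)
  (l_sym : forall u v, l u v = l v u)
  (d : nat -> nat -> measure_display)
  (Omega : forall p q, measurableType (d p q))
  (P : forall p q, probability (Omega p q) R)
  (X : forall p q, nat -> {RV (P p q) >-> p.-tuple R})
  (Y : forall p q, nat -> {RV (P p q) >-> q.-tuple R})
  (XY_iid : forall p q, iid (P p q) (fun s w => (X p q s w, Y p q s w)))
  (k_int : forall p q, kernel_integrable k (X p q))
  (l_int : forall p q, kernel_integrable l (Y p q))
  (H0 : forall p q, independent_pair (P p q) (X p q 0%N) (Y p q 0%N))
  (F : set_system (nat * nat * nat)) (FF : ProperFilter F)
  (F_oo : minn (minn t.1.1 t.1.2) t.2 @[t --> F] --> \oo)
  (U_mom : \forall t \near F, (0 < EU2 k (X t.1.2 t.2) /\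
                                EU4 k (X t.1.2 t.2) < +oo)%E)
  (V_mom : \forall t \near F, (0 < EU2 l (Y t.1.2 t.2) /\
                                EU4 l (Y t.1.2 t.2) < +oo)%E)
  (U_4 : fine (EU4 k (X t.1.2 t.2))
           / (Num.sqrt t.1.1%:R * fine (EU2 k (X t.1.2 t.2)) ^+ 2)
         @[t --> F] --> (0 : R))
  (U_cycle : fine (EUcycle k (X t.1.2 t.2)) / fine (EU2 k (X t.1.2 t.2)) ^+ 2
         @[t --> F] --> (0 : R))
  (V_4 : fine (EU4 l (Y t.1.2 t.2))
           / (Num.sqrt t.1.1%:R * fine (EU2 l (Y t.1.2 t.2)) ^+ 2)
         @[t --> F] --> (0 : R))
  (V_cycle : fine (EUcycle l (Y t.1.2 t.2)) / fine (EU2 l (Y t.1.2 t.2)) ^+ 2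
         @[t --> F] --> (0 : R)) :
  cvg_in_distribution F (fun t => P t.1.2 t.2)
    (fun t w => Num.sqrt 'C(t.1.1, 2)%:R
       * (uCov2 k l (X t.1.2 t.2) (Y t.1.2 t.2) t.1.1 w
          / Sscale k l (X t.1.2 t.2) (Y t.1.2 t.2)))
    (normal_prob 0 1).
Proof.
have mT t : measurable_fun setT (normalized_uCov2 k l (X t.1.2 t.2) (Y t.1.2 t.2) t.1.1).
  by apply: measurable_funM => //; apply: measurable_funM => //; exact: measurable_uCov2.
apply: (@cvg_normal_of_smooth R _ F FF (fun t => d t.1.2 t.2) (fun t => Omega t.1.2 t.2)
  (fun t => P t.1.2 t.2) (fun t => normalized_uCov2 k l (X t.1.2 t.2) (Y t.1.2 t.2) t.1.1)) => //.
move=> g dg K Hg gK dgK g0.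
have gM x : `|g x| <= `|K| by apply: le_trans (gK x) (ler_norm _).
have dgM x : `|dg x| <= `|K| by apply: le_trans (dgK x) (ler_norm _).
have [f [df [ddf [C [Hf Hdf fC stein]]]]] := stein_solution Hg gM dgM g0.
have C0 : 0 <= C by have [h _ _] := fC 0; apply: le_trans h; exact: normr_ge0.
have n_oo : t.1.1 @[t --> F] --> \oo.
  move=> A [m _ hm].
  have mF : F [set t | (m <= minn (minn t.1.1 t.1.2) t.2)%N] by exact: (F_oo _ (nbhs_infty_ge m)).
  change (F [set t | A t.1.1]); apply: (filterS _ mF) => t /= mt.
  by apply: hm; rewrite /= (leq_trans mt)// !geq_min leqnn.
have ninv : t.1.1%:R^-1 @[t --> F] --> (0 : R) by exact: cvg_inv_nat.
apply/cvgrPdist_le => e e0.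
(* Chosen so that the terms proportional to [lam], with total factor [|K| + 2 C], stay below e/2;
   the + 1 keeps the denominator positive. *)
pose lam := e / (2 * (`|K| + 2 * C + 1)).
have den0 : 0 < 2 * (`|K| + 2 * C + 1) by have := normr_ge0 K; move: C0; lra.
have lam0 : 0 < lam by rewrite divr_gt0.
pose a (t : nat * nat * nat) := fine (EU4 k (X t.1.2 t.2)) / (Num.sqrt t.1.1%:R * fine (EU2 k (X t.1.2 t.2)) ^+ 2).
pose b (t : nat * nat * nat) := fine (EU4 l (Y t.1.2 t.2)) / (Num.sqrt t.1.1%:R * fine (EU2 l (Y t.1.2 t.2)) ^+ 2).
pose cu (t : nat * nat * nat) := fine (EUcycle k (X t.1.2 t.2)) / fine (EU2 k (X t.1.2 t.2)) ^+ 2.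
pose cv (t : nat * nat * nat) := fine (EUcycle l (Y t.1.2 t.2)) / fine (EU2 l (Y t.1.2 t.2)) ^+ 2.
(* The part of [smooth_bound] that carries [lam^-1]. As [lam] is already fixed, it tends to 0 by the
   moment conditions and 1/n -> 0. *)
pose err (t : nat * nat * nat) : R := `|K| * (lam^-1 * (240 * t.1.1%:R^-1)) +
  C * (lam^-1 * (8 * t.1.1%:R^-1 + 8 * (`|cu t| * `|cv t|) + 80 * (a t * b t))).
have err0 : err t @[t --> F] --> (0 : R).
  have -> : (0 : R) = `|K| * (lam^-1 * (240 * 0)) +
      C * (lam^-1 * (8 * 0 + 8 * (`|0 : R| * `|0 : R|) + 80 * (0 * 0))).
    by rewrite normr0 !(mulr0, addr0).
  have cst_ (r : R) : r @[_ --> F] --> r by exact: cvg_cst.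
  have hU : `|cu t| @[t --> F] --> `|0 : R| by exact: cvg_norm.
  have hV : `|cv t| @[t --> F] --> `|0 : R| by exact: cvg_norm.
  apply: cvgD; do 2 apply: (cvgM (cst_ _)); first exact: (cvgM (cst_ _)).
  by apply: cvgD; [apply: cvgD|]; apply: (cvgM (cst_ _)) => //; exact: cvgM.
have e2 : 0 < e / 2 by rewrite divr_gt0.
have n6 : \forall t \near F, (6 <= t.1.1)%N by exact: (n_oo _ (nbhs_infty_ge 6)).
near=> t.
rewrite sub0r normrN.
have Ut : (0 < EU2 k (X t.1.2 t.2) /\ EU4 k (X t.1.2 t.2) < +oo)%E by near: t.
have Vt : (0 < EU2 l (Y t.1.2 t.2) /\ EU4 l (Y t.1.2 t.2) < +oo)%E by near: t.
have nt : (6 <= t.1.1)%N by near: t.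
have et : `|0 - err t| <= e / 2 by near: t; move/cvgrPdist_le : err0; apply.
apply: (le_trans (smooth_bound k_meas l_meas k_sym l_sym (XY_iid t.1.2 t.2)
  (k_int t.1.2 t.2) (l_int t.1.2 t.2) (H0 t.1.2 t.2) Ut Vt nt Hg gM dgM Hf Hdf fC stein lam0)).
have le_ : `|K| * lam + C * (2 * lam) <= e / 2.
  have -> : e / 2 = (`|K| + 2 * C + 1) * lam.
    rewrite /lam; field; apply: lt0r_neq0; move: den0; lra.
  by move: (normr_ge0 K) lam0 => *; lra.
move: et; rewrite sub0r normrN => /(le_trans (ler_norm _)).
rewrite /err /a /b /cu /cv !mulrDr; move: le_; lra.
Unshelve. all: by end_near. Qed.
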